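(* Let $n\in\mathbb{N}$, let $\Gamma$ be a countable infinite amenable group of type $\mathrm{FP}_{n+1}$, and let $\alpha$ be a standard $\Gamma$-action. Then $$\mathrm{medim}^Z_n(\alpha)=0\quad\text{if $Z$ is $\mathbb{Z}$ or a finite field},\qquad \mathrm{mevol}_n(\alpha)=0.$$
   Context: $\mathbb{N}$ contains $0$. $Z$ denotes $\mathbb{Z}$ with the usual absolute value or a finite field with the trivial norm ($|0|=0$, $|x|=1$ for $x\neq 0$). A group $\Gamma$ is of type $\mathrm{FP}_m$ if the trivial $\mathbb{Z}\Gamma$-module $\mathbb{Z}$ has a projective resolution that is finitely generated in degrees $\le m$. Standard actions. A standard $\Gamma$-action $\alpha\colon\Gamma\curvearrowright(X,\mu)$ is an essentially free, probability measure preserving action of a countable group on a standard Borel probability space. $L^\infty(\alpha,Z)=L^\infty(X,\mu,Z)$ is the ring of essentially bounded measurable functions $X\to Z$ modulo a.e. equality, with $(\gamma\cdot\lambda)(x)=\lambda(\gamma^{-1}x)$. The crossed product ring $R=L^\infty(\alpha,Z)*\Gamma$ is the free $L^\infty(\alpha,Z)$-module with basis $\Gamma$ (elements are finite sums of terms $(\lambda,\gamma)$) with multiplication $(\lambda,\gamma)(\lambda',\gamma')=(\lambda\cdot(\gamma\cdot\lambda'),\gamma\gamma')$. It contains $Z\Gamma$ via $\gamma\mapsto(1,\gamma)$ and acts on $L^\infty(\alpha,Z)$ by $(\lambda,\gamma)\cdot f=\lambda\cdot(\gamma\cdot f)$. Marked modules. For measurable $A\subset X$ put $\langle A\rangle=R\cdot(\chi_A,1)$.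 A marked projective $R$-module is an $R$-module $M$ with a finite family $(A_i)_{i\in I}$ of measurable subsets of $X$ and an isomorphism $M\cong\bigoplus_{i\in I}\langle A_i\rangle$ (suppressed from notation); $\dim_R(M)=\sum_i\mu(A_i)$. On $R$ let $|\sum_\gamma(\lambda_\gamma,\gamma)|_1=\sum_\gamma\int_X|\lambda_\gamma|\,d\mu$; elements of $M\subset\bigoplus_I R$ have norm $\|\sum_i\lambda_ie_i\|_1=\sum_i|\lambda_i|_1$. For an $R$-homomorphism $f\colon M\to N$ of marked projective modules, $\|f\|$ is the least $c$ with $\|f(z)\|_1\le c\|z\|_1$ for all $z$ (always finite). A marked direct summand of $\bigoplus_j\langle B_j\rangle$ is a submodule $\bigoplus_j\langle B_j'\rangle$ with $B_j'\subset B_j$ measurable. A finite marked decomposition of $M=\bigoplus_i\langle A_i\rangle$ is a finite family $(M_k)_k$ with $M_k=\bigoplus_i\langle A_{i,k}\rangle$ for measurable partitions $A_i=\bigsqcup_kA_{i,k}$. Logarithmic norm. $\log_+(t)=\max\{\log t,0\}$ (and $\log_+0=0$). $\mathrm{rk}(f)=\inf\{\dim N'\mid N'\subset N\text{ marked direct summand with }f(M)\subset N'\}$; $\mathrm{lognorm}'(f)=\min\{\dim(M)\log_+\|f\|,\ \mathrm{rk}(f)\log_+\|f\|\}$; $\mathrm{lognorm}(f)=\inf\sum_k\mathrm{lognorm}'(f|_{M_k}\colon M_k\to N)$, the infimum over all finite marked decompositions $(M_k)_k$ of $M$. Measured embeddings. A marked projective augmented $R$-chain complex $D_*\twoheadrightarrow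 L^\infty(\alpha,Z)$ is a chain complex $(D_k)_{k\ge0}$ of marked projective $R$-modules with a surjective $R$-homomorphism $\eta\colon D_0\to L^\infty(\alpha,Z)$, $\eta\circ\partial_1=0$. Fix a free $Z\Gamma$-resolution $C_*\twoheadrightarrow Z$ (the following is independent of the choice). An $\alpha$-embedding (up to degree $n$) is such a complex together with a $Z\Gamma$-chain map $C_*\to D_*$ up to degree $n+1$ extending the inclusion $Z\to L^\infty(\alpha,Z)$ as constant functions. $A_n(\alpha)$ is the class of all augmented complexes $D_*$ arising in this way. For $\Gamma$ of type $\mathrm{FP}_{n+1}$: $\mathrm{medim}^Z_n(\alpha)=\inf_{D_*\in A_n(\alpha)}\dim_R(D_n)$, and (for $Z=\mathbb{Z}$) $\mathrm{mevol}_n(\alpha)=\inf_{D_*\in A_n(\alpha)}\mathrm{lognorm}(\partial^D_{n+1})$. *)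

(* Defs.v *)
From HB Require Import structures.
From mathcomp Require Import all_boot all_order all_algebra.
From mathcomp Require Import ring_quotient.
From mathcomp Require Import all_classical all_reals all_analysis.

Set Implicit Arguments.
Unset Strict Implicit.
Unset Printing Implicit Defensive.

Import Order.TTheory GRing.Theory Num.Theory.

Local Open Scope quotient_scope.
Local Open Scope classical_set_scope.
Local Open Scope ring_scope.

Section FiniteSums.
Variables (G : choiceType) (V : nmodType).
Implicit Types (F : G -> V) (s : seq G).

Definition finsupp F : Prop := finite_set [set g | F g != 0].

Lemma finsupp_seq F : finsupp F ->
  exists2 s, uniq s & forall g, F g != 0 -> g \in s.
Proof.
move=> /finite_seqP[s sE]; exists (undup s); first exact: undup_uniq.
by move=> g Fg; rewrite mem_undup; have : [set g | F g != 0] g by []; rewrite sE.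
Qed.

Lemma seq_finsupp F s : (forall g, F g != 0 -> g \in s) -> finsupp F.
Proof.
move=> sF; apply: (@sub_finite_set _ _ [set` s]); last exact: finite_seq.
by move=> g /= /sF.
Qed.

Lemma fsumE F s : uniq s -> (forall g, F g != 0 -> g \in s) ->
  \sum_(g \in [set: G]) F g = \sum_(g <- s) F g.
Proof.
move=> us sF; rewrite (fsbigE s)//; last first.
  by move=> g _ gs; apply/eqP; apply: contraNT gs => /sF.
by apply: eq_bigl => g; rewrite in_setT.
Qed.

End FiniteSums.

Record ringAction (G : groupType) (L : nzRingType) := RingAction {
  ract :> G -> {rmorphism L -> L};
  ract1 : forall x, ract 1%g x = x;
  ractM : forall g h x, ract (g * h)%g x = ract g (ract h x)
}.

Section Crossed.
Variables (G : groupType) (L : nzRingType).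

Definition crossed_pred : {pred G -> L} := fun f => `[< finsupp f >].

(* The crossed product [L * G]: a finite sum of terms [(l, g)] is the finitely
   supported function sending each [g] to its coefficient. *)
Definition crossed (a : ringAction G L) : Type := {f : G -> L | f \in crossed_pred}.

Lemma crossed_zmod_closed : zmod_closed crossed_pred.
Proof.
split=> [|f g /asboolP/finsupp_seq[s us sf] /asboolP/finsupp_seq[t ut tg]].
  by apply/asboolP/(@seq_finsupp _ _ _ [::]) => g; rewrite eqxx.
apply/asboolP/(@seq_finsupp _ _ _ (s ++ t)) => x.
rewrite mem_cat; apply: contraR; rewrite negb_or => /andP[xs xt].
have /eqP fx : f x == 0 by apply: contraR xs => /sf.
have /eqP gx : g x == 0 by apply: contraR xt => /tg.
by rewrite -[(f - g) x]/(f x - g x) fx gx subrr.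
Qed.

HB.instance Definition _ :=
  GRing.isZmodClosed.Build (G -> L) crossed_pred crossed_zmod_closed.

Variable a : ringAction G L.

HB.instance Definition _ := [isSub of crossed a for @sval _ _].
HB.instance Definition _ := [Choice of crossed a by <:].
HB.instance Definition _ := [SubChoice_isSubZmodule of crossed a by <:].

Definition coeff (r : crossed a) : G -> L := val r.

Lemma coeff_finsupp r : finsupp (coeff r).
Proof. exact/asboolP/(valP r). Qed.

Lemma crossedP (r s : crossed a) : (forall g, coeff r g = coeff s g) -> r = s.
Proof. by move=> rs; apply/val_inj/funext. Qed.

Lemma coeffD r s g : coeff (r + s) g = coeff r g + coeff s g.
Proof. by []. Qed.

Definition monom_fun (l : L) (g : G) : G -> L := fun h => if h == g then l else 0.

Lemma monom_subproof l g : monom_fun l g \in crossed_pred.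
Proof.
apply/asboolP/(@seq_finsupp _ _ _ [:: g]) => h; rewrite /monom_fun inE.
by case: ifP => //; rewrite eqxx.
Qed.

(* the element (l, g) *)
Definition monom l g : crossed a := exist _ (monom_fun l g) (monom_subproof l g).

(* Collecting the terms over [k] in (l, h) (l', h') = (l * h l', h h'). *)
Definition cmul_fun (r s : crossed a) : G -> L := fun k =>
  \sum_(h \in [set: G]) coeff r h * a h (coeff s (h^-1 * k)%g).

Lemma cmul_funE (r s : crossed a) (S : seq G) k : uniq S ->
    (forall h, coeff r h != 0 -> h \in S) ->
  cmul_fun r s k = \sum_(h <- S) coeff r h * a h (coeff s (h^-1 * k)%g).
Proof.
move=> uS rS; apply: fsumE => // h; apply: contraR => hS.
have /eqP-> : coeff r h == 0 by apply: contraR hS => /rS.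
by rewrite mul0r.
Qed.

Lemma cmul_fun_supp (r s : crossed a) (S T : seq G) k :
    (forall h, coeff r h != 0 -> h \in S) ->
    (forall h, coeff s h != 0 -> h \in T) ->
  cmul_fun r s k != 0 -> k \in [seq (h * t)%g | h <- S, t <- T].
Proof.
move=> rS sT; apply: contraR => kST; rewrite /cmul_fun fsbig1// => h _.
have [->|rh] := eqVneq (coeff r h) 0; first by rewrite mul0r.
have [->|sh] := eqVneq (coeff s (h^-1 * k)%g) 0; first by rewrite rmorph0 mulr0.
case/negP: kST; apply/allpairsP; exists (h, (h^-1 * k)%g) => /=.
by rewrite rS// sT// mulVKg.
Qed.

Lemma cmul_subproof r s : cmul_fun r s \in crossed_pred.
Proof.
have [S _ rS] := finsupp_seq (coeff_finsupp r).
have [T _ sT] := finsupp_seq (coeff_finsupp s).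
by apply/asboolP/seq_finsupp => k; apply: cmul_fun_supp rS sT.
Qed.

Definition cone : crossed a := monom 1 1%g.
Definition cmul r s : crossed a := exist _ (cmul_fun r s) (cmul_subproof r s).

Lemma coeffM (r s : crossed a) (S : seq G) k : uniq S ->
    (forall h, coeff r h != 0 -> h \in S) ->
  coeff (cmul r s) k = \sum_(h <- S) coeff r h * a h (coeff s (h^-1 * k)%g).
Proof. exact: cmul_funE. Qed.

Lemma cmulA : associative cmul.
Proof.
move=> r s t; apply: crossedP => k.
have [S uS rS] := finsupp_seq (coeff_finsupp r).
have [T uT sT] := finsupp_seq (coeff_finsupp s).
set U := undup [seq (h * t)%g | h <- S, t <- T].
have uU : uniq U by exact: undup_uniq.
rewrite (coeffM _ _ uS rS) (@coeffM _ _ U)//; last first.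
  by move=> h; rewrite mem_undup; apply: cmul_fun_supp rS sT.
under [RHS]eq_bigr do rewrite (coeffM _ _ uS rS) big_distrl.
rewrite exchange_big/= !big_seq; apply: eq_bigr => h hS.
set F := fun u => coeff r h * a h (coeff s (h^-1 * u)%g) * a u (coeff t (u^-1 * k)%g).
have sF x : coeff s x = 0 -> F (h * x)%g = 0.
  by rewrite /F mulKg => ->; rewrite rmorph0 mulr0 mul0r.
rewrite -(@fsumE _ _ F U)//; last first.
  move=> g Fg; rewrite mem_undup; apply/allpairsP.
  exists (h, (h^-1 * g)%g) => /=; rewrite hS mulVKg; split => //.
  by apply/sT; apply: contraNneq Fg => /sF; rewrite mulVKg => ->.
rewrite (reindex_fsbigT (fun x => (h * x)%g)); last first.
  by exists (fun x => (h^-1 * x)%g) => x; rewrite ?mulKg ?mulVKg.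
rewrite (@fsumE _ _ _ T)//; last first.
  by move=> g; apply: contraR => gT; rewrite sF//; apply/eqP; apply: contraR gT => /sT.
rewrite (coeffM _ _ uT sT) rmorph_sum mulr_sumr; apply: eq_bigr => x _.
by rewrite /F mulKg invgM rmorphM -mulgA ractM mulrA.
Qed.

Lemma cone_supp h : coeff cone h != 0 -> h \in [:: 1%g].
Proof. by rewrite inE /coeff/= /monom_fun; case: (h == _) => //; rewrite eqxx. Qed.

Lemma cmul1r : left_id cone cmul.
Proof.
move=> r; apply: crossedP => k; rewrite (coeffM _ _ _ cone_supp)// big_seq1.
by rewrite /coeff/= /monom_fun eqxx mul1r ract1 invg1 mul1g.
Qed.

Lemma cmulr1 : right_id cone cmul.
Proof.
move=> r; apply: crossedP => k.
have [S uS rS] := finsupp_seq (coeff_finsupp r).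
rewrite (@coeffM _ _ (undup (k :: S)))//; first last.
- by move=> h /rS; rewrite mem_undup inE orbC => ->.
- exact: undup_uniq.
rewrite (bigD1_seq k) ?mem_undup ?mem_head ?undup_uniq//=.
rewrite big1 => [|h hk]; rewrite /coeff/= /monom_fun.
  by rewrite mulVg eqxx rmorph1 mulr1 addr0.
rewrite ifF ?rmorph0 ?mulr0//; apply: contraNF hk => /eqP hk.
by apply/eqP; rewrite -[k](mulVKg h) hk mulg1.
Qed.

Lemma cmulDl : left_distributive cmul +%R.
Proof.
move=> r s t; apply: crossedP => k.
have [S _ rS] := finsupp_seq (coeff_finsupp r).
have [T _ sT] := finsupp_seq (coeff_finsupp s).
have uU : uniq (undup (S ++ T)) by exact: undup_uniq.
have rU h : coeff r h != 0 -> h \in undup (S ++ T).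
  by rewrite mem_undup mem_cat => /rS ->.
have sU h : coeff s h != 0 -> h \in undup (S ++ T).
  by rewrite mem_undup mem_cat => /sT ->; rewrite orbT.
rewrite coeffD (coeffM _ _ uU rU) (coeffM _ _ uU sU) (coeffM _ _ uU); last first.
  move=> h; apply: contraR => hU; rewrite coeffD.
  have /eqP-> : coeff r h == 0 by apply: contraR hU => /rU.
  have /eqP-> : coeff s h == 0 by apply: contraR hU => /sU.
  by rewrite addr0.
by rewrite -big_split; apply: eq_bigr => h _; rewrite coeffD mulrDl.
Qed.

Lemma cmulDr : right_distributive cmul +%R.
Proof.
move=> r s t; apply: crossedP => k.
have [S uS rS] := finsupp_seq (coeff_finsupp r).
rewrite coeffD !(coeffM _ _ uS rS) -big_split; apply: eq_bigr => h _ /=.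
by rewrite coeffD rmorphD mulrDr.
Qed.

Lemma cone_neq0 : cone != 0.
Proof.
apply/eqP => /(congr1 (fun r => coeff r 1%g)) /eqP.
by rewrite /coeff/= /monom_fun eqxx oner_eq0.
Qed.

HB.instance Definition _ := GRing.Zmodule_isNzRing.Build (crossed a)
  cmulA cmul1r cmulr1 cmulDl cmulDr cone_neq0.

Lemma monomM l g l' g' :
  monom l g * monom l' g' = monom (l * a g l') (g * g')%g.
Proof.
apply: crossedP => k; rewrite (@coeffM _ _ [:: g])//; last first.
  by move=> h; rewrite inE /coeff/= /monom_fun; case: (h == g); rewrite ?eqxx.
rewrite big_seq1 /coeff/= /monom_fun eqxx.
have -> : (g^-1 * k == g')%g = (k == g * g')%g.
  by apply/eqP/eqP => [<-|->]; rewrite ?mulVKg ?mulKg.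
by case: (k == _) => //; rewrite rmorph0 mulr0.
Qed.

(* The coefficient ring [L], as a left module over [L * G]:
    (l, g) . x = l * g x. *)
Definition coefMod (_ : ringAction G L) : Type := L.

HB.instance Definition _ := GRing.Zmodule.on (coefMod a).

Definition cact (r : crossed a) (x : coefMod a) : coefMod a :=
  \sum_(g \in [set: G]) coeff r g * a g x.

Lemma cactE (r : crossed a) (S : seq G) x : uniq S ->
    (forall h, coeff r h != 0 -> h \in S) ->
  cact r x = \sum_(g <- S) coeff r g * a g x.
Proof.
move=> uS rS; apply: fsumE => // h; apply: contraR => hS.
have /eqP-> : coeff r h == 0 by apply: contraR hS => /rS.
by rewrite mul0r.
Qed.

Lemma cactA r s x : cact r (cact s x) = cact (r * s) x.
Proof.
have [S uS rS] := finsupp_seq (coeff_finsupp r).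
have [T uT sT] := finsupp_seq (coeff_finsupp s).
set U := undup [seq (h * t)%g | h <- S, t <- T].
have uU : uniq U by exact: undup_uniq.
rewrite [LHS](cactE _ uS rS) [RHS](@cactE _ U)//; last first.
  by move=> h; rewrite mem_undup; exact: (cmul_fun_supp rS sT).
under [RHS]eq_bigr do rewrite (coeffM _ _ uS rS) big_distrl.
rewrite exchange_big/= !big_seq; apply: eq_bigr => h hS.
set F := fun u => coeff r h * a h (coeff s (h^-1 * u)%g) * a u x.
have sF y : coeff s y = 0 -> F (h * y)%g = 0.
  by rewrite /F mulKg => ->; rewrite rmorph0 mulr0 mul0r.
rewrite -(@fsumE _ _ F U)//; last first.
  move=> g Fg; rewrite mem_undup; apply/allpairsP.
  exists (h, (h^-1 * g)%g) => /=; rewrite hS mulVKg; split => //.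
  by apply/sT; apply: contraNneq Fg => /sF; rewrite mulVKg => ->.
rewrite (reindex_fsbigT (fun x => (h * x)%g)); last first.
  by exists (fun x => (h^-1 * x)%g) => y; rewrite ?mulKg ?mulVKg.
rewrite (@fsumE _ _ _ T)//; last first.
  by move=> g; apply: contraR => gT; rewrite sF//; apply/eqP; apply: contraR gT => /sT.
rewrite (cactE _ uT sT) rmorph_sum mulr_sumr; apply: eq_bigr => y _.
by rewrite /F mulKg rmorphM ractM mulrA.
Qed.

Lemma cact1 : left_id 1 cact.
Proof.
move=> x; rewrite (cactE _ _ cone_supp)// big_seq1.
by rewrite /coeff/= /monom_fun eqxx mul1r ract1.
Qed.

Lemma cactDr : right_distributive cact +%R.
Proof.
move=> r x y; have [S uS rS] := finsupp_seq (coeff_finsupp r).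
rewrite !(cactE _ uS rS) -big_split; apply: eq_bigr => h _ /=.
by rewrite rmorphD mulrDr.
Qed.

Lemma cactDl x : {morph cact^~ x : r s / r + s}.
Proof.
move=> r s.
have [S _ rS] := finsupp_seq (coeff_finsupp r).
have [T _ sT] := finsupp_seq (coeff_finsupp s).
have uU : uniq (undup (S ++ T)) by exact: undup_uniq.
have rU h : coeff r h != 0 -> h \in undup (S ++ T).
  by rewrite mem_undup mem_cat => /rS ->.
have sU h : coeff s h != 0 -> h \in undup (S ++ T).
  by rewrite mem_undup mem_cat => /sT ->; rewrite orbT.
rewrite (cactE _ uU rU) (cactE _ uU sU) (cactE _ uU); last first.
  move=> h; apply: contraR => hU; rewrite coeffD.
  have /eqP-> : coeff r h == 0 by apply: contraR hU => /rU.
  have /eqP-> : coeff s h == 0 by apply: contraR hU => /sU.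
  by rewrite addr0.
by rewrite -big_split; apply: eq_bigr => h _; rewrite coeffD mulrDl.
Qed.

HB.instance Definition _ := GRing.Zmodule_isLmodule.Build (crossed a) (coefMod a)
  cactA cact1 cactDr cactDl.

End Crossed.

Section CrossedMap.
Variables (G : groupType) (L L' : nzRingType).
Variables (a : ringAction G L) (a' : ringAction G L') (f : {rmorphism L -> L'}).

Lemma crossed_map_subproof (r : crossed a) : (f \o coeff r) \in crossed_pred (G := G) (L := L').
Proof.
have [S uS rS] := finsupp_seq (coeff_finsupp r).
apply/asboolP/(@seq_finsupp _ _ _ S) => h /=; apply: contraNT => hS.
have /eqP-> : coeff r h == 0 by apply: contraR hS => /rS.
by rewrite rmorph0.
Qed.

(* Coefficientwise application of [f]; a ring morphism if [f] is equivariant. *)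
Definition crossed_map (r : crossed a) : crossed a' :=
  exist _ (f \o coeff r) (crossed_map_subproof r).

End CrossedMap.

Definition trivial_action (G : groupType) (Z : nzRingType) : ringAction G Z :=
  @RingAction G Z (fun=> idfun) (fun=> erefl) (fun _ _ _ => erefl).

(* The group ring [Z G] and the trivial [Z G]-module [Z]. *)
Notation groupRing G Z := (crossed (trivial_action G Z)).
Notation trivialMod G Z := (coefMod (trivial_action G Z)).

Section Homological.
Variable S : nzRingType.

Definition module_basis (M : lmodType S) (B : set M) : Prop :=
  forall x : M, exists! c : M -> S,
    [/\ finsupp c, [set b | c b != 0] `<=` B & x = \sum_(b \in B) c b *: b].

Definition free_module (M : lmodType S) : Prop := exists B, module_basis (M := M) B.

Definition projective_module (P : lmodType S) : Prop :=
  forall (M N : lmodType S) (p : {linear M -> N}) (f : {linear P -> N}),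
    (forall y, exists x, p x = y) ->
    exists g : {linear P -> M}, forall x, p (g x) = f x.

Definition finitely_generated (M : lmodType S) : Prop :=
  exists (k : nat) (e : 'I_k -> M), forall x, exists c : 'I_k -> S,
    x = \sum_(i < k) c i *: e i.

(* [bd k] is the differential of degree k.+1. *)
Record augmentedComplex (N : lmodType S) := AugmentedComplex {
  chain :> nat -> lmodType S;
  bd : forall k, {linear chain k.+1 -> chain k};
  aug : {linear chain 0 -> N};
  bd_bd : forall k x, bd k (bd k.+1 x) = 0;
  aug_bd : forall x, aug (bd 0 x) = 0;
  aug_surj : forall y, exists x, aug x = y
}.

Definition resolution (N : lmodType S) (C : augmentedComplex N) : Prop :=
  (forall x, aug C x = 0 -> exists y, bd C 0 y = x) /\
  (forall k x, bd C k x = 0 -> exists y, bd C k.+1 y = x).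

Definition free_resolution (N : lmodType S) (C : augmentedComplex N) : Prop :=
  resolution C /\ forall k, free_module (C k).

Definition projective_resolution (N : lmodType S) (C : augmentedComplex N) : Prop :=
  resolution C /\ forall k, projective_module (C k).

End Homological.

Definition typeFP (G : groupType) (m : nat) : Prop :=
  exists C : augmentedComplex (trivialMod G int),
    projective_resolution C /\ forall k, (k <= m)%N -> finitely_generated (C k).

Section Amenable.
Variables (R : realType) (G : groupType).

Definition bounded_function (f : G -> R) : Prop :=
  exists c, forall g, `|f g| <= c.

(* A left-invariant mean on the space of bounded functions; the values of [m]
   outside of this space are irrelevant. *)
Definition invariant_mean (m : (G -> R) -> R) : Prop :=
  [/\ forall (c : R) f h, bounded_function f -> bounded_function h ->
        m (fun g => c * f g + h g) = c * m f + m h,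
      forall f, bounded_function f -> (forall g, 0 <= f g) -> 0 <= m f,
      m (fun=> 1) = 1 &
      forall g f, bounded_function f -> m (fun h => f (g^-1 * h)%g) = m f].

Definition amenable : Prop := exists m, invariant_mean m.

End Amenable.

(* Countability makes [Z], with its discrete sigma-algebra, a reasonable target
   for measurable functions; submultiplicativity and subadditivity make the
   essentially bounded functions a ring. *)
Record coefRing (R : realType) := CoefRing {
  coef_ring :> comNzRingType;
  coef_norm : coef_ring -> R;
  coef_countable : countable [set: coef_ring];
  coef_normD : forall x y, coef_norm (x + y) <= coef_norm x + coef_norm y;
  coef_normM : forall x y, coef_norm (x * y) <= coef_norm x * coef_norm y;
  coef_norm_ge0 : forall x, 0 <= coef_norm x
}.
Arguments coef_norm {R} c x.

Section Coefficients.
Variable R : realType.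

Definition int_norm (x : int) : R := `|x|%:~R.

Lemma int_normD x y : int_norm (x + y) <= int_norm x + int_norm y.
Proof. by rewrite /int_norm -intrD ler_int ler_normD. Qed.

Lemma int_normM x y : int_norm (x * y) <= int_norm x * int_norm y.
Proof. by rewrite /int_norm -intrM normrM. Qed.

Lemma int_norm_ge0 x : 0 <= int_norm x.
Proof. by rewrite /int_norm ler0z. Qed.

Definition coefInt : coefRing R := @CoefRing R int int_norm (countableP _)
  int_normD int_normM int_norm_ge0.

Variable F : finFieldType.

Definition fin_norm (x : F) : R := (x != 0)%:R.

Lemma fin_normD x y : fin_norm (x + y) <= fin_norm x + fin_norm y.
Proof.
rewrite /fin_norm -natrD ler_nat; have [->|_] := eqVneq x 0; first by rewrite add0r.
by case: (_ == _) (_ == _) => -[].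
Qed.

Lemma fin_normM x y : fin_norm (x * y) <= fin_norm x * fin_norm y.
Proof. by rewrite /fin_norm -natrM ler_nat mulf_eq0; case: (_ == _) (_ == _) => -[]. Qed.

Lemma fin_norm_ge0 x : 0 <= fin_norm x.
Proof. exact: ler0n. Qed.

Definition coefFin : coefRing R := @CoefRing R F fin_norm (countableP _)
  fin_normD fin_normM fin_norm_ge0.

End Coefficients.

Section Linf.
Variables (R : realType) (d : measure_display) (X : measurableType d).
Variables (mu : probability X R) (Z : coefRing R).

(* measurability for the discrete sigma-algebra on [Z] *)
Definition measurable_discrete (T : Type) (f : X -> T) : Prop :=
  forall B : set T, measurable (f @^-1` B).

Definition ess_bounded (f : X -> Z) : Prop :=
  exists c : R, {ae mu, forall x, coef_norm Z (f x) <= c}.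

Definition bmeas_pred : {pred X -> Z} :=
  fun f => `[< measurable_discrete f /\ ess_bounded f >].

Lemma measurable_discrete2 (f g : X -> Z) (op : Z -> Z -> Z) :
  measurable_discrete f -> measurable_discrete g ->
  measurable_discrete (fun x => op (f x) (g x)).
Proof.
move=> mf mg B.
rewrite (_ : _ @^-1` _ = \bigcup_(z in [set: Z])
    (f @^-1` [set z] `&` g @^-1` [set w | B (op z w)])); last first.
  by apply/seteqP; split=> [x Bx|x [z _ [/= <-]]//]; exists (f x).
apply: countable_bigcupT_measurable => [|z]; first exact: coef_countable.
by apply: measurableI; [exact: mf|exact: mg].
Qed.

Lemma bmeas_subring_closed : subring_closed bmeas_pred.
Proof.
split=> [|f g /asboolP[mf [c fc]] /asboolP[mg [e ge]]|
          f g /asboolP[mf [c fc]] /asboolP[mg [e ge]]].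
- apply/asboolP; split; last by exists (coef_norm Z 1); apply: aeW.
  move=> B; have [B1|B1] := pselect (B 1).
    by rewrite (_ : _ @^-1` _ = setT)//; apply/seteqP; split.
  by rewrite (_ : _ @^-1` _ = set0)//; apply/seteqP; split.
- apply/asboolP; split; first exact: (measurable_discrete2 (fun z w => z - w) mf mg).
  exists (c + coef_norm Z (-1) * e); apply: filterS2 fc ge => x fx gx.
  rewrite -[(f - g) x]/(f x - g x) (le_trans (coef_normD _ _))// lerD//.
  by rewrite -mulN1r (le_trans (coef_normM _ _))// ler_wpM2l// coef_norm_ge0.
- apply/asboolP; split; first exact: (measurable_discrete2 (fun z w => z * w) mf mg).
  exists (c * e); apply: filterS2 fc ge => x fx gx.
  rewrite -[(f * g) x]/(f x * g x) (le_trans (coef_normM _ _))//.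
  by rewrite ler_pM// coef_norm_ge0.
Qed.

HB.instance Definition _ :=
  GRing.isSubringClosed.Build (X -> Z) bmeas_pred bmeas_subring_closed.

Definition bmeas : Type := {f : X -> Z | f \in bmeas_pred}.

HB.instance Definition _ := [isSub of bmeas for @sval _ _].
HB.instance Definition _ := [Choice of bmeas by <:].
HB.instance Definition _ := [SubChoice_isSubComNzRing of bmeas by <:].

Definition bmeas_fun (f : bmeas) : X -> Z := val f.

Definition ae_zero : {pred bmeas} :=
  fun f => `[< {ae mu, forall x, bmeas_fun f x = 0} >].

Lemma ae_zero_ideal : idealr_closed ae_zero.
Proof.
split.
- exact/asboolP/aeW.
- apply/negP => /asboolP; move=> [N [mN N0 sub]].
  have : mu setT = 0%E.
    apply: subset_measure0 (mN) _ N0 => // x _; apply: sub => /= /eqP.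
    by rewrite oner_eq0.
  by rewrite probability_setT => /eqP; rewrite onee_eq0.
- move=> f g h /asboolP g0 /asboolP h0; apply/asboolP; apply: filterS2 g0 h0 => x gx hx.
  rewrite -[bmeas_fun _ x]/(bmeas_fun f x * bmeas_fun g x + bmeas_fun h x).
  by rewrite gx hx mulr0 addr0.
Qed.

HB.instance Definition _ := isIdealr.Build bmeas ae_zero ae_zero_ideal.

Definition Linf : Type := {ideal_quot ae_zero}.

HB.instance Definition _ := GRing.ComNzRing.on Linf.
HB.instance Definition _ := EqQuotient.on Linf.

Definition Linf_class (f : bmeas) : Linf := \pi_Linf f.

Lemma Linf_class_zmod : zmod_morphism Linf_class.
Proof. by move=> f g; rewrite /Linf_class rmorphB. Qed.

Lemma Linf_class_monoid : monoid_morphism Linf_class.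
Proof. by split=> [|f g]; rewrite /Linf_class (rmorph1, rmorphM). Qed.

HB.instance Definition _ :=
  GRing.isZmodMorphism.Build bmeas Linf Linf_class Linf_class_zmod.
HB.instance Definition _ :=
  GRing.isMonoidMorphism.Build bmeas Linf Linf_class Linf_class_monoid.

Lemma Linf_reprK (l : Linf) : Linf_class (repr l) = l.
Proof. exact: reprK. Qed.

Lemma Linf_classP (f g : bmeas) : Linf_class f = Linf_class g <->
  {ae mu, forall x, bmeas_fun f x = bmeas_fun g x}.
Proof.
have e : (Linf_class f == Linf_class g) = (f - g \in ae_zero).
  by rewrite Quotient.idealrBE.
split=> [/eqP|fg].
  rewrite e => /asboolP; apply: filterS => x.
  rewrite -[bmeas_fun _ x]/(bmeas_fun f x - bmeas_fun g x).
  by move=> /eqP; rewrite subr_eq0 => /eqP.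
apply/eqP; rewrite e; apply/asboolP; apply: filterS fg => x fg.
by rewrite -[bmeas_fun _ x]/(bmeas_fun f x - bmeas_fun g x) fg subrr.
Qed.

Definition Linf_fun (l : Linf) : X -> Z := bmeas_fun (repr l).

End Linf.
Arguments bmeas_pred {R d X} mu Z.
Arguments ae_zero {R d X} mu Z.

(* The sigma-algebra of [X] is the Borel sigma-algebra of a Polish topology; a
   Hausdorff pseudometric structure is induced by a metric. *)
Definition standard_borel (R : realType) (d : measure_display)
    (X : measurableType d) : Prop :=
  exists (T : completePseudoMetricType R) (f : X -> T),
    [/\ hausdorff_space T, exists2 S : set T, countable S & dense S,
        bijective f &
        forall A : set X, measurable A <-> <<s @open T >> (f @` A)].

Record standardAction (R : realType) (G : groupType) (d : measure_display)
    (X : measurableType d) (mu : probability X R) := StandardAction {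
  sact :> G -> X -> X;
  sact1 : forall x, sact 1%g x = x;
  sactM : forall g h x, sact (g * h)%g x = sact g (sact h x);
  sact_measurable : forall g, measurable_fun setT (sact g);
  sact_preserving : forall g A, measurable A -> mu (sact g @^-1` A) = mu A;
  sact_ess_free : {ae mu, forall x, forall g, sact g x = x -> g = 1%g};
  sact_standard : standard_borel R X
}.

Section LinfAction.
Variables (R : realType) (G : groupType) (d : measure_display).
Variables (X : measurableType d) (mu : probability X R).
Variables (al : standardAction G mu) (Z : coefRing R).

Lemma ae_translate g (P : X -> Prop) :
  {ae mu, forall x, P x} -> {ae mu, forall x, P (al g x)}.
Proof.
move=> [N [mN N0 sub]]; exists (al g @^-1` N); split.
- by rewrite -[X in measurable X]setTI; apply: sact_measurable.
- by rewrite sact_preserving.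
- by move=> x; exact: sub.
Qed.

Lemma translate_subproof g (f : bmeas mu Z) :
  (fun x => bmeas_fun f (al g^-1%g x)) \in bmeas_pred mu Z.
Proof.
have /asboolP[mf [c fc]] := valP f; apply/asboolP; split.
  move=> B; rewrite -[X in measurable X]setTI.
  by have := sact_measurable al g^-1%g measurableT (mf B).
by exists c; exact: (ae_translate g^-1 fc).
Qed.

Definition translate g (f : bmeas mu Z) : bmeas mu Z :=
  exist _ (fun x => bmeas_fun f (al g^-1%g x)) (translate_subproof g f).

Definition Linf_act g (l : Linf mu Z) : Linf mu Z :=
  Linf_class (translate g (repr l)).

Lemma Linf_act_class g f : Linf_act g (Linf_class f) = Linf_class (translate g f).
Proof.
apply/Linf_classP.
have /Linf_classP : Linf_class (repr (Linf_class f)) = Linf_class f.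
  by rewrite Linf_reprK.
exact: ae_translate.
Qed.

Lemma Linf_act_zmod g : zmod_morphism (Linf_act g).
Proof.
move=> l m; rewrite -[l]Linf_reprK -[m]Linf_reprK -rmorphB !Linf_act_class -rmorphB.
by apply/Linf_classP; apply: aeW.
Qed.

Lemma Linf_act_monoid g : monoid_morphism (Linf_act g).
Proof.
split=> [|l m].
  rewrite -(rmorph1 (@Linf_class _ _ _ mu Z)) Linf_act_class.
  by apply/Linf_classP; apply: aeW.
rewrite -[l]Linf_reprK -[m]Linf_reprK -rmorphM !Linf_act_class -rmorphM.
by apply/Linf_classP; apply: aeW.
Qed.

HB.instance Definition _ g :=
  GRing.isZmodMorphism.Build (Linf mu Z) (Linf mu Z) (Linf_act g) (Linf_act_zmod g).
HB.instance Definition _ g :=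
  GRing.isMonoidMorphism.Build (Linf mu Z) (Linf mu Z) (Linf_act g) (Linf_act_monoid g).

Lemma Linf_act1 l : Linf_act 1%g l = l.
Proof.
rewrite -[l]Linf_reprK Linf_act_class; apply/Linf_classP; apply: aeW => x.
by rewrite /bmeas_fun/= invg1 sact1.
Qed.

Lemma Linf_actM g h l : Linf_act (g * h)%g l = Linf_act g (Linf_act h l).
Proof.
rewrite -[l]Linf_reprK !Linf_act_class; apply/Linf_classP; apply: aeW => x.
by rewrite /bmeas_fun/= invgM sactM.
Qed.

Definition Linf_action : ringAction G (Linf mu Z) :=
  @RingAction G (Linf mu Z) (fun g => Linf_act g) Linf_act1 Linf_actM.

End LinfAction.

Section Constants.
Variables (R : realType) (d : measure_display) (X : measurableType d).
Variables (mu : probability X R) (Z : coefRing R).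

Lemma const_subproof (z : Z) : (fun _ : X => z) \in bmeas_pred mu Z.
Proof.
apply/asboolP; split; last by exists (coef_norm Z z); apply: aeW.
move=> B; have [Bz|Bz] := pselect (B z).
  by rewrite (_ : _ @^-1` _ = setT)//; apply/seteqP; split.
by rewrite (_ : _ @^-1` _ = set0)//; apply/seteqP; split.
Qed.

Definition const_bmeas (z : Z) : bmeas mu Z := 
  exist _ (fun=> z) (const_subproof z).

Definition Linf_const (z : Z) : Linf mu Z := Linf_class (const_bmeas z).

Lemma Linf_const_zmod : zmod_morphism Linf_const.
Proof. by move=> z w; rewrite /Linf_const -rmorphB; apply/Linf_classP; apply: aeW. Qed.

Lemma Linf_const_monoid : monoid_morphism Linf_const.
Proof.
split=> [|z w]; first by rewrite /Linf_const -(rmorph1 (@Linf_class _ _ _ mu Z)); apply/Linf_classP; apply: aeW.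
by rewrite /Linf_const -rmorphM; apply/Linf_classP; apply: aeW.
Qed.

HB.instance Definition _ :=
  GRing.isZmodMorphism.Build Z (Linf mu Z) Linf_const Linf_const_zmod.
HB.instance Definition _ :=
  GRing.isMonoidMorphism.Build Z (Linf mu Z) Linf_const Linf_const_monoid.

Record measurableSet := MeasurableSet { ms_set :> set X; ms_measurable : measurable ms_set }.

Lemma chi_subproof (A : measurableSet) :
  (fun x => if `[< (A : set X) x >] then 1 else 0 : Z) \in bmeas_pred mu Z.
Proof.
apply/asboolP; split; last first.
  exists (Num.max (coef_norm Z 1) (coef_norm Z 0)); apply: aeW => x.
  by case: ifP => _; rewrite le_max lexx ?orbT.
move=> B; have mA := ms_measurable A.
have -> : (fun x => if `[< (A : set X) x >] then 1 else 0 : Z) @^-1` B =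
    (A `&` [set _ | B 1]) `|` (~` A `&` [set _ | B 0]).
  apply/seteqP; split=> [x /=|x /= [[Ax B1]|[Ax B0]]].
  - by case: asboolP => Ax Bx; [left|right].
  - by rewrite asboolT.
  - by rewrite asboolF.
have mc (P : Prop) : measurable [set _ : X | P].
  have [p|p] := pselect P.
    by rewrite (_ : [set _ | _] = setT)//; apply/seteqP; split.
  by rewrite (_ : [set _ | _] = set0)//; apply/seteqP; split.
by apply: measurableU; apply: measurableI => //; exact: measurableC.
Qed.

Definition chi_bmeas (A : measurableSet) : bmeas mu Z :=
  exist _ (fun x => if `[< (A : set X) x >] then 1 else 0) (chi_subproof A).

Definition chi (A : measurableSet) : Linf mu Z := Linf_class (chi_bmeas A).

End Constants.
Arguments measurableSet {d} X.

(* The crossed product [L^oo(al, Z) * G] and its module [L^oo(al, Z)]. *)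
Notation crossedRing al Z := (crossed (Linf_action al Z)).
Notation Linf_module al Z := (coefMod (Linf_action al Z)).

Section Marked.
Variables (R : realType) (G : groupType) (d : measure_display).
Variables (X : measurableType d) (mu : probability X R).
Variables (al : standardAction G mu) (Z : coefRing R).

Local Notation crossedRing := (crossedRing al Z).
Local Notation Linf_module := (Linf_module al Z).

(* the left ideal generated by (chi_A, 1) *)
Definition angle (A : measurableSet X) : set crossedRing :=
  [set r | exists s : crossedRing, r = s * monom (Linf_action al Z) (chi mu Z A) 1%g].

(* [marking M] is an isomorphism of [M] with the sum of the <A_i>, given as an
   embedding into the free module R^I with the appropriate image. *)
Record marking (M : lmodType crossedRing) := Marking {
  mk_index : finType;
  mk_set : mk_index -> measurableSet X;
  mk_iso : {linear M -> {ffun mk_index -> crossedRing^o}};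
  mk_iso_inj : injective mk_iso;
  mk_iso_image : forall v,
    (exists z, mk_iso z = v) <-> forall i, angle (mk_set i) (v i)
}.

(* A marked direct summand of a marked module is given by its family of sets. *)
Definition marked_summand M (m : marking M) (B : mk_index m -> measurableSet X) : Prop :=
  forall i, (B i : set X) `<=` mk_set i.

Definition summand_set M (m : marking M) (B : mk_index m -> measurableSet X) : set M :=
  [set z | forall i, angle (B i) (mk_iso m z i)].

Definition sets_dim (I : finType) (A : I -> measurableSet X) : R :=
  \sum_i fine (mu (A i)).

Definition mdim M (m : marking M) : R := sets_dim (mk_set (m := m)).

Definition L1norm (l : Linf mu Z) : R :=
  fine (\int[mu]_x (coef_norm Z (Linf_fun l x))%:E).

Definition crossed_norm (r : crossedRing) : R :=
  \sum_(g \in [set: G]) L1norm (coeff r g).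

Definition mnorm M (m : marking M) (z : M) : R :=
  \sum_i crossed_norm (mk_iso m z i).

Definition logp (t : R) : R := Num.max (ln t) 0.

Section Lognorm.
Variables (M N : lmodType crossedRing) (m : marking M) (n : marking N).
Variable f : {linear M -> N}.

(* The next three definitions concern the restriction of [f] to the marked
   direct summand [B] of [M], with the marking inherited from [M]. The set in
   [opnorm] is never empty: [f] is given by a finite matrix over the crossed
   product, whose coefficients are essentially bounded. *)
Definition opnorm (B : mk_index m -> measurableSet X) : R :=
  inf [set c | 0 <= c /\
    forall z, summand_set B z -> mnorm n (f z) <= c * mnorm m z].

Definition rk (B : mk_index m -> measurableSet X) : R :=
  inf [set t | exists C : mk_index n -> measurableSet X,
    [/\ marked_summand C,
        forall z, summand_set B z -> summand_set C (f z) &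
        t = sets_dim C]].

Definition lognorm' (B : mk_index m -> measurableSet X) : R :=
  Num.min (sets_dim B * logp (opnorm B)) (rk B * logp (opnorm B)).

Definition marked_decomposition (k : nat) (B : 'I_k -> mk_index m -> measurableSet X) : Prop :=
  forall i, trivIset [set: 'I_k] (fun j => B j i : set X) /\
    \bigcup_j (B j i : set X) = mk_set i.

Definition lognorm : R :=
  inf [set t | exists k (B : 'I_k -> mk_index m -> measurableSet X),
    marked_decomposition B /\ t = \sum_(j < k) lognorm' (B j)].

End Lognorm.

Record markedComplex := MarkedComplex {
  mc_complex :> augmentedComplex Linf_module;
  mc_marking : forall k, marking (mc_complex k)
}.

Definition groupRing_incl (x : groupRing G Z) : crossedRing :=
  crossed_map (Linf_action al Z) (@Linf_const _ _ _ mu Z) x.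

Variables (C : augmentedComplex (trivialMod G Z)) (n : nat).

(* The maps [phi k] with k > n.+1 are irrelevant. *)
Definition embedding (D : markedComplex) (phi : forall k, C k -> D k) : Prop :=
  [/\ forall k, (k <= n.+1)%N ->
        GRing.linear_for (fun x v => groupRing_incl x *: v) (phi k),
      forall k, (k <= n)%N -> forall x, bd D k (phi k.+1 x) = phi k (bd C k x) &
      forall x, aug D (phi 0 x) = Linf_const mu (aug C x)].

Definition embeddable (D : markedComplex) : Prop :=
  exists phi : forall k, C k -> D k, embedding phi.

Definition medim : \bar R :=
  ereal_inf [set t | exists2 D : markedComplex,
    embeddable D & t = (mdim (mc_marking D n))%:E].

Definition mevol : \bar R :=
  ereal_inf [set t | exists2 D : markedComplex,
    embeddable D &
    t = (lognorm (mc_marking D n.+1) (mc_marking D n) (bd D n))%:E].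

End Marked.

(* Main.v *)
From HB Require Import structures.
Require Import Defs.
From mathcomp Require Import all_boot all_order all_algebra.
From mathcomp Require Import all_classical all_reals all_analysis.
From mathcomp Require Import measurable_realfun ring lra.

(**
Since an embedding [C -> D] need not be exact, it is enough to build a small
complex [D] receiving a chain map from a complex [E] of finitely generated free
[Z G]-modules that itself receives a chain map from [C].

The complex [E].  A projective resolution [P] of the trivial [int G]-module, finitely
generated up to degree [n + 1], is in these degrees a retract of finitely generated
free modules, which inherit a differential.  As the terms of [P] are direct summands
of free abelian groups, [P] has an additive contraction; extending the coefficients
of the matrix of this contraction from [int] to [Z] shows that a free complex over
[Z G] can still be mapped to [E].

The complex [D].  Let [c : X -> G] have finitely many values and satisfy
[c (g^-1 x) = g^-1 c x] for all [g] in a given finite set and all [x] outside of a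
small set [B].  Then [F = { (c x)^-1 x }] is small too if the finite set is large, as
its points, apart from those coming from [B], have many preimages.  Put [D_0 = <F>]
and let [z] in [D_0] be the indicator of the graph of [x |-> (c x)^-1 x], which is
mapped to [1] by the augmentation.  A generator of [E_0] is sent to the corresponding
multiple of [z].  Off [B] the elements [g z] and [z] agree, so the image of the
boundary of a generator of [E_1] is supported on [B]; hence it suffices to put a copy
of [<B>] in [D_1], and inductively a copy of [<S B>] for a finite set [S] in [D_k],
for each generator of [E_k].  The norms of the differentials stay bounded while the
dimensions tend to zero.

The map [c].  Among the partially defined maps [X -> G] whose total defect of
equivariance is at most [e] times the measure of the domain, choose one with maximal
domain.  If the complement [Y] of its domain were not null, average over [p] the
traces [{ t in T | t p in Y }] of a Folner set [T]: one of these traces [T'] has a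
small boundary and occurs for [p] in a set of positive measure, in which there is a
set [Q] of positive measure with [t Q] disjoint for [t] in [T'], because the action
is free.  Mapping [t p] to [t] for [p] in [Q] extends the map, a contradiction.

Folner sets exist: otherwise the coboundary is bounded below on finitely supported
functions, by the coarea formula, and the Hahn-Banach theorem gives a bounded flow
on [G] with constant divergence [1], which no invariant mean allows.
*)

Set Implicit Arguments.
Unset Strict Implicit.
Unset Printing Implicit Defensive.

Import Order.TTheory GRing.Theory Num.Theory.

Local Open Scope classical_set_scope.
Local Open Scope ring_scope.

(** * The Hahn-Banach theorem along a sequence *)

Section HahnBanach.
Variables (R : realType) (V : lmodType R) (p : V -> R).
Hypothesis pD : forall x y, p (x + y) <= p x + p y.
Hypothesis pZ : forall c x, 0 <= c -> p (c *: x) = c * p x.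

(* [L x a] means that a linear functional, defined on a subspace, maps [x] to [a]. *)
Definition dominated_graph (L : V -> R -> Prop) : Prop :=
  [/\ L 0 0, forall c x a y b, L x a -> L y b -> L (c *: x + y) (c * a + b) &
      forall x a, L x a -> a <= p x].

(** The vector [b] may already lie in the domain: as [p] vanishes at 0, domination of the extended
    graph then forces [f] to be the value that [b] has. *)
Definition extend_graph (L : V -> R -> Prop) (b : V) (f : R) : V -> R -> Prop :=
  fun y s => exists x a c, [/\ L x a, y = x + c *: b & s = a + c * f].

(** Subadditivity puts every [a - p (x - b)] below every [p (y + b) - c] with [L y c], so the
    supremum of the former is an admissible value at [b]. Homogeneity reduces the other multiples of
    [b] to [b] and [- b]. *)
Lemma hahn_banach_step (L : V -> R -> Prop) (b : V) : dominated_graph L ->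
  exists f, dominated_graph (extend_graph L b f).
Proof.
move=> [L0 LD Lp].
pose E := [set s | exists x a, L x a /\ s = a - p (x - b)].
have ubE x a : L x a -> ubound E (p (x + b) - a).
  move=> Lx _ [y [c [Ly ->]]].
  have /Lp : L (y + x) (c + a) by have := LD 1 _ _ _ _ Ly Lx; rewrite scale1r mul1r.
  have -> : y + x = (y - b) + (x + b) by rewrite addrACA addNr addr0.
  move=> /le_trans/(_ (pD _ _)); lra.
have E0 : E !=set0 by exists (0 - p (0 - b)), 0, 0.
have hE : has_sup E by split => //; exists (p (0 + b) - 0); exact: ubE.
exists (sup E); split.
- by exists 0, 0, 0; rewrite scale0r mul0r !addr0.
- move=> k _ _ _ _ [x [a [c [Lx -> ->]]]] [y [e [d [Ly -> ->]]]].
  exists (k *: x + y), (k * a + e), (k * c + d); split; first exact: LD.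
    by rewrite scalerDr scalerDl scalerA addrACA.
  by rewrite mulrDr mulrDl mulrA addrACA.
- move=> _ _ [x [a [c [Lx -> ->]]]].
  have LZ k : L (k *: x) (k * a).
    by have := LD k _ _ _ _ Lx L0; rewrite !addr0.
  have [c0|c0|->] := ltgtP c 0; last by rewrite scale0r mul0r !addr0 Lp.
  + have d0 : 0 < - c by rewrite oppr_gt0.
    have : (- c)^-1 * a - p ((- c)^-1 *: x - b) <= sup E.
      by apply: sup_upper_bound => //; exists ((- c)^-1 *: x), ((- c)^-1 * a).
    have -> : (- c)^-1 *: x - b = (- c)^-1 *: (x + c *: b).
      by rewrite scalerDr scalerA invrN mulNr mulVf ?lt_eqF// scaleN1r.
    rewrite pZ -?mulrBr; last by rewrite invr_ge0 ltW.
    move=> /(ler_wpM2l (ltW d0)).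
    by rewrite mulVKf ?gt_eqF//; lra.
  + have : sup E <= p (c^-1 *: x + b) - c^-1 * a by apply: ge_sup => //; exact: ubE.
    have -> : c^-1 *: x + b = c^-1 *: (x + c *: b).
      by rewrite scalerDr scalerA mulVf ?gt_eqF// scale1r.
    rewrite pZ -?mulrBr; last by rewrite invr_ge0 ltW.
    move=> /(ler_wpM2l (ltW c0)).
    by rewrite mulVKf ?gt_eqF//; lra.
Qed.

(** Only countably many vectors need a value, so recursion takes the place of Zorn's lemma. The
    union of the graphs is defined on the span of the domain of [L] and of the [b n]. *)
Lemma hahn_banach_countable (L : V -> R -> Prop) (b : nat -> V) :
  dominated_graph L ->
  exists (f : nat -> R) (M : V -> R -> Prop),
    [/\ dominated_graph M, forall x a, L x a -> M x a & forall n, M (b n) (f n)].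
Proof.
move=> domL.
(* [F] is total, with a default value where the graph is not dominated, so that the recursion
   defining [S] carries no proofs. *)
have [F FP] : exists F : (V -> R -> Prop) -> V -> R,
    forall L' x, dominated_graph L' -> dominated_graph (extend_graph L' x (F L' x)).
  have /choice[F FP] : forall Lx : (V -> R -> Prop) * V, exists f,
      dominated_graph Lx.1 -> dominated_graph (extend_graph Lx.1 Lx.2 f).
    move=> [L' x]; have [dL|ndL] := pselect (dominated_graph L'); last by exists 0.
    by have [f] := hahn_banach_step x dL; exists f.
  by exists (fun L' x => F (L', x)) => L' x; exact: (FP (L', x)).
pose S := fix S n := if n is k.+1 then extend_graph (S k) (b k) (F (S k) (b k)) else L.
have domS n : dominated_graph (S n) by elim: n => //= n IH; exact: FP.
have S_incr m n x a : (m <= n)%N -> S m x a -> S n x a.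
  move=> /subnK <-; elim: (n - m)%N => //= k IH /IH Sk; exists x, a, 0.
  by rewrite scale0r mul0r !addr0.
exists (fun n => F (S n) (b n)), (fun x a => exists n, S n x a); split.
- split; first by exists 0%N; have [] := domL.
    move=> c x a y e [m Sx] [n Sy]; exists (maxn m n).
    have [_ SD _] := domS (maxn m n); apply: SD.
      by apply: S_incr Sx; rewrite leq_maxl.
    by apply: S_incr Sy; rewrite leq_maxr.
  by move=> x a [n Sx]; have [_ _] := domS n; apply.
- by move=> x a Lx; exists 0%N.
- move=> n; exists n.+1; exists 0, 0, 1; have [S0 _ _] := domS n.
  by rewrite scale1r mul1r !add0r.
Qed.

End HahnBanach.

(** * Finitely supported functions and their l1 norm *)

Section FinitelySupported.
Variables (R : realType) (T : choiceType).

Definition fsupp_pred : {pred T -> R^o} := fun f => `[< finsupp f >].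

Lemma fsupp_submod_closed : submod_closed fsupp_pred.
Proof.
split=> [|c f g /asboolP/finsupp_seq[s us sf] /asboolP/finsupp_seq[t ut tg]].
  by apply/asboolP/(@seq_finsupp _ _ _ [::]) => g; rewrite eqxx.
apply/asboolP/(@seq_finsupp _ _ _ (s ++ t)) => x.
rewrite mem_cat; apply: contraR; rewrite negb_or => /andP[xs xt].
have /eqP fx : f x == 0 by apply: contraR xs => /sf.
have /eqP gx : g x == 0 by apply: contraR xt => /tg.
by rewrite -[(_ + _) x]/(c * f x + g x) fx gx mulr0 addr0.
Qed.

HB.instance Definition _ :=
  GRing.isSubmodClosed.Build R (T -> R^o) fsupp_pred fsupp_submod_closed.

Definition fsupp : Type := {f : T -> R^o | f \in fsupp_pred}.

HB.instance Definition _ := [isSub of fsupp for @sval _ _].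
HB.instance Definition _ := [Choice of fsupp by <:].
HB.instance Definition _ := [SubChoice_isSubLmodule of fsupp by <:].

Definition fsval (f : fsupp) : T -> R := val f.

Lemma fsupp_mem (f : fsupp) : exists2 s, uniq s & forall x, fsval f x != 0 -> x \in s.
Proof. exact/finsupp_seq/asboolP/(valP f). Qed.

Lemma fsupp_ext (f g : fsupp) : fsval f =1 fsval g -> f = g.
Proof. by move=> fg; apply/val_inj/funext. Qed.

Lemma mk_fsupp_subproof (f : T -> R) (s : seq T) (fs : forall x, f x != 0 -> x \in s) :
  (f : T -> R^o) \in fsupp_pred.
Proof. by apply/asboolP/(@seq_finsupp _ _ _ s). Qed.

Definition mk_fsupp f s fs : fsupp := exist _ f (@mk_fsupp_subproof f s fs).

Definition fsnorm (f : fsupp) : R := \sum_(x \in [set: T]) `|fsval f x|.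

Lemma fsnormE (f : fsupp) s : uniq s -> (forall x, fsval f x != 0 -> x \in s) ->
  fsnorm f = \sum_(x <- s) `|fsval f x|.
Proof. by move=> us sf; apply: fsumE => // x; rewrite normr_eq0 => /sf. Qed.

Lemma fsnormD f g : fsnorm (f + g) <= fsnorm f + fsnorm g.
Proof.
have [s _ sf] := fsupp_mem f; have [t _ tg] := fsupp_mem g.
have uu : uniq (undup (s ++ t)) by exact: undup_uniq.
rewrite (fsnormE (f := f) uu); last by move=> x /sf; rewrite mem_undup mem_cat => ->.
rewrite (fsnormE (f := g) uu); last first.
  by move=> x /tg; rewrite mem_undup mem_cat => ->; rewrite orbT.
rewrite (fsnormE uu); last first.
  move=> x; apply: contraR; rewrite mem_undup mem_cat negb_or => /andP[xs xt].
  have /eqP fx : fsval f x == 0 by apply: contraR xs => /sf.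
  have /eqP gx : fsval g x == 0 by apply: contraR xt => /tg.
  by rewrite -[fsval _ _]/(fsval f x + fsval g x) fx gx addr0.
by rewrite -big_split ler_sum// => x _; exact: ler_normD.
Qed.

Lemma fsnormZ (c : R) f : 0 <= c -> fsnorm (c *: f) = c * fsnorm f.
Proof.
move=> c0; have [s us sf] := fsupp_mem f.
rewrite (fsnormE us sf) (fsnormE (f := c *: f) us).
  rewrite mulr_sumr; apply: eq_bigr => x _.
  by rewrite -[fsval _ _]/(c * fsval f x) normrM ger0_norm.
move=> x; rewrite -[fsval _ _]/(c * fsval f x).
by rewrite mulf_eq0 negb_or => /andP[_ /sf].
Qed.

Lemma fsdelta_subproof (y x : T) : (if x == y then 1 : R else 0) != 0 -> x \in [:: y].
Proof. by rewrite inE; case: (x == y) => //=; rewrite eqxx. Qed.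

Definition fsdelta (y : T) : fsupp := mk_fsupp (@fsdelta_subproof y).

Lemma fsdeltaE y x : fsval (fsdelta y) x = (x == y)%:R.
Proof. by rewrite /fsval/=; case: eqP. Qed.

Lemma fsnorm_delta y : fsnorm (fsdelta y) = 1.
Proof.
rewrite (fsnormE (s := [:: y]))//; last by move=> x; exact: fsdelta_subproof.
by rewrite big_seq1 fsdeltaE eqxx normr1.
Qed.

End FinitelySupported.

(** * Folner sets *)

Lemma ler_sum_subset (R : numDomainType) (I : eqType) (s t : seq I) (F : I -> R) :
  uniq s -> uniq t -> {subset s <= t} -> (forall x, 0 <= F x) ->
  \sum_(x <- s) F x <= \sum_(x <- t) F x.
Proof.
move=> us ut st F0.
have st_perm : perm_eq [seq x <- t | x \in s] s.
  apply: uniq_perm; rewrite ?filter_uniq// => x.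
  by rewrite mem_filter; case: (boolP (x \in s)) => // /st ->.
rewrite [leRHS](bigID (mem s))/= -[X in _ <= X + _]big_filter (perm_big _ st_perm).
by rewrite lerDl sumr_ge0.
Qed.

Lemma seq_minimum (R : realDomainType) (I : eqType) (s : seq I) (F : I -> R) :
  s != [::] -> exists2 x, x \in s & forall y, y \in s -> F x <= F y.
Proof.
elim: s => // x [|y s] IH _.
  by exists x; rewrite ?mem_head// => y; rewrite inE => /eqP ->.
have [//|z zs zP] := IH; have [xz|zx] := leP (F x) (F z).
  exists x; rewrite ?mem_head// => w; rewrite inE => /predU1P[->//|/zP].
  exact: le_trans.
exists z; first by rewrite inE zs orbT.
by move=> w; rewrite inE => /predU1P[->|/zP//]; exact: ltW.
Qed.

Lemma countable_enum (T : Type) (A : set T) : countable A ->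
  exists en : nat -> option T, forall y, A y -> exists n, en n = Some y.
Proof.
move=> /countable_injP[j jinj].
have [|en enP] := @choice nat (option T) (fun n o => (exists2 y, A y & j y = n) ->
    exists y, [/\ A y, o = Some y & j y = n]).
  move=> n; have [[y Ay jy]|nex] := pselect (exists2 y, A y & j y = n).
    by exists (Some y) => _; exists y.
  by exists None.
exists en => y Ay; exists (j y); have [|z [Az -> jz]] := enP (j y); first by exists y.
by rewrite (jinj z y)// inE.
Qed.

Section Folner.
Variables (R : realType) (G : groupType) (m : nat) (k : 'I_m -> G) (e : R).

Definition boundary (T : seq G) : nat := \sum_i count (fun t => (k i * t)%g \notin T) T.

Hypothesis e0 : 0 < e.
Hypothesis not_folner : forall T : seq G, uniq T -> T != [::] ->
  e * (size T)%:R <= (boundary T)%:R.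

(** Layer by layer: subtract from [f] its minimum [c] on the support [s]. The norm of the coboundary
    is additive along this splitting; [not_folner] treats [c] times the indicator of [s], and the
    rest has a smaller support. The edge set [S] stays fixed during the induction. *)
Lemma coarea (S : seq (G * 'I_m)) (s0 : seq G) : uniq S ->
  (forall x i, x \in s0 -> ((k i * x)%g, i) \in S) ->
  forall n (s : seq G) (f : G -> R), (size s <= n)%N -> uniq s ->
    {subset s <= s0} -> (forall x, f x != 0 -> x \in s) ->
    (forall x, x \in s -> 0 < f x) ->
  e * (\sum_(x <- s) f x) <= \sum_(y <- S) `|f ((k y.2)^-1 * y.1)%g - f y.1|.
Proof.
move=> uS s0S; elim=> [|n IH] s f.
  by case: s => // *; rewrite big_nil mulr0 sumr_ge0.
move=> sn us ss0 fs f0; have [s_eq0|sN0] := eqVneq s [::].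
  by rewrite s_eq0 big_nil mulr0 sumr_ge0.
have [z zs zmin] := seq_minimum f sN0; pose c := f z.
have c0 : 0 < c by exact: f0.
pose f' x := if x \in s then f x - c else 0.
pose s' := [seq x <- s | f x != c].
have s's x : x \in s' -> x \in s by rewrite mem_filter => /andP[].
have fE x : f x = c * (x \in s)%:R + f' x.
  rewrite /f'; case: ifPn => xs; first by rewrite mulr1 addrC subrK.
  by rewrite mulr0 addr0; apply/eqP; apply: contraNT xs => /fs.
have f'0 x : 0 <= f' x.
  by rewrite /f'; case: ifPn => // xs; rewrite subr_ge0 zmin.
have -> : \sum_(x <- s) f x = c * (size s)%:R + \sum_(x <- s') f' x.
  under eq_bigr do rewrite fE; rewrite big_split/=; congr (_ + _).
    rewrite -mulr_sumr; congr (_ * _); rewrite -sum1_size natr_sum !big_seq.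
    by apply: eq_bigr => x ->.
  rewrite [RHS]big_filter [RHS]big_mkcond/= [LHS]big_seq [RHS]big_seq.
  apply: eq_bigr => x xs; rewrite /f' xs; case: eqP => //= ->.
  by rewrite subrr.
(* The two differences never have opposite signs, as [f'] is nonnegative and vanishes off [s], so
   their absolute values add up. *)
have normE a b : `|f a - f b| = c * `|(a \in s)%:R - (b \in s)%:R| + `|f' a - f' b|.
  rewrite (fE a) (fE b); have := f'0 a; have := f'0 b.
  have f'out x : x \notin s -> f' x = 0 by rewrite /f' => /negbTE ->.
  case: (boolP (a \in s)) => [as_|/f'out ->]; case: (boolP (b \in s)) => [bs|/f'out ->] => fb fa /=.
  - by rewrite subrr normr0 mulr0 add0r; congr `|_|; ring.
  - rewrite !subr0 mulr0 addr0 normr1 subr0 mulr1 !ger0_norm//; lra.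
  - rewrite sub0r mulr0 !(sub0r, add0r) !normrN normr1 mulr1 [`|f' b|]ger0_norm// ger0_norm; lra.
  - by rewrite !(mulr0, subr0, addr0, normr0).
under [leRHS]eq_bigr do rewrite normE.
rewrite mulrDr big_split/= lerD//; last first.
  apply: IH; rewrite ?filter_uniq//.
  - rewrite -ltnS; apply: leq_trans sn; rewrite size_filter.
    rewrite -(count_predC (fun x => f x != c) s) -[ltnLHS]addn0 ltn_add2l -has_count.
    by apply/hasP; exists z => //=; rewrite /c eqxx.
  - by move=> x /s's /ss0.
  - move=> x; rewrite mem_filter /f'; case: (boolP (x \in s)) => xs; last by rewrite eqxx.
    by rewrite subr_eq0 andbT.
  - move=> x; rewrite mem_filter => /andP[fx xs].
    by rewrite /f' xs subr_gt0 lt_neqAle eq_sym fx zmin.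
rewrite -mulr_sumr mulrCA ler_pM2l//; apply: le_trans (not_folner us sN0) _.
rewrite /boundary natr_sum.
(* Among all edges only those leaving [s] are kept; each of them contributes 1. *)
pose A := [seq ((k i * t)%g, i) | i <- enum 'I_m, t <- [seq t <- s | (k i * t)%g \notin s]].
have uA : uniq A.
  apply: allpairs_uniq_dep; rewrite ?enum_uniq//.
    by move=> i _; rewrite filter_uniq.
  by move=> [i t] [j u] _ _ /= [] /[swap] ->  /mulgI ->.
apply: le_trans (ler_sum_subset uA uS _ _) => //; last first.
  move=> [x i] /allpairsPdep[j [t [_]]]; rewrite mem_filter => /andP[_ ts] ->.
  exact/s0S/ss0.
rewrite big_allpairs_dep/= big_enum/=; apply: ler_sum => i _.
rewrite -sum1_count natr_sum -big_filter big_seq [leRHS]big_seq.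
apply: ler_sum => t; rewrite mem_filter => /andP[kt ts].
by rewrite mulKg ts (negbTE kt) subr0 normr1.
Qed.

Lemma coboundary_subproof (f : fsupp R G) :
  exists s : seq (G * 'I_m), forall y,
    fsval f ((k y.2)^-1 * y.1)%g - fsval f y.1 != 0 -> y \in s.
Proof.
have [s _ fs] := fsupp_mem f.
exists ([seq ((k i * x)%g, i) | i <- enum 'I_m, x <- s] ++
        [seq (x, i) | i <- enum 'I_m, x <- s]) => -[x i] /=.
rewrite mem_cat; apply: contraR; rewrite negb_or => /andP[xi1 xi2].
have /eqP-> : fsval f x == 0.
  apply: contraR xi2 => /fs xs; apply/allpairsP; exists (i, x); split => //=.
  by rewrite mem_enum.
have /eqP-> : fsval f ((k i)^-1 * x)%g == 0.
  apply: contraR xi1 => /fs xs; apply/allpairsP.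
  by exists (i, ((k i)^-1 * x)%g); split; rewrite /= ?mem_enum ?mulVKg.
by rewrite subrr.
Qed.

(** An edge is encoded by its end point [y.1] and its direction [y.2]; it starts at
    [(k y.2)^-1 y.1]. *)
Definition coboundary (f : fsupp R G) : fsupp R (G * 'I_m)%type :=
  mk_fsupp (projT2 (cid (coboundary_subproof f))).

Lemma coboundaryE f y :
  fsval (coboundary f) y = fsval f ((k y.2)^-1 * y.1)%g - fsval f y.1.
Proof. by []. Qed.

Definition fssum (f : fsupp R G) : R := \sum_(x \in [set: G]) fsval f x.

Lemma fssumE (f : fsupp R G) s : uniq s -> (forall x, fsval f x != 0 -> x \in s) ->
  fssum f = \sum_(x <- s) fsval f x.
Proof. exact: fsumE. Qed.

(** Passing to the absolute value of [f] increases the sum and decreases the coboundary, so [coarea]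
    applies. *)
Lemma fssum_le (f : fsupp R G) : fssum f <= e^-1 * fsnorm (coboundary f).
Proof.
have [s us fs] := fsupp_mem f; have [S _ dS] := fsupp_mem (coboundary f).
pose S' := undup (S ++ [seq ((k i * x)%g, i) | i <- enum 'I_m, x <- s]).
have uS' : uniq S' by exact: undup_uniq.
rewrite (fssumE us fs) (fsnormE uS'); last by move=> x /dS; rewrite mem_undup mem_cat => ->.
rewrite -ler_pdivrMl ?invr_gt0// invrK.
pose t := [seq x <- s | fsval f x != 0].
have -> : \sum_(x <- s) fsval f x = \sum_(x <- t) fsval f x.
  rewrite big_filter [RHS]big_mkcond; apply: eq_bigr => x _.
  by case: eqP.
apply: le_trans (_ : e * \sum_(x <- t) `|fsval f x| <= _).
  by rewrite ler_pM2l// ler_sum// => x _; exact: ler_norm.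
apply: le_trans (coarea (s0 := s) (f := fun x => `|fsval f x|) uS' _ (leqnn (size t)) _ _ _ _) _.
- move=> x i xs; rewrite mem_undup mem_cat; apply/orP; right.
  by apply/allpairsP; exists (i, x); split => //=; rewrite mem_enum.
- by rewrite filter_uniq.
- by move=> x; rewrite mem_filter => /andP[].
- by move=> x; rewrite normr_eq0 => fx; rewrite mem_filter fx fs.
- by move=> x; rewrite mem_filter normr_gt0 => /andP[].
- apply: ler_sum => y _; rewrite coboundaryE.
  by apply: le_trans (ler_dist_dist _ _) _.
Qed.

(** By [fssum_le], sending [coboundary f] to the sum of [f] is dominated by [e^-1] times the l1
    norm. The values of an extension at single edges form the flow. Evaluating it at the coboundary
    of the delta function at [h], whose sum is 1, gives the divergence at [h]. *)
Lemma bounded_flow : countable [set: G] ->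
  exists2 F : 'I_m -> G -> R, forall i h, `|F i h| <= e^-1 &
    forall h, \sum_i (F i (k i * h)%g - F i h) = 1.
Proof.
move=> cG.
pose p (v : fsupp R (G * 'I_m)%type) := e^-1 * fsnorm v.
have pD x y : p (x + y) <= p x + p y.
  by rewrite /p -mulrDr ler_pM2l ?invr_gt0// fsnormD.
have pZ c x : 0 <= c -> p (c *: x) = c * p x.
  by move=> c0; rewrite /p fsnormZ// mulrCA.
have p1 y : p (fsdelta R y) = e^-1 by rewrite /p fsnorm_delta mulr1.
pose L v a := exists f, v = coboundary f /\ a = fssum f.
have domL : dominated_graph p L.
  split.
  - exists 0; split.
      by apply: fsupp_ext => y; rewrite coboundaryE subrr.
    by rewrite (fssumE (s := [::])) ?big_nil// => x; rewrite eqxx.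
  - move=> c _ _ _ _ [f [-> ->]] [g [-> ->]]; exists (c *: f + g); split.
      apply: fsupp_ext => y.
      rewrite coboundaryE -![fsval (_ *: _ + _) _]/(c * fsval _ _ + fsval _ _).
      rewrite !coboundaryE; ring.
    have [s _ fs] := fsupp_mem f; have [t _ gt] := fsupp_mem g.
    have uu : uniq (undup (s ++ t)) by exact: undup_uniq.
    rewrite (fssumE (f := f) uu); last by move=> x /fs; rewrite mem_undup mem_cat => ->.
    rewrite (fssumE (f := g) uu); last first.
      by move=> x /gt; rewrite mem_undup mem_cat => ->; rewrite orbT.
    rewrite (fssumE uu); last first.
      move=> x; apply: contraR; rewrite mem_undup mem_cat negb_or => /andP[xs xt].
      have /eqP fx : fsval f x == 0 by apply: contraR xs => /fs.
      have /eqP gx : fsval g x == 0 by apply: contraR xt => /gt.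
      by rewrite -[fsval _ _]/(c * fsval f x + fsval g x) fx gx mulr0 addr0.
    by rewrite mulr_sumr -big_split.
  - by move=> _ _ [f [-> ->]]; exact: fssum_le.
have [en enP] : exists en : nat -> option (G * 'I_m), forall y, exists n, en n = Some y.
  have [|en enP] := @countable_enum (G * 'I_m)%type setT.
    by rewrite -setXTT; apply: countableX.
  by exists en => y; exact: enP.
pose b n := if en n is Some y then fsdelta R y else 0.
have [f [M [[M0 MD Mp] LM Mb]]] := hahn_banach_countable pD pZ b domL.
have /choice[N NP] := enP.
pose P i h := f (N (h, i)).
have MP i h : M (fsdelta R (h, i)) (P i h).
  by have := Mb (N (h, i)); rewrite /b NP.
have MZ c x a : M x a -> M (c *: x) (c * a).
  by move=> Mx; have := MD c _ _ _ _ Mx M0; rewrite !addr0.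
have MDD x a y c : M x a -> M y c -> M (x + y) (a + c).
  by move=> Mx My; have := MD 1 _ _ _ _ Mx My; rewrite scale1r mul1r.
have MDB x a y c : M x a -> M y c -> M (x - y) (a - c).
  by move=> Mx /(MZ (-1)); rewrite scaleN1r mulN1r; exact: MDD.
(* Domination of [a] and of [- a] by [p 0 = 0] shows that [M] is single-valued. *)
have M0eq a : M 0 a -> a = 0.
  have p0 : p 0 = 0 by rewrite -(scale0r (0 : fsupp R (G * 'I_m)%type)) pZ// mul0r.
  move=> Ma; apply/eqP; rewrite eq_le -{1}p0 Mp//=.
  by have /Mp := MZ (-1) _ _ Ma; rewrite scaler0 p0 mulN1r oppr_le0.
exists P => [i h|h].
  rewrite ler_norml -(p1 (h, i)) Mp// andbT.
  have /Mp := MZ (-1) _ _ (MP i h); rewrite mulN1r lerNl => /(le_trans _); apply.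
  rewrite lerN2 /p ler_pM2l ?invr_gt0// !(@fsnormE _ _ _ [:: (h, i)])//.
  - by rewrite !big_seq1 -[fsval (_ *: _) _]/(-1 * fsval _ _) mulN1r normrN.
  - by move=> x; exact: fsdelta_subproof.
  - move=> x; rewrite -[fsval (_ *: _) _]/(-1 * fsval _ _) mulN1r oppr_eq0.
    exact: fsdelta_subproof.
have M1 : M (coboundary (fsdelta R h)) 1.
  apply: LM; exists (fsdelta R h); split => //.
  rewrite (fssumE (s := [:: h]))//; last by move=> x; exact: fsdelta_subproof.
  by rewrite big_seq1 fsdeltaE eqxx.
have M2 : M (\sum_i (fsdelta R ((k i * h)%g, i) - fsdelta R (h, i)))
            (\sum_i (P i (k i * h)%g - P i h)).
  apply: (big_rec2 (fun x a => M x a)) => // i a x _ Mxa; apply: (MDD) => //.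
  exact: MDB.
apply/eqP; rewrite -subr_eq0; apply/eqP/M0eq.
suff -> : 0 = \sum_i (fsdelta R ((k i * h)%g, i) - fsdelta R (h, i)) -
              coboundary (fsdelta R h).
  exact: MDB.
apply/eqP; rewrite eq_sym subr_eq0; apply/eqP/fsupp_ext => -[x j].
have -> : fsval (\sum_i (fsdelta R ((k i * h)%g, i) - fsdelta R (h, i))) (x, j) =
   \sum_i (fsval (fsdelta R ((k i * h)%g, i)) (x, j) - fsval (fsdelta R (h, i)) (x, j)).
  by apply: (big_morph (fun v => fsval v (x, j))).
rewrite coboundaryE/= (bigD1 j)//= big1 ?addr0.
  by rewrite !fsdeltaE !xpair_eqE eqxx !andbT (can2_eq (mulVKg _) (mulKg _)).
by move=> i ij; rewrite !fsdeltaE !xpair_eqE [j == i]eq_sym (negbTE ij) !andbF subrr.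
Qed.

End Folner.

(** Apply the mean to the divergence of a bounded flow: by invariance each [F i (k i h) - F i h] has
    mean 0, whereas the divergence is constantly 1. *)
Lemma amenable_folner (R : realType) (G : groupType) (m : nat) (k : 'I_m -> G) (e : R) :
  countable [set: G] -> amenable R G -> 0 < e ->
  exists T : seq G, [/\ uniq T, T != [::] & (boundary k T)%:R < e * (size T)%:R].
Proof.
move=> cG [M [Mlin Mpos M1 Minv]] e0; apply: contrapT => nofol.
have [|F Fb F1] := @bounded_flow R G m k e e0 _ cG.
  move=> T uT T0; rewrite leNgt; apply/negP => lt.
  by apply: nofol; exists T.
have bF i h : bounded_function (fun g => F i (h * g)%g) by exists e^-1.
have b0 : bounded_function (fun _ : G => 0 : R) by exists 0 => g; rewrite normr0.
have bN f : bounded_function f -> bounded_function (fun g : G => -1 * f g : R).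
  by move=> [c fc]; exists c => g; rewrite mulN1r normrN.
have bD f g : bounded_function f -> bounded_function g ->
    bounded_function (fun x : G => f x + g x : R).
  move=> [c fc] [d gd]; exists (c + d) => x.
  by rewrite (le_trans (ler_normD _ _))// lerD.
have M0 : M (fun=> 0) = 0.
  have := Mlin 1 _ _ b0 b0; rewrite (_ : (fun=> 1 * 0 + 0) = fun=> 0) ?mul1r.
    by move=> h; lra.
  by apply/funext => x; rewrite ?(mulr0, mul1r) addr0.
(* The function is spelled in the shape [c * f g + h g] of the linearity axiom, and with [1 * h] to
   match [bF]. *)
have MF i : M (fun h => -1 * F i (1 * h)%g + F i (k i * h)%g) = 0.
  rewrite Mlin// -(Minv (k i)^-1%g (fun h => F i (1 * h)%g))//.
  under [X in -1 * M X]eq_fun do rewrite invgK mul1g.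
  by rewrite mulN1r addNr.
suff : M (fun h => \sum_i (F i (k i * h)%g - F i h)) = 0.
  under eq_fun do rewrite F1.
  by rewrite M1 => /eqP; rewrite oner_eq0.
suff [_ ->] : bounded_function (fun h => \sum_i (F i (k i * h)%g - F i h)) /\
    M (fun h => \sum_i (F i (k i * h)%g - F i h)) = 0 by [].
elim: (index_enum _) => [|i s [bs Ms]].
  by under eq_fun do rewrite big_nil.
have -> : (fun h => \sum_(j <- i :: s) (F j (k j * h)%g - F j h)) =
    (fun h => 1 * (-1 * F i (1 * h)%g + F i (k i * h)%g) +
              \sum_(j <- s) (F j (k j * h)%g - F j h)).
  by apply/funext => h; rewrite big_cons mul1g; congr (_ + _); ring.
have bi : bounded_function (fun h => -1 * F i (1 * h)%g + F i (k i * h)%g).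
  by apply: (bD); [exact: bN|].
split; last by rewrite Mlin// MF Ms mulr0 addr0.
by apply: (bD) => //; under eq_fun do rewrite mul1r.
Qed.

(** * Real-valued probabilities *)

Section ProbabilityReal.
Variables (R : realType) (d : measure_display) (X : measurableType d).
Variable mu : probability X R.

Definition pm (A : set X) : R := fine (mu A).

Lemma pm_EFin A : measurable A -> mu A = (pm A)%:E.
Proof. by move=> mA; rewrite /pm fineK// fin_num_measure. Qed.

Lemma pm_ge0 A : 0 <= pm A.
Proof. exact: fine_ge0. Qed.

Lemma pm0 : pm set0 = 0.
Proof. by rewrite /pm measure0. Qed.

Lemma pmT : pm setT = 1.
Proof. by rewrite /pm probability_setT. Qed.

Lemma le_pm A B : measurable A -> measurable B -> A `<=` B -> pm A <= pm B.
Proof.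
by move=> mA mB AB; rewrite -lee_fin -!pm_EFin// le_measure// inE.
Qed.

Lemma pmU A B : measurable A -> measurable B -> A `&` B = set0 ->
  pm (A `|` B) = pm A + pm B.
Proof.
move=> mA mB AB; apply: EFin_inj; rewrite EFinD -!pm_EFin//; last exact: measurableU.
exact: measureU.
Qed.

Lemma pmU_le A B : measurable A -> measurable B -> pm (A `|` B) <= pm A + pm B.
Proof.
move=> mA mB; rewrite -lee_fin EFinD -!pm_EFin//; last exact: measurableU.
exact: measureU2.
Qed.

Lemma pmDI A B : measurable A -> measurable B -> pm A = pm (A `\` B) + pm (A `&` B).
Proof.
move=> mA mB; rewrite -pmU; [| exact: measurableD | exact: measurableI |].
  by rewrite setUC setUIDK.
by apply/seteqP; split => // x [[_ nB] [_]].
Qed.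

Lemma pm_setC A : measurable A -> pm (~` A) = 1 - pm A.
Proof.
move=> mA; rewrite -pmT (pmDI measurableT mA) setTI setTD; lra.
Qed.

Lemma pm_bigU (I : Type) (s : seq I) (A : I -> set X) :
  (forall i, measurable (A i)) ->
  pm (\big[setU/set0]_(i <- s) A i) <= \sum_(i <- s) pm (A i).
Proof.
move=> mA; elim: s => [|i s IH]; first by rewrite !big_nil pm0.
rewrite !big_cons (le_trans (pmU_le _ _))// ?lerD2l//.
exact: bigsetU_measurable.
Qed.

Lemma pm_partition (I : finType) (P : I -> set X) (A : set X) :
  measurable A -> (forall i, measurable (P i)) -> (forall x, exists i, P i x) ->
  (forall i j x, P i x -> P j x -> i = j) ->
  pm A = \sum_i pm (A `&` P i).
Proof.
move=> mA mP cover disj.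
suff H (s : seq I) : uniq s ->
    pm (A `&` \big[setU/set0]_(i <- s) P i) = \sum_(i <- s) pm (A `&` P i).
  rewrite -H ?index_enum_uniq//; congr pm; apply/seteqP; split => [x Ax|x []//].
  split => //; have [i Pi] := cover x; rewrite -bigcup_seq; exists i => //=.
  exact: mem_index_enum.
elim: s => [|i s IH]; first by rewrite !big_nil setI0 pm0.
move=> /= /andP[iNs us]; rewrite !big_cons -IH// setIUr pmU//.
- exact: measurableI.
- by apply: measurableI => //; exact: bigsetU_measurable.
- apply/seteqP; split => // x [[_ Pi] [_]]; rewrite -bigcup_seq => -[j /= js Pj].
  by move: iNs; rewrite (disj _ _ _ Pi Pj) js.
Qed.

(* Markov's inequality for the counting function of the [A i]. *)
Lemma pm_count (I : Type) (s : seq I) (A : I -> set X) (F : set X) (N : nat) :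
  (forall i, measurable (A i)) -> measurable F ->
  (forall x, F x -> (N <= count (fun i => `[< A i x >]) s)%N) ->
  N%:R * pm F <= \sum_(i <- s) pm (A i `&` F).
Proof.
move=> mA; elim: s F N => [|i s IH] F N mF FN.
  have [->|/set0P[x Fx]] := eqVneq F set0; first by rewrite pm0 mulr0 big_nil.
  by have := FN _ Fx; rewrite /= leqn0 => /eqP ->; rewrite mul0r big_nil.
case: N FN => [|N] FN; first by rewrite mul0r sumr_ge0// => *; exact: pm_ge0.
rewrite big_cons.
have mFA : measurable (F `&` A i) by exact: measurableI.
have mFD : measurable (F `\` A i) by exact: measurableD.
have h1 := IH (F `&` A i) N mFA; have h2 := IH (F `\` A i) N.+1 mFD.
have {}h1 : N%:R * pm (F `&` A i) <= \sum_(j <- s) pm (A j `&` (F `&` A i)).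
  by apply: h1 => x [Fx Ax]; have := FN _ Fx; rewrite /= asboolT.
have {}h2 : N.+1%:R * pm (F `\` A i) <= \sum_(j <- s) pm (A j `&` (F `\` A i)).
  by apply: h2 => x [Fx Ax]; have := FN _ Fx; rewrite /= asboolF.
have -> : \sum_(j <- s) pm (A j `&` F) =
    \sum_(j <- s) pm (A j `&` (F `\` A i)) + \sum_(j <- s) pm (A j `&` (F `&` A i)).
  rewrite -big_split; apply: eq_bigr => j _ /=.
  have mAF : measurable (A j `&` F) by exact: measurableI.
  by rewrite (pmDI mAF (mA i)) setIDA setIA.
rewrite (pmDI mF (mA i)) [A i `&` F]setIC.
move: h1 h2; rewrite -natr1; lra.
Qed.

Lemma pm_nondecreasing (A : nat -> set X) (e : R) :
  (forall n, measurable (A n)) -> (forall n, A n `<=` A n.+1) -> 0 < e ->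
  exists n, pm (\bigcup_k A k) - pm (A n) < e.
Proof.
move=> mA incrA e0.
have ndA : nondecreasing_seq A.
  by apply/nondecreasing_seqP => n; rewrite subsetEset.
have mU : measurable (\bigcup_k A k) by exact: bigcupT_measurable.
have /fine_cvg : (mu \o A) n @[n --> \oo] --> (pm (\bigcup_k A k))%:E.
  by rewrite -pm_EFin//; exact: nondecreasing_cvg_mu.
move=> /cvgrPdist_lt/(_ _ e0)[n _ /(_ n (leqnn n))] /= h; exists n.
by apply: le_lt_trans h; exact: ler_norm.
Qed.

End ProbabilityReal.

(** * A Rokhlin lemma for amenable groups *)

(** Small balls around the points of a countable dense set separate points. Their interiors are
    used, since balls themselves may fail to be open. *)
Lemma standard_borel_separating (R : realType) (d : measure_display) (X : measurableType d) :
  standard_borel R X ->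
  exists U : nat -> set X, (forall n, measurable (U n)) /\
    forall x y, x <> y -> exists n, U n x /\ ~ U n y.
Proof.
move=> [T [f [hT [S cS dS] [g fK gK] mX]]].
have [en enP] := countable_enum cS.
pose V n : set T := if unpickle n is Some (i, j) then
   if en i is Some s then interior (ball s (j.+1%:R^-1 : R)) else set0 else set0.
have openV n : open (V n).
  rewrite /V; case: (unpickle n) => [[i j]|]; last exact: open0.
  by case: (en i) => [s|]; [exact: open_interior|exact: open0].
exists (fun n => f @^-1` V n); split.
  move=> n; apply/mX; rewrite image_preimage; first exact: sub_sigma_algebra.
  by apply/seteqP; split => // y _; exists (g y).
move=> x y xy.
have /eqP fxy : f x != f y by apply/eqP => /(can_inj fK).
move: hT; rewrite ball_hausdorff => /(_ (f x) (f y)) [|[r r'] /= /eqP rr'].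
  exact/eqP.
(* If [f y] were in the ball of radius [1 / (j + 1)] around [s], it would be at distance at most
   [3 / 2] times this radius from [f x], hence within [r]. *)
have [j jr] : exists j, 2 * j.+1%:R^-1 < r%:num.
  have [|j jr] := @ltr_add_invr R 0 (r%:num / 2); first by rewrite divr_gt0.
  by exists j; rewrite mulrC -ltr_pdivlMr// -[ltLHS]add0r.
have j0 : 0 < j.+1%:R^-1 :> R by rewrite invr_gt0.
have j20 : 0 < j.+1%:R^-1 / 2 :> R by rewrite divr_gt0.
have fxball : nbhs (f x) (interior (ball (f x) (j.+1%:R^-1 / 2))).
  exact/nbhs_interior/nbhsx_ballx.
have [||s [/interior_subset fxs Ss]] := dS (interior (ball (f x) (j.+1%:R^-1 / 2))).
- by exists (f x); exact: nbhs_singleton.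
- exact: open_interior.
have [i ei] := enP _ Ss; exists (pickle (i, j)).
rewrite /preimage/= /V pickleK ei; split.
  apply: (@interiorS _ (ball (f x) (j.+1%:R^-1 / 2))) (nbhs_singleton fxball).
  by move=> z; exact: ball_split (ball_sym fxs).
move=> /interior_subset sy.
have : (ball (f x) r%:num `&` ball (f y) r'%:num) (f y).
  split; last exact: ballxx.
  apply: (@le_ball _ _ _ (j.+1%:R^-1 / 2 + j.+1%:R^-1)).
    move: j0 jr; move: (j.+1%:R^-1) (r%:num) => q r0 q0 qr; lra.
  exact: ball_triangle fxs sy.
by rewrite rr'.
Qed.

Section Rokhlin.
Variables (R : realType) (G : groupType) (d : measure_display).
Variables (X : measurableType d) (mu : probability X R) (al : standardAction G mu).

Local Notation m := (pm mu).

Lemma sactVK g x : al g (al g^-1%g x) = x.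
Proof. by rewrite -sactM mulgV sact1. Qed.

Lemma measurable_preimage_sact g A : measurable A -> measurable (al g @^-1` A).
Proof. by move=> mA; rewrite -[X in measurable X]setTI; exact: sact_measurable. Qed.

Lemma pm_preimage_sact g A : measurable A -> m (al g @^-1` A) = m A.
Proof. by move=> mA; rewrite /pm sact_preserving. Qed.

(** Induction on [L]. By freeness [g] moves almost every point, so the pieces of [Q] on which some
    [U n] separates [x] from [g x] cover [Q] up to a null set. One of the countably many pieces has
    positive measure, and [g] moves it off itself. *)
Lemma wandering_subset (P : set X) (L : seq G) : measurable P -> 0 < m P ->
  (forall g, g \in L -> g <> 1%g) ->
  exists Q, [/\ measurable Q, Q `<=` P, 0 < m Q &
    forall g x, g \in L -> Q x -> ~ Q (al g x)].
Proof.
have [U [mU sepU]] := standard_borel_separating (sact_standard al).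
move=> + + ; elim: L P => [|g L IH] P mP P0 L1; first by exists P; split => //.
have [//|//|h hL|Q [mQ QP Q0 QL]] := IH P; first by apply: L1; rewrite inE hL orbT.
have [N [mN N0 fN]] := sact_ess_free al.
pose V n := Q `&` (U n `&` al g @^-1` (~` U n)).
have mV n : measurable (V n).
  apply: measurableI => //; apply: measurableI => //.
  exact/measurable_preimage_sact/measurableC.
have [n Vn] : exists n, 0 < m (V n).
  apply: contrapT => nV.
  suff : mu Q = 0%E by rewrite pm_EFin// => -[Q_eq0]; rewrite Q_eq0 ltxx in Q0.
  apply: measure_negligible => //; apply: (@negligibleS _ _ _ _ (N `|` \bigcup_n V n)).
    move=> x Qx; have [Nx|nN] := pselect (N x); [by left|right].
    have gx : x <> al g x.
      move=> /esym gx; apply: nN; apply: fN => /(_ g gx) g1.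
      by apply: (L1 g); rewrite ?mem_head.
    by have [k [Ukx nUk]] := sepU _ _ gx; exists k.
  apply: negligibleU; first by exists N; split.
  apply: negligible_bigcup => k; apply/negligibleP => //.
  transitivity (m (V k))%:E; first exact: (pm_EFin mu (mV k)).
  congr EFin; apply/eqP; rewrite eq_le pm_ge0 andbT leNgt.
  by apply/negP => Vk; apply: nV; exists k.
exists (V n); split => //; first by move=> x [/QP].
move=> h x; rewrite inE => /predU1P[-> [_ [_ nU]] [_ [/nU]]//|hL [Qx _] [Qhx _]].
exact: QL hL Qx Qhx.
Qed.

End Rokhlin.

(** * Traces of Folner sets on orbits *)

Section Tiles.
Variables (R : realType) (G : groupType) (d : measure_display).
Variables (X : measurableType d) (mu : probability X R) (al : standardAction G mu).

Local Notation m := (pm mu).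

(* The trace of a Folner set [T] on the orbit of [p], i.e. the set of [t] in [T]
   with [t p] in [Y], inherits the boundary estimate of [T] on average over [p]. *)
Lemma folner_trace (M : nat) (k : 'I_M -> G) (e : R) (T : seq G) (Y : set X) :
  uniq T -> (boundary k T)%:R < e * (size T)%:R -> measurable Y -> 0 < m Y ->
  exists (T' : seq G) (P : set X),
    [/\ uniq T', measurable P, 0 < m P,
     (\sum_(t <- T') \sum_i ((k i * t)%g \notin T : nat))%:R < e * (size T')%:R &
     forall p t, P p -> (t \in T') <-> (t \in T /\ Y (al t p))].
Proof.
move=> uT bT mY Y0; pose n := size T; pose t (i : 'I_n) := nth 1%g T i.
have tT i : t i \in T by rewrite mem_nth.
have tinj : injective t.
  by move=> i j /eqP; rewrite nth_uniq// => /eqP/val_inj.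
have Tt g : g \in T -> exists i, g = t i.
  by move=> /(nthP 1%g)[i iT <-]; exists (Ordinal iT).
(* Exits are counted from [T] and not from the trace: leaving the trace inside [T] means leaving
   [Y]. *)
pose c (i : 'I_n) := \sum_j ((k j * t i)%g \notin T : nat).
have bE : boundary k T = \sum_i c i.
  rewrite /boundary exchange_big/=; apply: eq_bigr => j _.
  by rewrite -sum1_count big_mkcond (big_nth 1%g) big_mkord; apply: eq_bigr => i _; case: ifP.
(* The points [p] whose trace is exactly [Q]; these atoms partition [X]. *)
pose P (Q : {set 'I_n}) : set X :=
  \bigcap_(i in [set: 'I_n]) (if i \in Q then al (t i) @^-1` Y else ~` (al (t i) @^-1` Y)).
have mP Q : measurable (P Q).
  apply: fin_bigcap_measurable => // i _.
  by case: ifP => _; [|apply: measurableC]; exact: measurable_preimage_sact.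
have PE Q p i : P Q p -> i \in Q <-> Y (al (t i) p).
  by move=> /(_ i Logic.I); case: ifP.
have mYE i : m Y = \sum_(Q : {set 'I_n}) (i \in Q)%:R * m (P Q).
  rewrite -(pm_preimage_sact al (t i) mY) (pm_partition mu _ mP).
  - apply: eq_bigr => Q _; case: (boolP (i \in Q)) => iQ.
      rewrite mul1r; congr pm; apply/seteqP; split => [p []//|p Pp]; split => //.
      exact/(PE Q p i Pp).
    rewrite mul0r (_ : _ `&` _ = set0) ?pm0//; apply/seteqP; split => // p [Yp /PE h].
    by move/negP: iQ; apply; apply/h.
  - exact: measurable_preimage_sact.
  - move=> p; exists [set j : 'I_n | `[< Y (al (t j) p) >]]%SET => j _.
    by rewrite inE; case: asboolP.
  - move=> Q Q' p PQ PQ'; apply/setP => j; apply/idP/idP.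
      by move/(PE Q p j PQ)/(PE Q' p j PQ').
    by move/(PE Q' p j PQ')/(PE Q p j PQ).
(* Otherwise every atom of positive measure satisfies the reverse inequality. Weighted by the
   measures of the atoms these add up to [m Y] times the reverse of [bT], since by invariance each
   [i] lies in the trace on a set of measure [m Y]. *)
have [Q [PQ0 cQ]] : exists Q : {set 'I_n}, 0 < m (P Q) /\
    (\sum_(i in Q) c i)%:R < e * #|Q|%:R.
  apply: contrapT => nQ.
  have : \sum_(Q : {set 'I_n}) m (P Q) * (e * #|Q|%:R) <=
      \sum_(Q : {set 'I_n}) m (P Q) * (\sum_(i in Q) c i)%:R.
    apply: ler_sum => Q _; have [->|PQ] := eqVneq (m (P Q)) 0; first by rewrite !mul0r.
    have PQ0 : 0 < m (P Q) by rewrite lt_neqAle eq_sym PQ pm_ge0.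
    by rewrite ler_pM2l// leNgt; apply/negP => h; apply: nQ; exists Q.
  have S (f : 'I_n -> R) : \sum_(Q : {set 'I_n}) m (P Q) * \sum_(i in Q) f i = m Y * \sum_i f i.
    under eq_bigr do rewrite big_mkcond mulr_sumr.
    rewrite exchange_big mulr_sumr; apply: eq_bigr => i _.
    rewrite (mYE i) mulr_suml; apply: eq_bigr => Q _.
    by case: ifP => _; rewrite ?(mulr0, mul1r, mul0r).
  have -> : \sum_(Q : {set 'I_n}) m (P Q) * (e * #|Q|%:R) = m Y * (e * (size T)%:R).
    rewrite -[size T]card_ord -sum1_card natr_sum mulr_sumr -S.
    by apply: eq_bigr => Q _; rewrite -sum1_card natr_sum mulr_sumr.
  under [leRHS]eq_bigr do rewrite natr_sum.
  by rewrite S -natr_sum -bE ler_pM2l// leNgt bT.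
exists [seq t i | i <- enum Q], (P Q); split => //.
- by rewrite map_inj_uniq// enum_uniq.
- by rewrite size_map -cardE big_map big_enum.
- move=> p g Pp; split.
    by move=> /mapP[i]; rewrite mem_enum => /(PE Q p i Pp) Yi ->; split.
  move=> [/Tt[i ->]] /(PE Q p i Pp) iQ; apply: map_f.
  by rewrite mem_enum.
Qed.

End Tiles.

Lemma pm_bigU_disjoint (R : realType) (d : measure_display) (X : measurableType d)
    (mu : probability X R) (I : choiceType) (s : seq I) (A : I -> set X) :
  uniq s -> (forall i, measurable (A i)) ->
  (forall i j x, i \in s -> j \in s -> A i x -> A j x -> i = j) ->
  pm mu (\big[setU/set0]_(i <- s) A i) = \sum_(i <- s) pm mu (A i).
Proof.
move=> + mA; elim: s => [|i s IH]; first by rewrite !big_nil pm0.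
move=> /= /andP[iNs us] disj; rewrite !big_cons pmU ?IH//.
- by move=> j j' x js j's; apply: disj; rewrite inE (js, j's) orbT.
- exact: bigsetU_measurable.
- apply/seteqP; split => // x [Ax]; rewrite -bigcup_seq => -[j /= js Aj].
  by move: iNs; rewrite (disj i j x)// ?js// inE ?eqxx// js orbT.
Qed.

(** * Almost equivariant partial maps to the group *)

Section PartialSections.
Variables (R : realType) (G : groupType) (d : measure_display).
Variables (X : measurableType d) (mu : probability X R) (al : standardAction G mu).
Hypothesis cG : countable [set: G].

Local Notation m := (pm mu).
Implicit Types f : X -> option G.

Definition pmeasurable f : Prop := forall o, measurable (f @^-1` [set o]).

Definition covered f : set X := ~` (f @^-1` [set None]).

(** Being undefined at both points counts as agreement, being defined at only one of them as a
    defect. *)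
Definition defect f (g : G) : set X :=
  [set x | f (al g^-1%g x) <> omap (fun t => (g^-1 * t)%g) (f x)].

Definition extends f f' : Prop := forall x t, f x = Some t -> f' x = Some t.

Lemma measurable_covered f : pmeasurable f -> measurable (covered f).
Proof. by move=> mf; exact: measurableC. Qed.

Lemma measurable_defect f g : pmeasurable f -> measurable (defect f g).
Proof.
move=> mf.
pose D o := f @^-1` [set o] `&`
  (al g^-1%g @^-1` (~` (f @^-1` [set omap (fun t => (g^-1 * t)%g) o]))).
have mD o : measurable (D o).
  by apply: measurableI => //; apply: measurable_preimage_sact; exact: measurableC.
rewrite (_ : defect f g = D None `|` \bigcup_t D (Some t)).
  by apply: measurableU => //; exact: countable_bigcupT_measurable.
apply/seteqP; split => x.
  rewrite /defect/=; case fx: (f x) => [t|] h; last by left; split.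
  by right; exists t => //; split.
by case=> [[]|[t _ []]] /=; rewrite /defect/= => ->.
Qed.

Lemma extends_covered f f' : extends f f' -> covered f `<=` covered f'.
Proof.
by move=> ff' x; rewrite /covered/=; case fx: (f x) => [t|]// _; rewrite (ff' x t).
Qed.

Variables (M : nat) (k : 'I_M -> G) (e : R).
Hypothesis e0 : 0 < e.
Hypothesis amG : amenable R G.

Definition cost f : R := \sum_i m (defect f (k i)).

(** The bound is proportional to the covered measure, so a tower whose own defect is at most [e]
    times its measure can be added. *)
Definition admissible f : Prop := pmeasurable f /\ cost f <= e * m (covered f).

(** The disjoint tiles [t Q] with [t] in [T'] lie in the uncovered set [Y]; the new map has the
    value [t] on [t Q]. New defects come only from translates leaving [T], fewer than [e * size T']
    in number, each of measure [m Q]. *)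
Lemma extension_step f : admissible f -> m (covered f) < 1 ->
  exists f', [/\ admissible f', extends f f' & m (covered f) < m (covered f')].
Proof.
move=> [mf costf] cov1; pose Y := ~` covered f.
have mY : measurable Y by exact/measurableC/measurable_covered.
have Y0 : 0 < m Y.
  by rewrite pm_setC ?subr_gt0//; exact: measurable_covered.
(* Inverses are included because either [x] or its translate by [(k j)^-1] may be the point in a
   tile. *)
pose kk (i : 'I_(M + M)) := match fintype.split i with inl j => (k j)^-1%g | inr j => k j end.
have [T [uT _ bT]] := amenable_folner kk cG amG e0.
have [T' [P [uT' mP P0 cT' PE]]] := folner_trace al uT bT mY Y0.
(* If [Q] avoids its translates by the quotients of distinct elements of [T'], the tiles are
   disjoint. *)
pose L := [seq (s^-1 * t)%g | s <- T', t <- [seq t <- T' | s != t]].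
have [|Q [mQ QP Q0 QL]] := wandering_subset al mP P0 (L := L).
  move=> g /allpairsPdep[s [t [_ + ->]]]; rewrite mem_filter => /andP[/eqP st _] h.
  by apply: st; rewrite -[t](mulVKg s) h mulg1.
have Qdisj x s t : s \in T' -> t \in T' -> Q (al s^-1%g x) -> Q (al t^-1%g x) -> s = t.
  move=> sT tT Qs Qt; apply/eqP; apply: contraT => st; exfalso.
  apply: (QL (s^-1 * t)%g _ _ Qt).
    by apply/allpairsPdep; exists s, t; rewrite mem_filter st.
  by rewrite sactM sactVK.
have QY x t : t \in T' -> Q (al t^-1%g x) -> f x = None.
  move=> tT /QP /(PE _ t)[/(_ tT)[_ +] _].
  by rewrite sactVK /Y/covered/= => /contrapT.
have [f' f'E] : exists f', forall x t,
    f' x = Some t <-> f x = Some t \/ (t \in T' /\ Q (al t^-1%g x)).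
  have /choice[f' f'E] : forall x, exists o, forall t,
      o = Some t <-> f x = Some t \/ (t \in T' /\ Q (al t^-1%g x)).
    move=> x; have [[t [tT Qt]]|nt] := pselect (exists t, t \in T' /\ Q (al t^-1%g x)).
      exists (Some t) => s; split => [[<-]|]; first by right.
      case=> [|[sT Qs]]; first by rewrite (QY x t).
      by rewrite (Qdisj x t s).
    exists (f x) => t; split; first by left.
    by case=> // ht; case: nt; exists t.
  by exists f'.
have extf : extends f f' by move=> x t fx; apply/f'E; left.
have f'None x : f' x = None -> f x = None /\ forall t, t \in T' -> ~ Q (al t^-1%g x).
  move=> f'x; split.
    by case fx: (f x) => [t|]//; have := extf _ _ fx; rewrite f'x.
  by move=> t tT Qt; have /f'E : f x = Some t \/ (t \in T' /\ Q (al t^-1%g x)) by [right|];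
     rewrite f'x.
have mtQ t : measurable (al t^-1%g @^-1` Q) by exact: measurable_preimage_sact.
pose W := \big[setU/set0]_(t <- T') (al t^-1%g @^-1` Q).
have mW : measurable W by exact: bigsetU_measurable.
have covE : covered f' = covered f `|` W.
  rewrite /W -bigcup_seq; apply/seteqP; split => x.
    rewrite /covered/=; case f'x: (f' x) => [t|]// _; move/f'E : f'x => [->|[tT Qt]].
      by left.
    by right; exists t.
  move=> [/(extends_covered extf)//|[t /= tT Qt]]; rewrite /covered/= => /f'None[_ /(_ t tT)].
  exact.
have mf' : pmeasurable f'.
  move=> [t|]; last by rewrite -[X in measurable X]setCK -/(covered f') covE;
    apply/measurableC/measurableU => //; exact: measurable_covered.
  rewrite (_ : _ @^-1` _ = f @^-1` [set Some t] `|`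
     (if t \in T' then al t^-1%g @^-1` Q else set0)).
    by apply: measurableU => //; case: ifP.
  apply/seteqP; split => x /=.
    by move=> /f'E[|[->]]; [left|right].
  by case=> [fx|]; [exact: extf|case: ifPn => // tT Qt; apply/f'E; right].
have covD : m (covered f') = m (covered f) + (size T')%:R * m Q.
  rewrite covE pmU//; [|exact: measurable_covered|]; last first.
    apply/seteqP; split => // x [cx]; rewrite /W -bigcup_seq => -[t /= tT Qt].
    by apply: cx; exact: QY tT Qt.
  congr (_ + _); rewrite /W pm_bigU_disjoint//; last first.
    by move=> s t x; exact: Qdisj.
  under eq_bigr do rewrite pm_preimage_sact//.
  by rewrite big_const_seq count_predT iter_addr_0 mulr_natl.
exists f'; split => //; last first.
  rewrite covD ltrDl mulr_gt0// ltr0n lt0n size_eq0.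
  by apply/negP => /eqP T'0; move: cT'; rewrite T'0 big_nil mulr0 ltxx.
split => //; pose out (g : G) := (g \notin T : nat).
(* A new defect at [x] has two possible sources: [x] is in [t Q] and [g^-1 t] is outside of [T],
   giving [B g], or [g^-1 x] is in [t Q] and [g t] is outside of [T], giving [B' g]. *)
pose B g := \big[setU/set0]_(t <- T')
   (if (g^-1 * t)%g \notin T then al t^-1%g @^-1` Q else set0).
pose B' g := \big[setU/set0]_(t <- T')
   (if (g * t)%g \notin T then al (g * t)^-1%g @^-1` Q else set0).
have mB g : measurable (B g).
  by apply: bigsetU_measurable => t _; case: ifP.
have mB' g : measurable (B' g).
  by apply: bigsetU_measurable => t _; case: ifP.
have pmB g : m (B g) <= (\sum_(t <- T') out (g^-1 * t)%g)%:R * m Q.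
  rewrite natr_sum mulr_suml; apply: le_trans (pm_bigU mu _ _) _.
    by move=> t; case: ifP.
  apply: ler_sum => t _; rewrite /out; case: ifP => _.
    by rewrite pm_preimage_sact// mul1r.
  by rewrite pm0 mul0r.
have pmB' g : m (B' g) <= (\sum_(t <- T') out (g * t)%g)%:R * m Q.
  rewrite natr_sum mulr_suml; apply: le_trans (pm_bigU mu _ _) _.
    by move=> t; case: ifP.
  apply: ler_sum => t _; rewrite /out; case: ifP => _.
    by rewrite pm_preimage_sact// mul1r.
  by rewrite pm0 mul0r.
(* Where [f] has no defect, a point of a tile and its translate both lie in [Y]. As [T'] is the
   whole trace of [T] on [Y], a translate that stays in [T] stays in the tower, with the expected
   value. *)
have defE g : defect f' g `<=` defect f g `|` (B g `|` B' g).
  move=> x; rewrite /defect/= => dx.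
  have [fx|] := pselect (f (al g^-1%g x) = omap (fun t => (g^-1 * t)%g) (f x)); last by left.
  right; case f'x: (f' x) dx => [t|] /= dx.
    left; rewrite /B -bigcup_seq; move/f'E : f'x => [ft|[tT Qt]].
      by exfalso; apply: dx; rewrite (extf _ (g^-1 * t)%g)// fx ft.
    exists t => //=; case: ifPn => // /negPn gtT; exfalso; apply: dx; apply/f'E; right.
    have Qt' : Q (al (g^-1 * t)^-1%g (al g^-1%g x)).
      by rewrite -sactM invgM invgK mulgK.
    split => //; apply/(PE _ (g^-1 * t)%g (QP _ Qt')); split => //.
    by rewrite sactVK /Y/covered/= fx (QY x t).
  case f'gx: (f' (al g^-1%g x)) dx => [s|]// _.
  right; rewrite /B' -bigcup_seq.
  have [fx0 noQ] := f'None _ f'x.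
  move/f'E : f'gx => [|[sT Qs]]; first by rewrite fx fx0.
  have Qs' : Q (al (g * s)^-1%g x) by rewrite invgM sactM.
  exists s => //=; case: ifPn => // /negPn gsT; exfalso.
  apply: (noQ (g * s)%g) => //; apply/(PE _ (g * s)%g (QP _ Qs')); split => //.
  by rewrite sactVK /Y/covered/= fx0.
have mdef g : measurable (defect f g) by exact: measurable_defect.
have mdef' g : measurable (defect f' g) by exact: measurable_defect.
have defD g : m (defect f' g) <= m (defect f g) +
   (\sum_(t <- T') (out (g^-1 * t)%g + out (g * t)%g)%N)%:R * m Q.
  apply: le_trans (le_pm mu _ _ (defE g)) _ => //=.
    by apply: measurableU => //; exact: measurableU.
  apply: le_trans (pmU_le mu _ _) _ => //; first exact: measurableU.
  rewrite lerD2l (le_trans (pmU_le mu _ _))// big_split/= natrD mulrDl.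
  by rewrite lerD.
apply: (@le_trans _ _ (cost f + (\sum_(t <- T') \sum_i ((kk i * t)%g \notin T : nat))%:R * m Q)).
  rewrite exchange_big/= natr_sum mulr_suml big_split_ord/= -big_split/=.
  rewrite /cost -big_split/=; apply: ler_sum => i _.
  apply: le_trans (defD _) _; rewrite lerD2l -mulrDl -natrD -big_split/=.
  rewrite ler_pM2r// ler_nat; apply: leq_sum => t _.
  by rewrite /kk -[lshift M i]/(unsplit (inl i)) -[rshift M i]/(unsplit (inr i)) !unsplitK.
rewrite covD mulrDr lerD// mulrA ler_pM2r//; exact: ltW.
Qed.

End PartialSections.

(** Each step of a greedy chain realizes at least half of the gain still possible. If an upper bound
    of the chain could be improved by [d], every step would have gained [d / 2], against the bound
    1. *)
Lemma exhaustion (R : realType) (S : Type) (le : S -> S -> Prop) (v : S -> R) (s0 : S) :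
  (forall s, le s s) -> (forall s t u, le s t -> le t u -> le s u) ->
  (forall s t, le s t -> v s <= v t) -> (forall s, v s <= 1) ->
  (forall u : nat -> S, (forall n, le (u n) (u n.+1)) -> exists s, forall n, le (u n) s) ->
  exists s, forall t, le s t -> v t <= v s.
Proof.
move=> lexx letr v_homo v1 chainub.
have /choice[nx nxP] : forall s, exists t, le s t /\
    forall t', le s t' -> v t' - v s <= 2 * (v t - v s).
  move=> s; pose E := [set v t | t in [set t | le s t]].
  have hE : has_sup E.
    split; first by exists (v s), s => //=.
    by exists 1 => _ [t _ <-].
  have supE t : le s t -> v t <= sup E.
    by move=> st; apply: sup_upper_bound => //; exists t.
  have [vs|vs] := leP (sup E) (v s).
    exists s; split => // t' st'; rewrite subrr mulr0 subr_le0.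
    by rewrite (le_trans (supE _ st')).
  have d0 : 0 < (sup E - v s) / 2 by rewrite divr_gt0// subr_gt0.
  have [_ [t st <-] ht] := sup_adherent d0 hE.
  exists t; split => // t' st'; have := supE _ st'; lra.
pose u := fix u n := if n is n'.+1 then nx (u n') else s0.
have u0 : u 0%N = s0 by [].
have uS n : u n.+1 = nx (u n) by [].
clearbody u.
have uup n : le (u n) (u n.+1) by rewrite uS; exact: (nxP _).1.
have [s us] := chainub u uup.
exists s => t st; rewrite leNgt; apply/negP => ltst.
pose d := v t - v s; have d0 : 0 < d by rewrite subr_gt0.
have uD n : v s0 + n%:R * (d / 2) <= v (u n).
  elim: n => [|n IH]; first by rewrite u0 mul0r addr0.
  have /(nxP (u n)).2 := letr _ _ _ (us n) st.
  have := v_homo _ _ (us n); rewrite uS.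
  have -> : n.+1%:R * (d / 2) = n%:R * (d / 2) + d / 2.
    by rewrite -[n.+1%:R]natr1 mulrDl mul1r.
  have dE : d = v t - v s by []; clearbody d; lra.
have [n] : exists n : nat, (1 - v s0) / (d / 2) < n%:R.
  by exists (Num.truncn ((1 - v s0) / (d / 2))).+1; exact: truncnS_gt.
rewrite ltr_pdivrMr ?divr_gt0//; have := uD n; have := v1 (u n); lra.
Qed.

(** * Almost equivariant maps defined everywhere *)

Section Sections.
Variables (R : realType) (G : groupType) (d : measure_display).
Variables (X : measurableType d) (mu : probability X R) (al : standardAction G mu).
Hypothesis cG : countable [set: G].
Hypothesis amG : amenable R G.

Local Notation m := (pm mu).

Lemma pm_le1 A : measurable A -> m A <= 1.
Proof. by move=> mA; rewrite -(pmT mu) le_pm. Qed.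

Lemma extends_chain (f : nat -> X -> option G) :
  (forall n, extends (f n) (f n.+1)) ->
  exists2 g, (forall n, extends (f n) g) &
    forall x t, g x = Some t -> exists n, f n x = Some t.
Proof.
move=> fS.
have fmono p n : (p <= n)%N -> extends (f p) (f n).
  by move=> /subnK <-; elim: (n - p)%N => //= k IH x t /IH /fS.
have /choice[g gE] : forall x, exists o,
    (forall n t, f n x = Some t -> o = Some t) /\
    (forall t, o = Some t -> exists n, f n x = Some t).
  move=> x; have [[n [t fnt]]|nf] := pselect (exists n t, f n x = Some t).
    exists (Some t); split; last by move=> _ [<-]; exists n.
    move=> p s fps; have := fmono _ _ (leq_maxl p n) _ _ fps.
    by rewrite (fmono _ _ (leq_maxr p n) _ _ fnt).
  by exists None; split => // n t fnt; case: nf; exists n, t.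
exists g => [n x t|x t]; first exact: (gE x).1.
exact: (gE x).2.
Qed.

(** The union [g] differs from a late [f n] only on a small set [D], so a defect of [g] exceeds that
    of [f n] by [D] and a translate of [D] at most. *)
Lemma admissible_chain (M : nat) (k : 'I_M -> G) (e : R) (f : nat -> X -> option G) :
  0 < e -> (forall n, admissible al k e (f n)) ->
  (forall n, extends (f n) (f n.+1)) ->
  exists2 g, admissible al k e g & forall n, extends (f n) g.
Proof.
move=> e0 admf fS; have [g fg gf] := extends_chain fS; exists g => //.
have mf n : pmeasurable (f n) by have [] := admf n.
have mcf n : measurable (covered (f n)) by exact: measurable_covered.
have covE : covered g = \bigcup_n covered (f n).
  apply/seteqP; split => [x|x [n _]]; last exact: extends_covered.
  rewrite /covered/=; case gx: (g x) => [t|]// _.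
  by have [n fn] := gf _ _ gx; exists n => //=; rewrite fn.
have mcg : measurable (covered g) by rewrite covE; exact: bigcupT_measurable.
have mg : pmeasurable g.
  move=> [t|]; last by rewrite -[X in measurable X]setCK; exact: measurableC.
  rewrite (_ : _ @^-1` _ = \bigcup_n (f n @^-1` [set Some t])).
    by apply: bigcupT_measurable => n; exact: mf.
  apply/seteqP; split => x /=; last by move=> [n _ /= /fg].
  by move=> /gf[n fn]; exists n.
split => //; apply/ler_addgt0Pr => r r0.
(* The [M] defects grow by at most [2 * q] each, hence by at most [r] in all; [M.+1] avoids dividing
   by 0. *)
pose q := r / (2 * M.+1%:R).
have q0 : 0 < q by rewrite divr_gt0// mulr_gt0.
have [n] := @pm_nondecreasing _ _ _ mu (fun n => covered (f n)) q mcf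
  (fun n => extends_covered (fS n)) q0.
rewrite -covE => nq.
pose D := covered g `\` covered (f n).
have mD : measurable D by exact: measurableD.
have pmD : m D < q.
  have := pmDI mu mcg (mcf n); rewrite -/D (_ : _ `&` _ = covered (f n)); first lra.
  by rewrite setIC setIidl//; exact: extends_covered.
have agree x : ~ D x -> f n x = g x.
  move=> nDx; case fx: (f n x) => [t|]; first by rewrite (fg n x t).
  case gx: (g x) => [t|]//; case: nDx; split; rewrite /covered/= ?gx//.
have mt h : measurable (al h @^-1` D) by exact: measurable_preimage_sact.
have defE h : defect al g h `<=` defect al (f n) h `|` (D `|` al h^-1%g @^-1` D).
  move=> x; rewrite /defect/= => dx.
  have [Dx|nDx] := pselect (D x); first by right; left.
  have [Dhx|nDhx] := pselect (D (al h^-1%g x)); first by right; right.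
  by left; rewrite !agree.
have defD h : m (defect al g h) <= m (defect al (f n) h) + 2 * q.
  have mdf : measurable (defect al (f n) h) by exact: measurable_defect.
  apply: le_trans (le_pm mu _ _ (defE h)) _; first exact: measurable_defect.
    by apply: measurableU => //; exact: measurableU.
  apply: le_trans (pmU_le mu _ _) _ => //; first exact: measurableU.
  rewrite lerD2l (le_trans (pmU_le mu _ _))// pm_preimage_sact//; move: pmD; lra.
have [_ costf] := admf n.
have : cost al k g <= cost al k (f n) + M%:R * (2 * q).
  rewrite /cost; apply: (@le_trans _ _ (\sum_i (m (defect al (f n) (k i)) + 2 * q))).
    by apply: ler_sum => i _; exact: defD.
  by rewrite big_split/= lerD2l sumr_const card_ord -[leLHS]mulr_natl.
move=> /le_trans; apply; apply: lerD.
  apply: le_trans costf _; rewrite ler_pM2l//; apply: le_pm => //.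
  exact: extends_covered.
have -> : M%:R * (2 * q) = r * (M%:R / M.+1%:R).
  by rewrite /q; field; rewrite nat1r pnatr_eq0.
by rewrite (ler_piMr (ltW r0))// ler_pdivrMr// mul1r ler_nat.
Qed.

(** Starting from the nowhere defined map, exhaustion yields an admissible map of maximal domain,
    which [extension_step] would enlarge if it missed a set of positive measure. *)
Lemma almost_everywhere_section (M : nat) (k : 'I_M -> G) (e : R) : 0 < e ->
  exists2 f, admissible al k e f & m (covered f) = 1.
Proof.
move=> e0; pose S := {f | admissible al k e f}.
have s0P : admissible al k e (fun=> None).
  split.
    move=> [t|]; last by rewrite (_ : _ @^-1` _ = setT)//; apply/seteqP; split.
    by rewrite (_ : _ @^-1` _ = set0)//; apply/seteqP; split.
  rewrite /cost big1 ?mulr_ge0 ?pm_ge0 ?(ltW e0)// => i _.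
  by rewrite (_ : defect _ _ _ = set0) ?pm0//; apply/seteqP; split.
pose s0 : S := exist _ _ s0P.
have mS (s : S) : measurable (covered (sval s)).
  by case: s => s /= [mf _]; exact: measurable_covered.
have [|||||[f af] maxf] := @exhaustion R S (fun s t => extends (sval s) (sval t))
  (fun s => m (covered (sval s))) s0.
- by move=> s x.
- by move=> s t u st tu x y /st /tu.
- by move=> s t st; apply: le_pm => //; exact: extends_covered.
- by move=> s; exact: pm_le1.
- move=> u uS; have [g ag ug] := admissible_chain e0 (fun n => svalP (u n)) uS.
  by exists (exist _ g ag).
exists f => //; apply/eqP; rewrite eq_le pm_le1 ?leNgt//=; last exact: (mS (exist _ f af)).
apply/negP => lt1; have [f' [af' ff' lt]] := extension_step cG e0 amG af lt1.
by have := maxf (exist _ f' af') ff'; rewrite /= leNgt lt.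
Qed.

Lemma measurable_total_defect (c : X -> G) (h : G) :
  (forall t, measurable (c @^-1` [set t])) ->
  measurable [set x | c (al h^-1%g x) <> (h^-1 * c x)%g].
Proof.
move=> mc.
rewrite (_ : mkset _ = \bigcup_t (c @^-1` [set t] `&`
     al h^-1%g @^-1` (~` (c @^-1` [set (h^-1 * t)%g])))).
  apply: countable_bigcupT_measurable => // t; apply: measurableI => //.
  by apply: measurable_preimage_sact; exact: measurableC.
by apply/seteqP; split => [x /= cx|x [t _ [/= <-]]//]; exists (c x).
Qed.

(** Off a small set [D], the map [f] takes only finitely many values. Giving the value 1 to the
    points where [f] has no value in [T] costs at most twice the measure of [D] for each [k i]. *)
Lemma finite_section (M : nat) (k : 'I_M -> G) (e : R) : 0 < e ->
  exists (c : X -> G) (T : seq G),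
    [/\ uniq T, forall x, c x \in T, forall t, measurable (c @^-1` [set t]) &
     \sum_i m [set x | c (al (k i)^-1%g x) <> ((k i)^-1 * c x)%g] <= e].
Proof.
move=> e0.
have e20 : 0 < e / 2 by rewrite divr_gt0.
have [f [mf costf] cov1] := almost_everywhere_section k e20.
have [en enP] := countable_enum cG.
pose C i := if en i is Some t then f @^-1` [set Some t] else set0.
have mC i : measurable (C i) by rewrite /C; case: (en i).
pose A n := \big[setU/set0]_(i < n) C i.
have mA n : measurable (A n) by exact: bigsetU_measurable.
have AS n : A n `<=` A n.+1 by rewrite /A big_ord_recr; left.
(* Half of [e] is spent on [f]; the [M] corrections of size [2 * q] fit into the other half. *)
pose q := e / (4 * M.+1%:R).
have q0 : 0 < q by rewrite divr_gt0// mulr_gt0.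
have [n] := @pm_nondecreasing _ _ _ mu A q mA AS q0.
have -> : \bigcup_k A k = covered f.
  apply/seteqP; split => x.
    move=> [p _]; rewrite /A -bigcup_mkord => -[i _]; rewrite /C.
    by case: (en i) => // t; rewrite /covered/= => ->.
  rewrite /covered/=; case fx: (f x) => [t|]// _; have [i ei] := enP t Logic.I.
  by exists i.+1 => //; rewrite /A -bigcup_mkord; exists i => //=; rewrite /C ei.
rewrite cov1 => nq.
pose T := undup (1%g :: pmap en (iota 0 n)).
pose c x := if f x is Some t then if t \in T then t else 1%g else 1%g.
have cT x : c x \in T.
  have T1 : 1%g \in T by rewrite mem_undup mem_head.
  by rewrite /c; case: (f x) => // t; case: ifP.
have Ac x : A n x -> f x = Some (c x).
  rewrite /A -bigcup_mkord => -[i /= ilt]; rewrite /C; case ei: (en i) => [t|]// ft.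
  rewrite /c ft ifT//; rewrite mem_undup inE mem_pmap; apply/orP; right.
  by apply/mapP; exists i; rewrite ?mem_iota// ei.
pose D := ~` A n; have mD : measurable D by exact: measurableC.
have pmD : m D < q by rewrite pm_setC.
have mc t : measurable (c @^-1` [set t]).
  (* The fiber over 1 also takes in all points where [f] is undefined or has a value outside of
     [T]. *)
  rewrite (_ : _ @^-1` _ = (if t \in T then f @^-1` [set Some t] else set0) `|`
     (if t == 1%g then ~` \bigcup_(s in [set: G]) (if s \in T then f @^-1` [set Some s] else set0)
      else set0)).
    apply: measurableU; first by case: ifP.
    case: ifP => // _; apply: measurableC; apply: countable_bigcupT_measurable => // s.
    by case: ifP.
  apply/seteqP; split => x /=; rewrite /c.
    case fx: (f x) => [s|].
      case: ifPn => sT <-; first by left; rewrite sT.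
      right; rewrite eqxx => -[r _]; case: ifPn => // rT /=; rewrite fx => -[sr].
      by move: sT; rewrite sr rT.
    by move=> <-; right; rewrite eqxx => -[r _]; case: ifPn => // rT /=; rewrite fx.
  case; first by case: ifPn => // tT /= ->; rewrite tT.
  case: eqP => // -> nx; case fx: (f x) => [s|]//; case: ifPn => // sT.
  by case: nx; exists s => //=; rewrite sT.
exists c, T; split => //; first exact: undup_uniq.
have badE h : [set x | c (al h^-1%g x) <> (h^-1 * c x)%g] `<=`
    defect al f h `|` (D `|` al h^-1%g @^-1` D).
  move=> x /= cx.
  have [Dx|/contrapT/Ac fx] := pselect (D x); first by right; left.
  have [Dhx|/contrapT/Ac fhx] := pselect (D (al h^-1%g x)); first by right; right.
  by left; rewrite /defect/= fx fhx => -[].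
have mt h : measurable (al h @^-1` D) by exact: measurable_preimage_sact.
have mdf h : measurable (defect al f h) by exact: measurable_defect.
have mbad h : measurable [set x | c (al h^-1%g x) <> (h^-1 * c x)%g].
  exact: measurable_total_defect.
have badD h : m [set x | c (al h^-1%g x) <> (h^-1 * c x)%g] <= m (defect al f h) + 2 * q.
  apply: le_trans (le_pm mu _ _ (badE h)) _ => //.
    by apply: measurableU => //; exact: measurableU.
  apply: le_trans (pmU_le mu _ _) _ => //; first exact: measurableU.
  rewrite lerD2l (le_trans (pmU_le mu _ _))// pm_preimage_sact//; move: pmD; lra.
apply: (@le_trans _ _ (\sum_i (m (defect al f (k i)) + 2 * q))).
  by apply: ler_sum => i _; exact: badD.
rewrite big_split/= sumr_const card_ord -[X in _ + X]mulr_natl.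
move: costf; rewrite /cost cov1 mulr1.
have : M%:R * (2 * q) <= e / 2.
  have -> : M%:R * (2 * q) = e / 2 * (M%:R / M.+1%:R).
    by rewrite /q; field; rewrite nat1r pnatr_eq0.
  by rewrite (ler_piMr (ltW e20))// ler_pdivrMr// mul1r ler_nat.
lra.
Qed.

Hypothesis infG : infinite_set [set: G].

Lemma infinite_uniq_seq (n : nat) : exists s : seq G, uniq s /\ size s = n.
Proof.
elim: n => [|n [s [us ss]]]; first by exists [::].
have [x xs] : exists x, x \notin s.
  apply: contrapT => nx; apply: infG; apply: (@sub_finite_set _ _ [set` s]).
    by move=> x _ /=; apply: contrapT => /negP xs; apply: nx; exists x.
  exact: finite_seq.
by exists (x :: s); rewrite /= xs us ss.
Qed.

(* [c] selects the point [(c x)^-1 x] of the orbit of [x]; off [B] this choice is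
   invariant under [K]. *)
Lemma rokhlin (K : seq G) (e : R) : 0 < e ->
  exists (c : X -> G) (T : seq G) (B F : set X),
    [/\ [/\ uniq T, forall x, c x \in T & forall t, measurable (c @^-1` [set t])],
       [/\ measurable B, measurable F, m B <= e & m F <= e],
       forall g x, g \in K -> ~ B x -> c (al g^-1%g x) = (g^-1 * c x)%g &
       forall x, F (al (c x)^-1%g x)].
Proof.
move=> e0.
have [N eN] : exists N, (e / 2)^-1 < N%:R :> R.
  by exists (Num.truncn ((e / 2)^-1)).+1; exact: truncnS_gt.
(* Equivariance under the [N] elements of [L] gives points of [F0] at least [N] preimages under
   [x |-> (c x)^-1 x], which bounds the measure of [F0] by [1 / N]. *)
have [L [uL sL]] := infinite_uniq_seq N.
pose K' := K ++ L; pose k (i : 'I_(size K')) := nth 1%g K' i.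
have e20 : 0 < e / 2 by rewrite divr_gt0.
have [c [T [uT cT mc costc]]] := finite_section k e20.
pose bad h := [set x | c (al h^-1%g x) <> (h^-1 * c x)%g].
have mbad h : measurable (bad h) by exact: measurable_total_defect.
pose B := \big[setU/set0]_i bad (k i).
have mB : measurable B by exact: bigsetU_measurable.
have pmB : m B <= e / 2.
  by apply: le_trans (pm_bigU mu _ _) _.
have Bgood g x : g \in K' -> ~ B x -> c (al g^-1%g x) = (g^-1 * c x)%g.
  move=> gK nB; apply: contrapT => cx; apply: nB.
  rewrite /B -bigcup_seq; move/(nthP 1%g): gK cx => [i iK <-] cx.
  by exists (Ordinal iK) => //=; rewrite mem_index_enum.
(* A point [y] is in [Z t] if [t y] is one of its preimages, i.e. [c (t y) = t]. The points of [F1]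
   have a preimage in [B]; those of [F0] have preimages, but none in [B]. *)
pose Z t := al t @^-1` (c @^-1` [set t]).
have mZ t : measurable (Z t) by exact: measurable_preimage_sact.
pose F1 := \big[setU/set0]_(t <- T) (Z t `&` al t @^-1` B).
have mZB t : measurable (Z t `&` al t @^-1` B).
  by apply: measurableI => //; exact: measurable_preimage_sact.
have mF1 : measurable F1 by exact: bigsetU_measurable.
pose F0 := (\big[setU/set0]_(t <- T) Z t) `\` F1.
have mF0 : measurable F0.
  by apply: measurableD => //; exact: bigsetU_measurable.
have cdisj (S : set X) : measurable S -> \sum_(t <- T) m (c @^-1` [set t] `&` S) = m S.
  move=> mS; rewrite -pm_bigU_disjoint//.
  - congr pm; apply/seteqP; split => x; rewrite -bigcup_seq; first by case=> t _ [].
    by move=> Sx; exists (c x) => //=.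
  - by move=> t; exact: measurableI.
  - by move=> s t x _ _ [/= <- _] [/= <-].
have pmF1 : m F1 <= e / 2.
  apply: le_trans (pm_bigU mu _ _) _ => //; rewrite (le_trans _ pmB)//.
  rewrite -(cdisj _ mB); apply: ler_sum => t _.
  by rewrite -(pm_preimage_sact al t (measurableI _ _ (mc t) mB)).
have pmF0 : m F0 <= e / 2.
  (* Along with [t x], each [g^-1 t x] with [g] in [L] is a preimage of [x]. The measures of the
     sets [Z t] add up to 1, so Markov's inequality applies. *)
  have : N%:R * m F0 <= 1.
    apply: le_trans (_ : \sum_(t <- T) m (Z t `&` F0) <= 1).
      apply: pm_count => // x [+ nF1]; rewrite -bigcup_seq => -[t /= tT Zt].
      have nBx : ~ B (al t x).
        by move=> Bx; apply: nF1; rewrite /F1 -bigcup_seq; exists t.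
      rewrite -sL -(size_map (fun g => (g^-1 * t)%g)) -size_filter.
      apply: uniq_leq_size.
        by rewrite map_inj_uniq// => g h /mulIg /invg_inj.
      move=> _ /mapP[g gL ->].
      have cg : c (al (g^-1 * t)%g x) = (g^-1 * t)%g.
        rewrite sactM Bgood// ?mem_cat ?gL ?orbT//.
        by rewrite [c (al t x)]Zt.
      rewrite mem_filter; apply/andP; split; last by rewrite -cg.
      exact/asboolP.
    rewrite -(pmT mu) -(cdisj setT)//; apply: ler_sum => t _.
    rewrite setIT -(pm_preimage_sact al t (mc t)).
    by apply: le_pm; [exact: measurableI|exact: mZ|move=> x []].
  move=> NF0; rewrite -[leRHS]mulr1 -ler_pdivrMl//; apply: le_trans NF0.
  by rewrite ler_wpM2r ?pm_ge0// ltW.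
exists c, T, B, (F0 `|` F1); split => //.
- split => //; first exact: measurableU.
    by rewrite (le_trans pmB)// ler_pdivrMr// (ler_peMr (ltW e0))// ler1n.
  by rewrite (le_trans (pmU_le mu _ _))//; move: pmF0 pmF1; lra.
- by move=> g x gK; apply: Bgood; rewrite mem_cat gK.
- move=> x; have [F1x|nF1] := pselect (F1 (al (c x)^-1%g x)); first by right.
  left; split => //; rewrite -bigcup_seq; exists (c x) => //=.
  by rewrite /Z/= sactVK.
Qed.

End Sections.

(** * Crossed products *)

Section CrossedTheory.
Variables (G : groupType) (L : nzRingType) (a : ringAction G L).
Implicit Types r s : crossed a.

Lemma coeff0 g : coeff (0 : crossed a) g = 0.
Proof. by []. Qed.

Lemma coeffN r g : coeff (- r) g = - coeff r g.
Proof. by []. Qed.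

Lemma coeff_sum (I : Type) (t : seq I) (F : I -> crossed a) g :
  coeff (\sum_(i <- t) F i) g = \sum_(i <- t) coeff (F i) g.
Proof. exact: (big_morph (fun r => coeff r g)). Qed.

Lemma coeff_monom l h g : coeff (monom a l h) g = if g == h then l else 0.
Proof. by []. Qed.

Lemma monomD l l' g : monom a (l + l') g = monom a l g + monom a l' g.
Proof.
by apply: crossedP => h; rewrite coeffD !coeff_monom; case: ifP => // _; rewrite addr0.
Qed.

Lemma monom0 g : monom a 0 g = 0.
Proof. by apply: crossedP => h; rewrite coeff_monom coeff0; case: ifP. Qed.

Lemma monom_sum (I : Type) (t : seq I) (F : I -> L) g :
  monom a (\sum_(i <- t) F i) g = \sum_(i <- t) monom a (F i) g.
Proof.
exact: (big_morph (fun l => monom a l g) (fun l l' => monomD l l' g) (monom0 g)).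
Qed.

Lemma monom1 : monom a 1 1%g = 1.
Proof. by []. Qed.

Lemma crossed_sumE r (S : seq G) : uniq S -> (forall g, coeff r g != 0 -> g \in S) ->
  r = \sum_(g <- S) monom a (coeff r g) g.
Proof.
move=> uS rS; apply: crossedP => h; rewrite coeff_sum.
under eq_bigr do rewrite coeff_monom.
have [hS|hS] := boolP (h \in S).
  rewrite (bigD1_seq h)//= eqxx big1 ?addr0// => g gh.
  by rewrite eq_sym (negbTE gh).
rewrite big_seq big1 => [|g gS]; last by case: eqP gS hS => // -> ->.
by apply/eqP; apply: contraNT hS => /rS.
Qed.

Lemma crossed_ind (P : crossed a -> Prop) :
  P 0 -> (forall r s, P r -> P s -> P (r + s)) -> (forall l g, P (monom a l g)) ->
  forall r, P r.
Proof.
move=> P0 PD Pm r; have [S uS rS] := finsupp_seq (coeff_finsupp r).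
by rewrite (crossed_sumE uS rS); apply: big_ind.
Qed.

End CrossedTheory.

Section CrossedMapMorphism.
Variables (G : groupType) (L L' : nzRingType).
Variables (a : ringAction G L) (a' : ringAction G L') (f : {rmorphism L -> L'}).
Hypothesis equiv : forall g x, f (a g x) = a' g (f x).

Local Notation F := (crossed_map a' f (a := a)).

Lemma crossed_mapD r s : F (r + s) = F r + F s.
Proof. by apply: crossedP => g; rewrite /coeff/= rmorphD. Qed.

Lemma crossed_map0 : F 0 = 0.
Proof. by apply: crossedP => g; rewrite /coeff/= rmorph0. Qed.

Lemma crossed_map_monom l g : F (monom a l g) = monom a' (f l) g.
Proof.
apply: crossedP => h; rewrite [LHS]/(f (coeff (monom a l g) h)) !coeff_monom.
by case: (h == g) => //; exact: (rmorph0 f).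
Qed.

Lemma crossed_mapM r s : F (r * s) = F r * F s.
Proof.
elim/crossed_ind: r => [|r r' IH IH'|l g].
- by rewrite mul0r crossed_map0 mul0r.
- by rewrite mulrDl !crossed_mapD IH IH' mulrDl.
elim/crossed_ind: s => [|s s' IH IH'|l' g'].
- by rewrite mulr0 crossed_map0 mulr0.
- by rewrite mulrDr !crossed_mapD IH IH' mulrDr.
by rewrite monomM !crossed_map_monom monomM rmorphM equiv.
Qed.

Lemma crossed_map1 : F 1 = 1.
Proof. by rewrite -monom1 crossed_map_monom rmorph1 monom1. Qed.

End CrossedMapMorphism.

(** * Maps linear over the coefficient ring only *)

Section CoefficientLinear.
Variables (G : groupType) (Z : comNzRingType).
Local Notation ZG := (groupRing G Z).
Local Notation mon c g := (monom (trivial_action G Z) c g).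

(** The scalar [c] is viewed in the group ring as [mon c 1]. Contractions of resolutions are linear
    in this sense, but rarely over the group ring. *)
Definition coef_linear (U V : lmodType ZG) (f : U -> V) : Prop :=
  forall c x y, f (mon c 1%g *: x + y) = mon c 1%g *: f x + f y.

Lemma coef_linearD (U V : lmodType ZG) (f : U -> V) : coef_linear f ->
  {morph f : x y / x + y}.
Proof. by move=> lf x y; have := lf 1 x y; rewrite monom1 !scale1r. Qed.

Lemma coef_linear0 (U V : lmodType ZG) (f : U -> V) : coef_linear f -> f 0 = 0.
Proof.
move=> lf; have := coef_linearD lf 0 0; rewrite addr0 => /eqP.
by rewrite -subr_eq subrr eq_sym => /eqP.
Qed.

Lemma coef_linearZ (U V : lmodType ZG) (f : U -> V) : coef_linear f ->
  forall c x, f (mon c 1%g *: x) = mon c 1%g *: f x.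
Proof. by move=> lf c x; have := lf c x 0; rewrite !addr0 (coef_linear0 lf) addr0. Qed.

Lemma coef_linear_linear (U V : lmodType ZG) (f : {linear U -> V}) : coef_linear f.
Proof. by move=> c x y; rewrite linearP. Qed.

Lemma coef_linear_comp (U V W : lmodType ZG) (f : V -> W) (g : U -> V) :
  coef_linear f -> coef_linear g -> coef_linear (f \o g).
Proof. by move=> lf lg c x y /=; rewrite lg lf. Qed.

Lemma coef_linear_add (U V : lmodType ZG) (f g : U -> V) :
  coef_linear f -> coef_linear g -> coef_linear (fun x => f x + g x).
Proof. by move=> lf lg c x y; rewrite lf lg scalerDr addrACA. Qed.

Lemma coef_linear_opp (U V : lmodType ZG) (f : U -> V) :
  coef_linear f -> coef_linear (fun x => - f x).
Proof. by move=> lf c x y; rewrite lf scalerN opprD. Qed.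

Section Extension.
Variables (V : lmodType ZG) (n : nat) (h : 'I_n -> G -> V).

Definition coef_extend (v : 'rV[ZG]_n) : V :=
  \sum_j \sum_(g \in [set: G]) mon (coeff (v 0 j) g) 1%g *: h j g.

Lemma coef_extend_linear : coef_linear coef_extend.
Proof.
move=> c v w; rewrite /coef_extend scaler_sumr -big_split; apply: eq_bigr => j _ /=.
rewrite !mxE.
have [S _ vS] := finsupp_seq (coeff_finsupp (v 0 j)).
have [T _ wT] := finsupp_seq (coeff_finsupp (w 0 j)).
have uU : uniq (undup (S ++ T)) by exact: undup_uniq.
have vU g : coeff (v 0 j) g != 0 -> g \in undup (S ++ T).
  by rewrite mem_undup mem_cat => /vS ->.
have wU g : coeff (w 0 j) g != 0 -> g \in undup (S ++ T).
  by rewrite mem_undup mem_cat => /wT ->; rewrite orbT.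
have coefE g : coeff (mon c 1%g * v 0 j) g = c * coeff (v 0 j) g.
  rewrite (@coeffM _ _ _ _ _ [:: 1%g])//.
    by rewrite big_seq1 coeff_monom eqxx invg1 mul1g.
  by move=> k; rewrite coeff_monom inE; case: ifP => //; rewrite eqxx.
have supp (x : ZG) : (forall g, coeff x g != 0 -> g \in undup (S ++ T)) ->
    forall g, mon (coeff x g) 1%g *: h j g != 0 -> g \in undup (S ++ T).
  move=> xU g; apply: contraR => gU.
  have /eqP-> : coeff x g == 0 by apply: contraR gU => /xU.
  by rewrite monom0 scale0r.
rewrite (fsumE uU (supp _ vU)) (fsumE uU (supp _ wU)) (fsumE uU); last first.
  apply: supp => g; apply: contraR => gU; rewrite coeffD coefE.
  have /eqP-> : coeff (v 0 j) g == 0 by apply: contraR gU => /vU.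
  have /eqP-> : coeff (w 0 j) g == 0 by apply: contraR gU => /wU.
  by rewrite mulr0 addr0.
rewrite scaler_sumr -big_split; apply: eq_bigr => g _ /=.
rewrite coeffD coefE monomD scalerDl; congr (_ + _).
by rewrite scalerA monomM/= mulg1.
Qed.

Lemma coef_extendE j g : coef_extend (mon 1 g *: delta_mx 0 j) = h j g.
Proof.
rewrite /coef_extend (bigD1 j)//= [X in _ + X]big1 ?addr0 => [|i ij].
  rewrite (@fsumE _ _ _ [:: g])//.
    by rewrite big_seq1 !mxE !eqxx mulr1 coeff_monom eqxx monom1 scale1r.
  move=> k; rewrite !mxE !eqxx mulr1 coeff_monom inE.
  by case: ifP => //; rewrite monom0 scale0r eqxx.
rewrite fsbig1// => k _.
by rewrite !mxE (negbTE ij) andbF mulr0 coeff0 monom0 scale0r.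
Qed.

End Extension.

Lemma coef_linear_ext (V : lmodType ZG) (n : nat) (f g : 'rV[ZG]_n -> V) :
  coef_linear f -> coef_linear g ->
  (forall j h, f (mon 1 h *: delta_mx 0 j) = g (mon 1 h *: delta_mx 0 j)) -> f =1 g.
Proof.
move=> lf lg fg v; have fgj j (x : ZG) : f (x *: delta_mx 0 j) = g (x *: delta_mx 0 j).
  elim/crossed_ind: x => [|x y IH IH'|c h].
  - by rewrite scale0r !coef_linear0.
  - by rewrite scalerDl !coef_linearD ?IH ?IH'.
  have -> : mon c h = mon c 1%g * mon 1 h by rewrite monomM/= mulr1 mul1g.
  by rewrite -scalerA (coef_linearZ lf) (coef_linearZ lg) fg.
rewrite [v]row_sum_delta.
rewrite (big_morph f (coef_linearD lf) (coef_linear0 lf)).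
rewrite (big_morph g (coef_linearD lg) (coef_linear0 lg)).
by apply: eq_bigr => j _; exact: fgj.
Qed.

End CoefficientLinear.

(** * Linear maps on free modules *)

Section LinearCombination.
Variables (S : nzRingType) (V : lmodType S) (n : nat) (w : 'I_n -> V).

Definition lcomb (v : 'rV[S]_n) : V := \sum_j v 0 j *: w j.

Lemma lcomb_is_linear : linear lcomb.
Proof.
move=> c u v; rewrite /lcomb scaler_sumr -big_split; apply: eq_bigr => j _ /=.
by rewrite !mxE scalerDl scalerA.
Qed.

HB.instance Definition _ := GRing.isLinear.Build S 'rV[S]_n V *:%R lcomb lcomb_is_linear.

End LinearCombination.

Lemma linear_row (S : nzRingType) (V : lmodType S) (n : nat)
    (f : {linear 'rV[S]_n -> V}) v : f v = \sum_j v 0 j *: f (delta_mx 0 j).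
Proof.
by rewrite {1}[v]row_sum_delta linear_sum; apply: eq_bigr => j _; rewrite linearZ.
Qed.

Section FreeModules.
Variable S : nzRingType.

Lemma basis_sumE (M : lmodType S) (B : set M) (V : lmodType S) (h : M -> V) (c : M -> S)
    (s : seq M) : uniq s -> (forall b, c b != 0 -> b \in s) -> [set b | c b != 0] `<=` B ->
  \sum_(b \in B) c b *: h b = \sum_(b <- s) c b *: h b.
Proof.
move=> us cs cB; have supp b : c b *: h b != 0 -> c b != 0.
  by apply: contra_neq => ->; rewrite scale0r.
have inB b : c b *: h b != 0 -> b \in B by move=> /supp /cB; rewrite inE.
rewrite (fsbigE [seq b <- s | b \in B]).
- rewrite big_filter_cond [LHS]big_mkcond; apply: eq_bigr => b _.
  by case: ifPn => //; apply: contraNeq; rewrite eq_sym andbb => /inB.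
- by rewrite filter_uniq.
- by move=> b /=; rewrite mem_filter => /andP[/set_mem].
- move=> b bB; apply: contraNeq => bn0; rewrite mem_filter inB//= cs//.
  exact: supp.
Qed.

(** Lift the values on a basis; uniqueness of the coordinates makes the extension linear. *)
Lemma free_lift (M A N : lmodType S) (p : {linear A -> N}) (f : {linear M -> N}) :
  free_module M -> (forall x, exists y, p y = f x) ->
  exists g : {linear M -> A}, forall x, p (g x) = f x.
Proof.
move=> [B basB] /choice[h hP].
have /choice[c cP] : forall x, exists c : M -> S,
   [/\ finsupp c, [set b | c b != 0] `<=` B & x = \sum_(b \in B) c b *: b].
  by move=> x; have [c [cP _]] := basB x; exists c.
have cuniq x c' : finsupp c' -> [set b | c' b != 0] `<=` B ->
    x = \sum_(b \in B) c' b *: b -> c x = c'.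
  move=> h1 h2 h3; have [c0 [_ c0u]] := basB x.
  by rewrite -(c0u _ (cP x)); apply: c0u.
pose g x := \sum_(b \in B) c x b *: h b.
have g_lin : linear g.
  move=> k x y.
  have [cx Bx Ex] := cP x; have [cy By Ey] := cP y.
  have [s _ xs] := finsupp_seq cx; have [t _ yt] := finsupp_seq cy.
  have uU : uniq (undup (s ++ t)) by exact: undup_uniq.
  have xU b : c x b != 0 -> b \in undup (s ++ t).
    by rewrite mem_undup mem_cat => /xs ->.
  have yU b : c y b != 0 -> b \in undup (s ++ t).
    by rewrite mem_undup mem_cat => /yt ->; rewrite orbT.
  pose c' b := k * c x b + c y b.
  have c'U b : c' b != 0 -> b \in undup (s ++ t).
    apply: contraR => bU; rewrite /c'.
    have /eqP-> : c x b == 0 by apply: contraR bU => /xU.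
    have /eqP-> : c y b == 0 by apply: contraR bU => /yU.
    by rewrite mulr0 addr0.
  have c'B : [set b | c' b != 0] `<=` B.
    move=> b /=; rewrite /c'; have [->|xb _] := eqVneq (c x b) 0; last exact: Bx.
    by rewrite mulr0 add0r => /By.
  have E (V : lmodType S) (h' : M -> V) : \sum_(b \in B) c' b *: h' b =
      k *: (\sum_(b \in B) c x b *: h' b) + \sum_(b \in B) c y b *: h' b.
    rewrite (basis_sumE _ uU c'U c'B) (basis_sumE _ uU xU Bx) (basis_sumE _ uU yU By).
    rewrite scaler_sumr -big_split; apply: eq_bigr => b _.
    by rewrite /c' scalerDl scalerA.
  rewrite /g (cuniq _ c') ?E//; first exact: seq_finsupp c'U.
  by rewrite -Ex -Ey.
pose g' : {linear M -> A} := HB.pack g (GRing.isLinear.Build S M A *:%R g g_lin).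
exists g' => x; rewrite -[g' x]/(g x) /g.
have [cx Bx Ex] := cP x; have [s us xs] := finsupp_seq cx.
rewrite (basis_sumE _ us xs Bx) linear_sum [in RHS]Ex (basis_sumE id us xs Bx) linear_sum.
by apply: eq_bigr => b _; rewrite !linearZ hP.
Qed.

End FreeModules.

(** * Resolutions by projective modules *)

Section Contraction.
Variable G : groupType.
Local Notation ZG := (groupRing G int).
Local Notation mon c g := (monom (trivial_action G int) c g).
Variable P : augmentedComplex (trivialMod G int).

Lemma cact_monom (Z : comNzRingType) (c : Z) g (x : trivialMod G Z) :
  (monom (trivial_action G Z) c g *: x : trivialMod G Z) = c * (x : Z) :> Z.
Proof.
rewrite -[LHS]/(cact _ _) (@cactE _ _ _ _ [:: g])//.
  by rewrite big_seq1 coeff_monom eqxx.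
by move=> h; rewrite coeff_monom inE; case: ifP => //; rewrite eqxx.
Qed.

(** [A] is a summand of a free module over the group ring, which is free over the integers on the
    elements [g e_j]. Lift the values there and restrict along [i]. *)
Lemma coef_linear_lift (A B B' : lmodType ZG) (n : nat) (q : {linear 'rV[ZG]_n -> A})
    (i : {linear A -> 'rV[ZG]_n}) (p : {linear B -> B'}) (f : A -> B') :
  cancel i q -> coef_linear f -> (forall x, exists y, p y = f x) ->
  exists2 s : A -> B, coef_linear s & forall x, p (s x) = f x.
Proof.
move=> qi lf /choice[Y Yp].
pose h j g := Y (q (mon 1 g *: delta_mx 0 j)).
exists (coef_extend h \o i).
  by apply: coef_linear_comp; [exact: coef_extend_linear|exact: coef_linear_linear].
move=> x; rewrite -{2}[x]qi /=.
have := @coef_linear_ext _ _ _ n (p \o coef_extend h) (f \o q).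
apply.
- by apply: coef_linear_comp; [exact: coef_linear_linear|exact: coef_extend_linear].
- by apply: coef_linear_comp => //; exact: coef_linear_linear.
- by move=> j g; rewrite /= coef_extendE Yp.
Qed.

Hypothesis resP : resolution P.
Variables (m : nat) (r : nat -> nat).
Variables (q : forall k, {linear 'rV[ZG]_(r k) -> P k}).
Variables (i : forall k, {linear P k -> 'rV[ZG]_(r k)}).
Hypothesis qi : forall k, (k <= m)%N -> cancel (@i k) (@q k).

(** The usual contracting homotopy: [x - aug x u] in degree 0 and [x - s (d x)] above are cycles,
    hence boundaries, and can be lifted additively by [coef_linear_lift]. *)
Lemma projective_contraction (u : P 0) : aug P u = 1 ->
  exists s : forall k, P k -> P k.+1,
    [/\ forall k, (k <= m)%N -> coef_linear (s k),
        forall x, bd P 0 (s 0%N x) = x - mon (aug P x : int) 1%g *: u &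
        forall k x, (k < m)%N -> bd P k.+1 (s k.+1 x) = x - s k (bd P k x)].
Proof.
move=> u1; have [ex0 exS] := resP.
(* The second clause makes [x - s (bd P k x)] a cycle, so that the next map exists. *)
pose I k (s : P k -> P k.+1) := (k <= m)%N ->
  coef_linear s /\ forall x, bd P k (s (bd P k x)) = bd P k x.
have [s0 [Is0 s0E]] : exists s, I 0%N s /\
    forall x, bd P 0 (s x) = x - mon (aug P x : int) 1%g *: u.
  pose f (x : P 0) := x - mon (aug P x : int) 1%g *: u.
  have lf : coef_linear f.
    move=> c x y; rewrite /f linearP cact_monom /= monomD scalerDl.
    rewrite scalerBr scalerA monomM/= mulg1 opprD addrACA; congr (_ + _).
  have [|s ls sE] := coef_linear_lift (p := bd P 0) (f := f) (qi (leq0n m)) lf.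
    move=> x; apply: ex0; rewrite linearB linearZ /= u1.
    apply/eqP; rewrite subr_eq0; apply/eqP.
    by rewrite -[LHS](@mulr1 int); symmetry; apply: cact_monom.
  exists s; split => // _; split => // x.
  by rewrite sE /f aug_bd monom0 scale0r subr0.
have step k (s : P k -> P k.+1) : I k s -> exists s', I k.+1 s' /\
    ((k < m)%N -> forall x, bd P k.+1 (s' x) = x - s (bd P k x)).
  have [km Is|mk _] := boolP (k < m)%N; last first.
    by exists (fun=> 0); split => //; rewrite /I (negbTE mk).
  have [ls sbd] := Is (ltnW km).
  have [||s' ls' s'E] := coef_linear_lift (p := bd P k.+1) (f := fun x => x - s (bd P k x)) (qi km).
  - apply: coef_linear_add; first by move=> c x y.
    apply: coef_linear_opp; apply: (coef_linear_comp ls).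
    exact: coef_linear_linear.
  - by move=> x; apply: exS; rewrite linearB sbd subrr.
  exists s'; split => // _; split => // x.
  by rewrite s'E bd_bd (coef_linear0 ls) subr0.
pose S := nat_rect (fun k => {s : P k -> P k.+1 | I k s}) (exist _ s0 Is0)
  (fun k s => exist _ (sval (cid (step k (sval s) (svalP s))))
                      (svalP (cid (step k (sval s) (svalP s)))).1).
exists (fun k => sval (S k)); split => //.
- by move=> k km; have [] := svalP (S k) km.
- by move=> k x km; apply: (svalP (cid (step k (sval (S k)) (svalP (S k))))).2.
Qed.

End Contraction.

(* A complex of finitely generated free modules with an idempotent chain map [rc_e],
   whose image is exact below degree [m]: a projective resolution, seen through a
   presentation of its terms as direct summands of free modules. *)
Record retract_complex (G : groupType) (Z : comNzRingType) (m : nat) := RetractComplex {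
  rc_rank : nat -> nat;
  rc_d : forall k, {linear 'rV[groupRing G Z]_(rc_rank k.+1) -> 'rV[groupRing G Z]_(rc_rank k)};
  rc_aug : {linear 'rV[groupRing G Z]_(rc_rank 0) -> trivialMod G Z};
  rc_e : forall k, {linear 'rV[groupRing G Z]_(rc_rank k) -> 'rV[groupRing G Z]_(rc_rank k)};
  rc_dd : forall k v, rc_d k (rc_d k.+1 v) = 0;
  rc_augd : forall v, rc_aug (rc_d 0 v) = 0;
  rc_ee : forall k v, rc_e k (rc_e k v) = rc_e k v;
  rc_de : forall k v, rc_d k (rc_e k.+1 v) = rc_d k v;
  rc_auge : forall v, rc_aug (rc_e 0 v) = rc_aug v;
  rc_lift0 : (0 < m)%N -> forall v, rc_e 0 v = v -> rc_aug v = 0 ->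
    exists w, rc_d 0 w = v;
  rc_liftS : forall k, (k.+1 < m)%N -> forall v, rc_e k.+1 v = v -> rc_d k v = 0 ->
    exists w, rc_d k.+1 w = v;
  rc_unit : exists u, rc_aug u = 1
}.

Section ChainMap.
Variables (G : groupType) (Z : comNzRingType) (m : nat) (E : retract_complex G Z m).
Variable C : augmentedComplex (trivialMod G Z).

(** The comparison theorem. Cycles of [E] are known to bound only in the image of [rc_e], so each
    lift is composed with [rc_e], which changes neither its boundary nor its augmentation. *)
Lemma chain_map_to_retract : (forall k, free_module (C k)) ->
  exists psi : forall k, {linear C k -> 'rV[groupRing G Z]_(rc_rank E k)},
    (forall k x, (k < m)%N -> rc_d E k (psi k.+1 x) = psi k (bd C k x)) /\
    (forall x, rc_aug E (psi 0 x) = aug C x).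
Proof.
move=> freeC.
pose I k (psi : {linear C k -> 'rV[groupRing G Z]_(rc_rank E k)}) :=
  (forall x, rc_e E k (psi x) = psi x) /\
  ((k < m)%N -> forall x, exists w, rc_d E k w = psi (bd C k x)).
have [psi0 [I0 aug0]] : exists psi, I 0%N psi /\ forall x, rc_aug E (psi x) = aug C x.
  have [|g gE] := free_lift (p := rc_aug E) (f := aug C) (freeC 0%N).
    move=> x; have [u u1] := rc_unit E.
    exists (monom (trivial_action G Z) (aug C x : Z) 1%g *: u); rewrite linearZ /= u1.
    by rewrite -[RHS](@mulr1 Z); apply: cact_monom.
  exists (rc_e E 0 \o g : {linear _ -> _}); split; last by move=> x; rewrite /= rc_auge.
  split=> [x|m0 x]; first by rewrite /= rc_ee.
  by apply: rc_lift0 => //=; rewrite ?rc_ee// rc_auge gE aug_bd.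
have step k psi : I k psi -> exists psi', I k.+1 psi' /\
    ((k < m)%N -> forall x, rc_d E k (psi' x) = psi (bd C k x)).
  have [km|mk] := boolP (k < m)%N; last first.
    move=> _; exists (\0 : {linear _ -> _}); split => //.
    by split => [x|/ltnW]; [rewrite /= linear0|rewrite (negbTE mk)].
  move=> [psie psilift].
  have [|g gE] := free_lift (p := rc_d E k) (f := psi \o bd C k : {linear _ -> _}) (freeC k.+1).
    exact: psilift.
  exists (rc_e E k.+1 \o g : {linear _ -> _}); split; last by move=> _ x; rewrite /= rc_de gE.
  split=> [x|k1m x]; first by rewrite /= rc_ee.
  by apply: rc_liftS => //=; rewrite ?rc_ee// rc_de gE/= bd_bd linear0.
pose S := nat_rect (fun k => {psi | I k psi}) (exist _ psi0 I0)
  (fun k s => exist _ (sval (cid (step k (sval s) (svalP s))))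
                      (svalP (cid (step k (sval s) (svalP s)))).1).
exists (fun k => sval (S k)); split => // k x km.
exact: (svalP (cid (step k (sval (S k)) (svalP (S k))))).2.
Qed.

End ChainMap.

(** * Extension of the coefficients from the integers *)

Section BaseChange.
Variables (G : groupType) (Z : comNzRingType).
Local Notation zG := (groupRing G int).
Local Notation ZG := (groupRing G Z).
Local Notation monz c g := (monom (trivial_action G int) c g).
Local Notation mon c g := (monom (trivial_action G Z) c g).

Definition intr_group (x : zG) : ZG :=
  crossed_map (trivial_action G Z) (intmul 1 : {rmorphism int -> Z}) x.

Lemma intr_groupD x y : intr_group (x + y) = intr_group x + intr_group y.
Proof. exact: crossed_mapD. Qed.

Lemma intr_groupM x y : intr_group (x * y) = intr_group x * intr_group y.
Proof. exact: crossed_mapM. Qed.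

Lemma intr_group0 : intr_group 0 = 0.
Proof. exact: crossed_map0. Qed.

Lemma intr_group_monom c g : intr_group (monz c g) = mon c%:~R g.
Proof. exact: crossed_map_monom. Qed.

Definition intr_row n (v : 'rV[zG]_n) : 'rV[ZG]_n := map_mx intr_group v.

Lemma intr_rowD n (v w : 'rV[zG]_n) : intr_row (v + w) = intr_row v + intr_row w.
Proof. by apply/rowP => j; rewrite !mxE intr_groupD. Qed.

Lemma intr_row0 n : intr_row (0 : 'rV[zG]_n) = 0.
Proof. by apply/rowP => j; rewrite !mxE intr_group0. Qed.

Lemma intr_rowZ n x (v : 'rV[zG]_n) : intr_row (x *: v) = intr_group x *: intr_row v.
Proof. by apply/rowP => j; rewrite !mxE intr_groupM. Qed.

Lemma intr_rowN n (v : 'rV[zG]_n) : intr_row (- v) = - intr_row v.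
Proof.
by apply/eqP; rewrite -addr_eq0 -intr_rowD addNr intr_row0.
Qed.

Lemma intr_row_sum n (I : Type) (s : seq I) (F : I -> 'rV[zG]_n) :
  intr_row (\sum_(i <- s) F i) = \sum_(i <- s) intr_row (F i).
Proof. exact: (big_morph _ (@intr_rowD n) (@intr_row0 n)). Qed.

Lemma intr_row_delta n (j : 'I_n) g :
  intr_row (monz 1 g *: delta_mx 0 j) = mon 1 g *: delta_mx 0 j.
Proof.
rewrite intr_rowZ intr_group_monom; congr (_ *: _); apply/rowP => i.
rewrite !mxE; case: eqP => _; case: eqP => _ //=; rewrite ?intr_group0//.
exact: intr_group_monom.
Qed.

Lemma row_ind n (Q : 'rV[zG]_n -> Prop) : Q 0 -> (forall v w, Q v -> Q w -> Q (v + w)) ->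
  (forall c g j, Q (monz c 1%g *: (monz 1 g *: delta_mx 0 j))) -> forall v, Q v.
Proof.
move=> Q0 QD Qm v; rewrite [v]row_sum_delta; apply: (big_ind Q) => // j _.
elim/crossed_ind: (v 0 j) => [|x y IH IH'|c g].
- by rewrite scale0r.
- by rewrite scalerDl; exact: QD.
- by have := Qm c g j; rewrite scalerA monomM/= mulr1 mul1g.
Qed.

Section LinearMaps.
Variables (n p : nat) (f : {linear 'rV[zG]_n -> 'rV[zG]_p}).

Definition base_change : 'rV[ZG]_n -> 'rV[ZG]_p :=
  lcomb (fun j => intr_row (f (delta_mx 0 j))).

HB.instance Definition _ := GRing.Linear.on base_change.

Lemma base_changeE v : base_change (intr_row v) = intr_row (f v).
Proof.
rewrite (linear_row f) intr_row_sum /base_change /lcomb; apply: eq_bigr => j _.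
by rewrite intr_rowZ !mxE.
Qed.

End LinearMaps.

Section CoefLinearMaps.
Variables (n p : nat) (f : 'rV[zG]_n -> 'rV[zG]_p).

(** For maps such as a contraction, linear over the integers only, the matrix is taken with respect
    to the basis of all [g e_j]. *)
Definition coef_base_change : 'rV[ZG]_n -> 'rV[ZG]_p :=
  coef_extend (fun j g => intr_row (f (monz 1 g *: delta_mx 0 j))).

Lemma coef_base_changeE v : coef_linear f -> coef_base_change (intr_row v) = intr_row (f v).
Proof.
move=> lf; have lF : coef_linear coef_base_change by exact: coef_extend_linear.
elim/row_ind: v => [|v w IH IH'|c g j].
- by rewrite intr_row0 (coef_linear0 lF) (coef_linear0 lf) intr_row0.
- by rewrite intr_rowD (coef_linearD lF) IH IH' (coef_linearD lf) intr_rowD.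
rewrite intr_rowZ intr_group_monom (coef_linearZ lF) (coef_linearZ lf).
by rewrite intr_row_delta /coef_base_change coef_extendE [RHS]intr_rowZ intr_group_monom.
Qed.

End CoefLinearMaps.

(** Integral rows include the [g e_j], a basis over [Z]; this transfers identities from the integers
    to [Z]. *)
Lemma coef_linear_intr_ext (V : lmodType ZG) n (f g : 'rV[ZG]_n -> V) :
  coef_linear f -> coef_linear g -> (forall v, f (intr_row v) = g (intr_row v)) -> f =1 g.
Proof.
move=> lf lg fg; apply: coef_linear_ext => // j h.
by have := fg (monz 1 h *: delta_mx 0 j); rewrite intr_row_delta.
Qed.

End BaseChange.

Lemma linear_intr_ext (G : groupType) (Z : comNzRingType) (V : lmodType (groupRing G Z)) n
    (f g : {linear 'rV[groupRing G Z]_n -> V}) :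
  (forall v, f (intr_row Z v) = g (intr_row Z v)) -> f =1 g.
Proof. by apply: coef_linear_intr_ext; exact: coef_linear_linear. Qed.

Lemma intr_cact (G : groupType) (Z : comNzRingType) (x : groupRing G int)
    (y : trivialMod G int) :
  ((x *: y : trivialMod G int) : int)%:~R =
  (intr_group Z x *: ((y : int)%:~R : trivialMod G Z) : trivialMod G Z) :> Z.
Proof.
elim/crossed_ind: x => [|x x' IH IH'|c g].
- by rewrite intr_group0 !scale0r.
- by rewrite intr_groupD !scalerDl intrD IH IH'.
by rewrite intr_group_monom !cact_monom intrM.
Qed.

(** Exactness itself may be lost under a change of coefficients, but the identity [D T + T D = e],
    with the augmentation in place of [T D] in degree 0, is preserved. It yields exactness on the
    image of [e]. *)
Lemma typeFP_retract (G : groupType) (m : nat) (Z : comNzRingType) :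
  typeFP G m -> exists E : retract_complex G Z m, True.
Proof.
move=> [P [[resP projP] fgP]].
pose zG := groupRing G int.
(* Above degree [m] the presenting module has rank 0, which makes the identities there trivial. *)
have presP k : exists t : {n & ({linear 'rV[zG]_n -> P k} * {linear P k -> 'rV[zG]_n})%type},
    ((k <= m)%N -> cancel (projT2 t).2 (projT2 t).1) /\ ((m < k)%N -> projT1 t = 0%N).
  have [km|mk] := leqP k m; last first.
    by exists (existT _ 0%N (\0 : {linear _ -> _}, \0 : {linear _ -> _})).
  have [n [b bP]] := fgP k km.
  have [|i iP] := projP k 'rV[zG]_n (P k) (lcomb b : {linear _ -> _}) (idfun : {linear _ -> _}).
    move=> x; have [c ->] := bP x; exists (\row_j c j).
    by rewrite /lcomb; apply: eq_bigr => j _; rewrite mxE.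
  by exists (existT _ n (lcomb b : {linear _ -> _}, i)).
pose t k := sval (cid (presP k)).
pose r k := projT1 (t k).
pose q k : {linear 'rV[zG]_(r k) -> P k} := (projT2 (t k)).1.
pose i k : {linear P k -> 'rV[zG]_(r k)} := (projT2 (t k)).2.
have qi k : (k <= m)%N -> cancel (i k) (q k) := (svalP (cid (presP k))).1.
have r0 k : (m < k)%N -> r k = 0%N := (svalP (cid (presP k))).2.
have row0 k (v : 'rV[zG]_(r k)) : (m < k)%N -> v = 0.
  by move=> mk; apply/rowP => j; have := ltn_ord j; rewrite {2}r0.
have [u u1] := aug_surj P 1.
have [s [s_lin s0 sS]] := projective_contraction resP qi u1.
(* Differential, augmentation and contraction are transported along [i] and [q]; the identity of
   [P k] becomes the idempotent [e k]. *)
pose e k : {linear 'rV[zG]_(r k) -> 'rV[zG]_(r k)} := i k \o q k.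
pose D k : {linear 'rV[zG]_(r k.+1) -> 'rV[zG]_(r k)} := i k \o bd P k \o q k.+1.
pose eps : {linear 'rV[zG]_(r 0%N) -> trivialMod G int} := aug P \o q 0%N.
pose T k : 'rV[zG]_(r k) -> 'rV[zG]_(r k.+1) := i k.+1 \o (s k \o q k).
have DD k v : D k (D k.+1 v) = 0.
  have [km|mk] := leqP k.+1 m; last by rewrite [D k.+1 v]row0// linear0.
  by rewrite /D/= qi// bd_bd linear0.
have ee k v : e k (e k v) = e k v.
  have [km|mk] := leqP k m; last by rewrite [LHS]row0// [RHS]row0.
  by rewrite /e/= qi.
have De k v : D k (e k.+1 v) = D k v.
  have [km|mk] := leqP k.+1 m; last by rewrite [v]row0// !linear0.
  by rewrite /D /e/= qi.
have epsD v : eps (D 0%N v) = 0.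
  have [km|mk] := leqP 1 m; last by rewrite [v]row0// !linear0.
  by rewrite /D /eps/= qi// aug_bd.
have epse v : eps (e 0%N v) = eps v by rewrite /eps /e/= qi.
have T_lin k : (k <= m)%N -> coef_linear (T k).
  move=> km; apply: coef_linear_comp; first exact: coef_linear_linear.
  by apply: coef_linear_comp; [exact: s_lin|exact: coef_linear_linear].
have DT0 v : (0 < m)%N -> D 0%N (T 0%N v) =
    e 0%N v - monom (trivial_action G int) (eps v : int) 1%g *: i 0%N u.
  by move=> m0; rewrite /D /T/= qi// s0 linearB linearZ.
have DTS k v : (k.+1 < m)%N -> D k.+1 (T k.+1 v) = e k.+1 v - T k (D k v).
  move=> km; rewrite /D /T/= qi// sS; last exact: ltnW.
  by rewrite linearB/= qi// ltnW// ltnW.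
pose epsZ : {linear 'rV[groupRing G Z]_(r 0%N) -> trivialMod G Z} :=
  lcomb (fun j => ((eps (delta_mx 0 j) : int)%:~R : Z) : trivialMod G Z).
have epsZE v : epsZ (intr_row Z v) = (eps v : int)%:~R :> Z.
  rewrite (linear_row eps) (big_morph (fun z : trivialMod G int => (z : int)%:~R : Z)
    (id1 := 0) (op1 := +%R)) //; last by move=> x y; rewrite intrD.
  by rewrite /epsZ/= /lcomb; apply: eq_bigr => j _; rewrite intr_cact mxE.
pose DZ k : {linear _ -> _} := @base_change G Z _ _ (D k).
pose eZ k : {linear _ -> _} := @base_change G Z _ _ (e k).
pose TZ k := @coef_base_change G Z _ _ (T k).
have DZE k v : DZ k (intr_row Z v) = intr_row Z (D k v) by exact: base_changeE.
have eZE k v : eZ k (intr_row Z v) = intr_row Z (e k v) by exact: base_changeE.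
have TZE k v : (k <= m)%N -> TZ k (intr_row Z v) = intr_row Z (T k v).
  by move=> km; apply: coef_base_changeE; exact: T_lin.
have TZ_lin k : coef_linear (TZ k) by exact: coef_extend_linear.
have DDZ k v : DZ k (DZ k.+1 v) = 0.
  apply: (linear_intr_ext (f := DZ k \o DZ k.+1 : {linear _ -> _})
    (g := \0 : {linear _ -> _})) => {}v /=.
  by rewrite !DZE DD intr_row0.
have epsDZ v : epsZ (DZ 0%N v) = 0.
  apply: (linear_intr_ext (f := epsZ \o DZ 0%N : {linear _ -> _})
    (g := \0 : {linear _ -> _})) => {}v /=.
  by rewrite DZE epsZE epsD.
have eeZ k v : eZ k (eZ k v) = eZ k v.
  apply: (linear_intr_ext (f := eZ k \o eZ k : {linear _ -> _})) => {}v /=.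
  by rewrite !eZE ee.
have DeZ k v : DZ k (eZ k.+1 v) = DZ k v.
  apply: (linear_intr_ext (f := DZ k \o eZ k.+1 : {linear _ -> _})) => {}v /=.
  by rewrite eZE !DZE De.
have epseZ v : epsZ (eZ 0%N v) = epsZ v.
  apply: (linear_intr_ext (f := epsZ \o eZ 0%N : {linear _ -> _})) => {}v /=.
  by rewrite eZE !epsZE epse.
pose uZ := intr_row Z (i 0%N u).
have epsu : epsZ uZ = 1 by rewrite epsZE /eps/= qi// u1.
have epsZ_lin : coef_linear (fun v => monom (trivial_action G Z) (epsZ v : Z) 1%g *: uZ).
  move=> c x y; rewrite linearP cact_monom /= monomD scalerDl.
  by rewrite scalerA monomM/= mulg1.
have DTZ0 v : (0 < m)%N -> DZ 0%N (TZ 0%N v) =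
    eZ 0%N v - monom (trivial_action G Z) (epsZ v : Z) 1%g *: uZ.
  move=> m0; apply: (coef_linear_intr_ext (f := DZ 0%N \o TZ 0%N)
    (g := fun v => eZ 0%N v - monom (trivial_action G Z) (epsZ v : Z) 1%g *: uZ)).
  - by apply: coef_linear_comp => //; exact: coef_linear_linear.
  - apply: coef_linear_add; first exact: coef_linear_linear.
    exact: coef_linear_opp.
  - move=> {}v /=; rewrite TZE// DZE eZE DT0// intr_rowD intr_rowN epsZE.
    by rewrite intr_rowZ intr_group_monom.
have DTZS k v : (k.+1 < m)%N -> DZ k.+1 (TZ k.+1 v) = eZ k.+1 v - TZ k (DZ k v).
  move=> km; apply: (coef_linear_intr_ext (f := DZ k.+1 \o TZ k.+1)
    (g := fun v => eZ k.+1 v - TZ k (DZ k v))).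
  - by apply: coef_linear_comp => //; exact: coef_linear_linear.
  - apply: coef_linear_add; first exact: coef_linear_linear.
    apply: coef_linear_opp; apply: (@coef_linear_comp _ _ _ _ _ (TZ k) (DZ k)) => //.
    exact: coef_linear_linear.
  - move=> {}v /=; rewrite TZE ?(ltnW km)// !DZE eZE TZE ?DTS ?intr_rowD ?intr_rowN//.
    by rewrite ltnW// ltnW.
unshelve eexists (@RetractComplex G Z m r DZ epsZ eZ DDZ epsDZ eeZ DeZ epseZ _ _ _) => //.
- move=> m0 v ev epsv; exists (TZ 0%N v).
  by rewrite DTZ0// ev epsv monom0 scale0r subr0.
- move=> k km v ev dv; exists (TZ k.+1 v).
  by rewrite DTZS// ev dv (coef_linear0 (TZ_lin k)) subr0.
- by exists uZ.
Qed.

(** * Norms on the crossed product *)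

Section Norms.
Variables (R : realType) (G : groupType) (d : measure_display).
Variables (X : measurableType d) (mu : probability X R).
Variables (al : standardAction G mu) (Z : coefRing R).
Hypothesis norm0 : coef_norm Z 0 = 0.

Local Notation L := (Linf mu Z).
Local Notation S := (crossedRing al Z).
Local Notation nrm := (coef_norm Z).

Lemma Linf_fun_class (f : bmeas mu Z) :
  {ae mu, forall x, Linf_fun (Linf_class f) x = bmeas_fun f x}.
Proof. by apply/Linf_classP; rewrite Linf_reprK. Qed.

Lemma Linf_funD (l l' : L) :
  {ae mu, forall x, Linf_fun (l + l') x = Linf_fun l x + Linf_fun l' x}.
Proof.
rewrite -[l in X in {ae _, forall x, Linf_fun X x = _}]Linf_reprK.
rewrite -[l' in X in {ae _, forall x, Linf_fun X x = _}]Linf_reprK -rmorphD.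
exact: Linf_fun_class.
Qed.

Lemma Linf_funM (l l' : L) :
  {ae mu, forall x, Linf_fun (l * l') x = Linf_fun l x * Linf_fun l' x}.
Proof.
rewrite -[l in X in {ae _, forall x, Linf_fun X x = _}]Linf_reprK.
rewrite -[l' in X in {ae _, forall x, Linf_fun X x = _}]Linf_reprK -rmorphM.
exact: Linf_fun_class.
Qed.

Lemma Linf_fun_act g (l : L) :
  {ae mu, forall x, Linf_fun (Linf_act al g l) x = Linf_fun l (al g^-1%g x)}.
Proof. exact: Linf_fun_class. Qed.

Definition pnorm (l : L) : X -> \bar R := fun x => (nrm (Linf_fun l x))%:E.

Lemma pnorm_ge0 l x : (0 <= pnorm l x)%E.
Proof. by rewrite lee_fin coef_norm_ge0. Qed.

Lemma measurable_pnorm l : measurable_fun [set: X] (pnorm l : X -> \bar R).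
Proof.
move=> _ B _; rewrite setTI; have /asboolP[mf _] := valP (repr l).
exact: (mf [set z | B (nrm z)%:E]).
Qed.

Lemma Linf_fun_bounded (l : L) : exists2 c : R, 0 <= c & {ae mu, forall x, nrm (Linf_fun l x) <= c}.
Proof.
have /asboolP[_ [c hc]] := valP (repr l).
exists (Num.max c 0); first by rewrite le_max lexx orbT.
by apply: filterS hc => x; rewrite le_max => ->.
Qed.

Lemma integral_pnorm_lty l : (\int[mu]_x pnorm l x < +oo)%E.
Proof.
have [c c0 hc] := Linf_fun_bounded l.
apply: (@le_lt_trans _ _ (\int[mu]_x (c%:E))%E); last first.
  rewrite integral_cst//; apply: lte_mul_pinfty; rewrite ?lee_fin//.
  exact: (le_lt_trans (probability_le1 mu measurableT) (ltry _)).
apply: ae_ge0_le_integral => //.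
- by move=> x _; exact: pnorm_ge0.
- exact: measurable_pnorm.
- by apply: filterS hc => x h _; rewrite lee_fin.
Qed.

Lemma L1normE (l : L) : (L1norm l)%:E = (\int[mu]_x pnorm l x)%E.
Proof.
rewrite /L1norm fineK// ge0_fin_numE ?integral_pnorm_lty//.
by apply: integral_ge0 => x _; exact: pnorm_ge0.
Qed.

Lemma L1norm_ge0 (l : L) : 0 <= L1norm l.
Proof. by apply/fine_ge0/integral_ge0 => x _; rewrite lee_fin coef_norm_ge0. Qed.

Lemma L1norm0 : L1norm (0 : L) = 0.
Proof.
apply: EFin_inj; rewrite L1normE; apply/eqP; rewrite eq_le; apply/andP; split; last first.
  by apply: integral_ge0 => x _; exact: pnorm_ge0.
rewrite -[leRHS](integral0 mu setT); apply: ae_ge0_le_integral => //.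
- by move=> x _; exact: pnorm_ge0.
- exact: measurable_pnorm.
- apply: filterS (Linf_fun_class 0) => x; rewrite rmorph0 /pnorm => -> _.
  by rewrite norm0.
Qed.

Lemma L1normD (l l' : L) : L1norm (l + l') <= L1norm l + L1norm l'.
Proof.
rewrite -lee_fin EFinD !L1normE -ge0_integralD//; last first.
- exact: measurable_pnorm.
- by move=> x _; exact: pnorm_ge0.
- exact: measurable_pnorm.
- by move=> x _; exact: pnorm_ge0.
apply: ae_ge0_le_integral => //.
- by move=> x _; exact: pnorm_ge0.
- exact: measurable_pnorm.
- by move=> x _; rewrite adde_ge0 ?pnorm_ge0.
- by apply: emeasurable_funD; exact: measurable_pnorm.
- apply: filterS (Linf_funD l l') => x E _; rewrite /pnorm E -EFinD lee_fin.
  exact: coef_normD.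
Qed.

Lemma sum_L1norm_mul_le (I : Type) (s : seq I) (l : L) (F : I -> L) (c : R) :
  0 <= c -> {ae mu, forall x, \sum_(i <- s) nrm (Linf_fun (F i) x) <= c} ->
  \sum_(i <- s) L1norm (l * F i) <= c * L1norm l.
Proof.
move=> c0 hF; rewrite -lee_fin EFinM L1normE -sumEFin.
under eq_bigr do rewrite L1normE.
rewrite -ge0_integral_sum//; last 2 first.
- by move=> i; exact: measurable_pnorm.
- by move=> i x _; exact: pnorm_ge0.
rewrite -ge0_integralZl//; last 2 first.
- exact: measurable_pnorm.
- by move=> x _; exact: pnorm_ge0.
apply: ae_ge0_le_integral => //.
- by move=> x _; apply: sume_ge0 => i _; exact: pnorm_ge0.
- by apply: emeasurable_sum => i; exact: measurable_pnorm.
- by move=> x _; rewrite mule_ge0 ?pnorm_ge0.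
- by apply: measurable_funeM; exact: measurable_pnorm.
have hM : {ae mu, forall x, \sum_(i <- s) nrm (Linf_fun (l * F i) x) <=
    nrm (Linf_fun l x) * \sum_(i <- s) nrm (Linf_fun (F i) x)}.
  elim: s {hF} => [|i s IH].
    by apply: aeW => x; rewrite !big_nil mulr0.
  apply: filterS2 IH (Linf_funM l (F i)) => x IH E.
  rewrite !big_cons mulrDr lerD// E; exact: coef_normM.
apply: filterS2 hF hM => x hF hM _; rewrite /pnorm sumEFin -EFinM lee_fin.
by rewrite (le_trans hM)// mulrC ler_wpM2r// coef_norm_ge0.
Qed.

Lemma crossed_normE (r : S) s : uniq s -> (forall g, coeff r g != 0 -> g \in s) ->
  crossed_norm r = \sum_(g <- s) L1norm (coeff r g).
Proof.
move=> us rs; apply: fsumE => // g; apply: contraR => gs.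
have /eqP-> : coeff r g == 0 by apply: contraR gs => /rs.
by rewrite L1norm0.
Qed.

Lemma crossed_norm_ge0 (r : S) : 0 <= crossed_norm r.
Proof.
have [s us rs] := finsupp_seq (coeff_finsupp r).
by rewrite (crossed_normE us rs) sumr_ge0// => g _; exact: L1norm_ge0.
Qed.

Lemma crossed_norm0 : crossed_norm (0 : S) = 0.
Proof. by rewrite (@crossed_normE _ [::]) ?big_nil// => g; rewrite coeff0 eqxx. Qed.

Lemma crossed_normD (r s : S) : crossed_norm (r + s) <= crossed_norm r + crossed_norm s.
Proof.
have [t _ rt] := finsupp_seq (coeff_finsupp r).
have [u _ su] := finsupp_seq (coeff_finsupp s).
have uU : uniq (undup (t ++ u)) by exact: undup_uniq.
have rU g : coeff r g != 0 -> g \in undup (t ++ u).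
  by rewrite mem_undup mem_cat => /rt ->.
have sU g : coeff s g != 0 -> g \in undup (t ++ u).
  by rewrite mem_undup mem_cat => /su ->; rewrite orbT.
rewrite (crossed_normE uU rU) (crossed_normE uU sU) (crossed_normE uU).
  by rewrite -big_split ler_sum// => g _; exact: L1normD.
move=> g; apply: contraR => gU; rewrite coeffD.
have /eqP-> : coeff r g == 0 by apply: contraR gU => /rU.
have /eqP-> : coeff s g == 0 by apply: contraR gU => /sU.
by rewrite addr0.
Qed.

Lemma crossed_norm_sum (I : Type) (s : seq I) (F : I -> S) :
  crossed_norm (\sum_(i <- s) F i) <= \sum_(i <- s) crossed_norm (F i).
Proof.
elim: s => [|i s IH]; first by rewrite !big_nil crossed_norm0.
by rewrite !big_cons (le_trans (crossed_normD _ _))// lerD2l.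
Qed.

Definition right_bounded (s : S) (c : R) : Prop :=
  0 <= c /\ forall r, crossed_norm (r * s) <= c * crossed_norm r.

Lemma coeff_monomM (l : L) h (s : S) k :
  coeff (monom _ l h * s) k = l * Linf_act al h (coeff s (h^-1 * k)%g).
Proof.
rewrite (@coeffM _ _ _ _ _ [:: h])//; last first.
  by move=> g; rewrite coeff_monom inE; case: ifP => //; rewrite eqxx.
by rewrite big_seq1 coeff_monom eqxx.
Qed.

(** The hypothesis is invariant under translation, so it bounds products with monomials, and these
    add up. Bounding the coefficients jointly at each point gives the graph of a map the bound 1,
    however many values the map has. *)
Lemma right_bounded_pointwise (s : S) (t : seq G) (c : R) : uniq t ->
  (forall g, coeff s g != 0 -> g \in t) -> 0 <= c ->
  {ae mu, forall x, \sum_(g <- t) nrm (Linf_fun (coeff s g) x) <= c} ->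
  right_bounded s c.
Proof.
move=> ut st c0 sc; split => // r.
have H l h : crossed_norm (monom _ l h * s) <= c * L1norm l.
  rewrite (@crossed_normE _ [seq (h * g)%g | g <- t]).
  - rewrite big_map; under eq_bigr do rewrite coeff_monomM mulKg.
    apply: sum_L1norm_mul_le => //.
    have := ae_translate al h^-1%g sc.
    have E : {ae mu, forall x,
        \sum_(g <- t) nrm (Linf_fun (Linf_act al h (coeff s g)) x) =
        \sum_(g <- t) nrm (Linf_fun (coeff s g) (al h^-1%g x))}.
      elim: t {ut st sc} => [|g t IH]; first by apply: aeW => x; rewrite !big_nil.
      by apply: filterS2 IH (Linf_fun_act h (coeff s g)) => x; rewrite !big_cons => -> ->.
    by apply: filterS2 E => x ->.
  - by rewrite map_inj_uniq//; exact: mulgI.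
  - move=> g; rewrite coeff_monomM => sg; rewrite -[g](mulVKg h) map_f// st//.
    by apply: contraNneq sg => ->; rewrite rmorph0 mulr0.
have [u uu ru] := finsupp_seq (coeff_finsupp r).
rewrite (crossed_normE uu ru) {1}(crossed_sumE uu ru) mulr_suml mulr_sumr.
by apply: le_trans (crossed_norm_sum _ _) _; apply: ler_sum => h _.
Qed.

Lemma right_boundedM (s t : S) (c e : R) : right_bounded s c -> right_bounded t e ->
  right_bounded (s * t) (c * e).
Proof.
move=> [c0 sc] [e0 te]; split => [|r]; first exact: mulr_ge0.
by rewrite mulrA (le_trans (te _))// [c * e]mulrC -mulrA; apply: ler_wpM2l.
Qed.

End Norms.

(** * Indicator functions in the crossed product *)

Section IndicatorFunctions.
Variables (R : realType) (G : groupType) (d : measure_display).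
Variables (X : measurableType d) (mu : probability X R).
Variables (al : standardAction G mu) (Z : coefRing R).

Local Notation L := (Linf mu Z).
Local Notation A := (Linf_action al Z).
Local Notation S := (crossedRing al Z).
Implicit Types (U V W : measurableSet X).
Local Notation chi := (chi mu Z).

Lemma chi_set0 U : (forall x, ~ (U : set X) x) -> chi U = 0.
Proof.
move=> U0; rewrite -(rmorph0 (@Linf_class _ _ _ mu Z)); apply/Linf_classP/aeW => x.
by rewrite /bmeas_fun/= asboolF.
Qed.

Lemma chi_mul U V W : (forall x, (W : set X) x <-> (U : set X) x /\ (V : set X) x) ->
  chi U * chi V = chi W.
Proof.
move=> WUV; rewrite -[LHS](rmorphM (@Linf_class _ _ _ mu Z)); apply/Linf_classP/aeW => x.
rewrite -[LHS]/(bmeas_fun (chi_bmeas mu Z U) x * bmeas_fun (chi_bmeas mu Z V) x).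
rewrite /bmeas_fun/=; case: (asboolP (ms_set W x)) => [/WUV[Ux Vx]|nW].
  by rewrite !asboolT// mulr1.
case: asboolP => Ux; last by rewrite mul0r.
by rewrite mul1r asboolF// => Vx; apply/nW/WUV.
Qed.

Lemma chi_sub U V : (forall x, (V : set X) x -> (U : set X) x) -> chi U * chi V = chi V.
Proof. by move=> VU; apply: chi_mul => x; split=> [Vx|[]//]; split => //; exact: VU. Qed.

Lemma chi_agree U V W : (forall x, ~ (U : set X) x -> (V : set X) x <-> (W : set X) x) ->
  chi U * (chi V - chi W) = chi V - chi W.
Proof.
move=> UVW; rewrite -[chi V - _](rmorphB (@Linf_class _ _ _ mu Z)).
rewrite -[LHS](rmorphM (@Linf_class _ _ _ mu Z)); apply/Linf_classP/aeW => x.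
set f := chi_bmeas mu Z V - chi_bmeas mu Z W.
rewrite -[LHS]/(bmeas_fun (chi_bmeas mu Z U) x * bmeas_fun f x).
rewrite -[bmeas_fun f x]/(bmeas_fun (chi_bmeas mu Z V) x - bmeas_fun (chi_bmeas mu Z W) x).
rewrite /bmeas_fun/=; case: (asboolP (ms_set U x)) => [Ux|nU]; first by rewrite mul1r.
have := UVW x nU; case: asboolP => Vx; case: asboolP => Wx.
- by rewrite subrr mulr0.
- by move=> [/(_ Vx)].
- by move=> [_ /(_ Wx)].
- by rewrite subrr mulr0.
Qed.

Lemma chi_act g U V : (forall x, (V : set X) x <-> (U : set X) (al g^-1%g x)) ->
  Linf_act al g (chi U) = chi V.
Proof.
move=> UV; rewrite Linf_act_class; apply/Linf_classP/aeW => x; rewrite /bmeas_fun/=.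
rewrite -[bmeas_fun _ _]/(if `[< ms_set U (al g^-1%g x) >] then 1 else 0).
by case: asboolP => Vx; case: asboolP => Ux //; [case: Ux|case: Vx]; apply/(UV x).
Qed.

Lemma chi_partition (c : X -> G) (T : seq G) (U : G -> measurableSet X) : uniq T ->
  (forall x, c x \in T) -> (forall t x, (U t : set X) x <-> c x = t) ->
  \sum_(t <- T) chi (U t) = 1.
Proof.
move=> uT cT Uc; rewrite -[LHS](rmorph_sum (@Linf_class _ _ _ mu Z)).
rewrite -(rmorph1 (@Linf_class _ _ _ mu Z)); apply/Linf_classP/aeW => x.
have -> : bmeas_fun (\sum_(t <- T) chi_bmeas mu Z (U t)) x =
    \sum_(t <- T) bmeas_fun (chi_bmeas mu Z (U t)) x.
  by apply: (big_morph (fun f => bmeas_fun f x)).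
rewrite (bigD1_seq (c x))//= big1 => [|t tc].
  by rewrite /bmeas_fun/= asboolT ?addr0//; apply/Uc.
by rewrite /bmeas_fun/= asboolF// => /Uc ct; rewrite ct eqxx in tc.
Qed.

Definition mchi U : S := monom A (chi U) 1%g.

Lemma Linf_act1E (l : L) : A 1%g l = l.
Proof. exact: ract1. Qed.

Lemma mchi_idem U : mchi U * mchi U = mchi U.
Proof. by rewrite /mchi monomM Linf_act1E mulg1 chi_sub. Qed.

(** As [mchi U] is idempotent, membership in the left ideal that it generates is an equation. *)
Lemma angleE U (r : S) : angle U r <-> r * mchi U = r.
Proof.
split; last by move=> rE; exists r.
by move=> [s ->]; rewrite -mulrA mchi_idem.
Qed.

Lemma coeff_mchiM U (s : S) k : coeff (mchi U * s) k = chi U * coeff s k.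
Proof. by rewrite coeff_monomM invg1 mul1g Linf_act1. Qed.

Lemma coeff_mulm (G' : groupType) (L' : nzRingType) (a : ringAction G' L')
    (r : crossed a) l k : coeff (r * monom a l 1%g) k = coeff r k * a k l.
Proof.
elim/crossed_ind: r => [|r s IH IH'|l' g].
- by rewrite mul0r coeff0 mul0r.
- by rewrite mulrDl !coeffD IH IH' mulrDl.
rewrite monomM mulg1 !coeff_monom; case: eqP => [->//|_]; by rewrite mul0r.
Qed.

Local Notation incl := (groupRing_incl al (Z := Z)).
Local Notation ZG := (groupRing G Z).

Lemma inclD (x y : ZG) : incl (x + y) = incl x + incl y.
Proof. exact: crossed_mapD. Qed.

Lemma incl0 : incl 0 = 0.
Proof. exact: crossed_map0. Qed.

Lemma incl1 : incl 1 = 1.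
Proof. exact: crossed_map1. Qed.

Lemma incl_monom c g : incl (monom _ c g) = monom A (Linf_const mu c) g.
Proof. exact: crossed_map_monom. Qed.

Lemma Linf_act_const g (c : Z) : Linf_act al g (Linf_const mu c) = Linf_const mu c.
Proof. by rewrite /Linf_const Linf_act_class; apply/Linf_classP/aeW. Qed.

Lemma inclM (x y : ZG) : incl (x * y) = incl x * incl y.
Proof. by apply: crossed_mapM => g c; rewrite /= Linf_act_const. Qed.

Lemma incl_sum (I : Type) (s : seq I) (F : I -> ZG) :
  incl (\sum_(i <- s) F i) = \sum_(i <- s) incl (F i).
Proof. exact: (big_morph _ inclD incl0). Qed.

Lemma Linf_cact_monom (l : L) g (x : Linf_module al Z) :
  (monom A l g *: x : Linf_module al Z) = l * Linf_act al g x :> L.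
Proof.
rewrite -[LHS]/(cact _ _) (@cactE _ _ _ _ [:: g])//.
  by rewrite big_seq1 coeff_monom eqxx.
by move=> h; rewrite coeff_monom inE; case: ifP => //; rewrite eqxx.
Qed.

Lemma incl_act (x : ZG) (w : trivialMod G Z) :
  (incl x *: (Linf_const mu (w : Z) : Linf_module al Z) : Linf_module al Z) =
  Linf_const mu ((x *: w : trivialMod G Z) : Z).
Proof.
elim/crossed_ind: x => [|x y IH IH'|c g].
- by rewrite incl0 !scale0r [RHS]rmorph0.
- by rewrite inclD !scalerDl IH IH' [RHS]rmorphD.
by rewrite incl_monom Linf_cact_monom Linf_act_const cact_monom -rmorphM.
Qed.

End IndicatorFunctions.

(** * Marked modules *)

Section MarkedSums.
Variables (R : realType) (G : groupType) (d : measure_display).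
Variables (X : measurableType d) (mu : probability X R).
Variables (al : standardAction G mu) (Z : coefRing R).
Local Notation S := (crossedRing al Z).
Variables (I : finType) (B : I -> measurableSet X).

Definition marked_pred : {pred {ffun I -> S^o}} :=
  fun v => `[< forall i, angle (al := al) (Z := Z) (B i) (v i) >].

Lemma marked_submod_closed : submod_closed marked_pred.
Proof.
split=> [|r v w /asboolP vB /asboolP wB]; apply/asboolP => i; apply/angleE.
  by rewrite ffunE mul0r.
have /angleE vi := vB i; have /angleE wi := wB i.
rewrite !ffunE -[in LHS]vi -[in LHS]wi.
rewrite -[r *: _]/(r * (v i * mchi al Z (B i))) mulrDl -!mulrA mchi_idem.
by rewrite vi wi.
Qed.

HB.instance Definition _ :=
  GRing.isSubmodClosed.Build S {ffun I -> S^o} marked_pred marked_submod_closed.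

Definition marked_sum : Type := {v : {ffun I -> S^o} | v \in marked_pred}.

HB.instance Definition _ := [isSub of marked_sum for @sval _ _].
HB.instance Definition _ := [Choice of marked_sum by <:].
HB.instance Definition _ := [SubChoice_isSubLmodule of marked_sum by <:].

Definition ms_coord (v : marked_sum) (i : I) : S := val v i.

Lemma ms_ext (v w : marked_sum) : (forall i, ms_coord v i = ms_coord w i) -> v = w.
Proof. by move=> vw; apply/val_inj/ffunP. Qed.

Lemma ms_coordD v w i : ms_coord (v + w) i = ms_coord v i + ms_coord w i.
Proof. by rewrite /ms_coord raddfD ffunE. Qed.

Lemma ms_coordZ r v i : ms_coord (r *: v) i = r * ms_coord v i.
Proof. by rewrite /ms_coord linearZ ffunE. Qed.

Lemma ms_coord0 i : ms_coord 0 i = 0.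
Proof. by rewrite /ms_coord raddf0 ffunE. Qed.

Lemma ms_coord_sum (J : Type) (s : seq J) (F : J -> marked_sum) i :
  ms_coord (\sum_(j <- s) F j) i = \sum_(j <- s) ms_coord (F j) i.
Proof.
exact: (big_morph (fun v => ms_coord v i) (fun v w => ms_coordD v w i) (ms_coord0 i)).
Qed.

Lemma mk_ms_subproof (f : I -> S) : (forall i, f i * mchi al Z (B i) = f i) ->
  [ffun i => f i : S^o] \in marked_pred.
Proof. by move=> fB; apply/asboolP => i; apply/angleE; rewrite ffunE. Qed.

Definition mk_ms f fB : marked_sum := exist _ [ffun i => f i : S^o] (@mk_ms_subproof f fB).

Lemma mk_msE f fB i : ms_coord (@mk_ms f fB) i = f i.
Proof. by rewrite /ms_coord/= ffunE. Qed.

Lemma marked_sum_image (v : {ffun I -> S^o}) :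
  (exists z : marked_sum, val z = v) <-> forall i, angle (al := al) (Z := Z) (B i) (v i).
Proof.
split=> [[z <-]|vB]; first exact/asboolP/(valP z).
have vP : v \in marked_pred by apply/asboolP.
by exists (exist _ v vP).
Qed.

Definition marked_sum_marking : marking (marked_sum : lmodType S) :=
  @Marking _ _ _ _ _ _ _ marked_sum I B (\val : {linear marked_sum -> {ffun I -> S^o}})
    val_inj marked_sum_image.

End MarkedSums.

(** * Norm bounds in terms of the complex [E] *)

Section Estimates.
Variables (R : realType) (G : groupType) (d : measure_display).
Variables (X : measurableType d) (mu : probability X R).
Variables (al : standardAction G mu) (Z : coefRing R).
Variables (m : nat) (E : retract_complex G Z m).

Local Notation ZG := (groupRing G Z).
Local Notation nrm := (coef_norm Z).
Local Notation incl := (groupRing_incl al (Z := Z)).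

Definition l1norm (y : ZG) : R := \sum_(g \in [set: G]) nrm (coeff y g).

(* A bound for the operator norm of [small_bd], depending on [E] only. *)
Definition bd_const (k : nat) : R :=
  match k with
  | 0 => \sum_(i < rc_rank E 1) l1norm
           (\sum_j rc_d E 0 (delta_mx 0 i) 0 j * monom _ (rc_aug E (delta_mx 0 j) : Z) 1%g)
  | k'.+1 => \sum_(i < rc_rank E k'.+2) \sum_j l1norm (rc_d E k'.+1 (delta_mx 0 i) 0 j)
  end.

Section NormBound.
Hypotheses (norm0 : nrm 0 = 0) (norm1 : nrm 1 = 1).

Lemma right_bounded_incl (y : ZG) : right_bounded (incl y) (l1norm y).
Proof.
have [s us ys] := finsupp_seq (coeff_finsupp y).
have l1E : l1norm y = \sum_(g <- s) nrm (coeff y g).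
  apply: fsumE => // g; apply: contraR => gs.
  have /eqP-> : coeff y g == 0 by apply: contraR gs => /ys.
  by rewrite norm0.
apply: (right_bounded_pointwise norm0 us).
- move=> g; apply: contraR => gs; rewrite /coeff/= -/(coeff y g).
  have /eqP-> : coeff y g == 0 by apply: contraR gs => /ys.
  exact/eqP/(rmorph0 (@Linf_const _ _ _ mu Z)).
- by rewrite l1E sumr_ge0// => g _; exact: coef_norm_ge0.
rewrite l1E; elim: (s) => [|g t IH]; first by apply: aeW => x; rewrite !big_nil.
apply: filterS2 IH (Linf_fun_class (const_bmeas mu (coeff y g))) => x IH Ex.
by rewrite !big_cons lerD//; rewrite [Linf_fun _ _]Ex.
Qed.

Lemma right_bounded_mchi (U : measurableSet X) : right_bounded (mchi al Z U) 1.
Proof.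
apply: (@right_bounded_pointwise _ _ _ _ _ _ _ norm0 _ [:: 1%g]) => //.
  by move=> g; rewrite coeff_monom inE; case: ifP => //; rewrite eqxx.
apply: filterS (Linf_fun_class (chi_bmeas mu Z U)) => x Ex.
rewrite big_seq1 coeff_monom eqxx [Linf_fun _ _]Ex /bmeas_fun/=.
by case: asboolP => _; rewrite ?norm0 ?norm1.
Qed.

End NormBound.
End Estimates.

(** * The small complex *)

Section SmallComplex.
Variables (R : realType) (G : groupType) (d : measure_display).
Variables (X : measurableType d) (mu : probability X R).
Variables (al : standardAction G mu) (Z : coefRing R).
Variables (m : nat) (E : retract_complex G Z m).

Local Notation L := (Linf mu Z).
Local Notation A := (Linf_action al Z).
Local Notation S := (crossedRing al Z).
Local Notation ZG := (groupRing G Z).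
Local Notation chi := (chi mu Z).
Local Notation mchi := (mchi al Z).
Local Notation incl := (groupRing_incl al (Z := Z)).

Variables (K : nat -> seq G).
Hypothesis K_supp : forall k i j h,
  coeff (rc_d E k (delta_mx 0 i) 0 j) h != 0 -> h \in K k.

Variables (c : X -> G) (T : seq G) (B F : measurableSet X).
Hypothesis uT : uniq T.
Hypothesis cT : forall x, c x \in T.
Hypothesis mc : forall t, measurable (c @^-1` [set t]).
Hypothesis c_equiv : forall g x, g \in K 0 -> ~ (B : set X) x ->
  c (al g^-1%g x) = (g^-1 * c x)%g.
Hypothesis cF : forall x, (F : set X) (al (c x)^-1%g x).

Definition fiber t : measurableSet X := MeasurableSet (mc t).

(* As a function on the orbit relation, the indicator of the graph of the
   retraction [x |-> (c x)^-1 x]. *)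
Definition graph_elt : S := \sum_(t <- T) monom A (chi (fiber t)) t.

Lemma coeff_graph k : coeff graph_elt k = chi (fiber k).
Proof.
rewrite coeff_sum; under eq_bigr do rewrite coeff_monom.
have [kT|kT] := boolP (k \in T).
  rewrite (bigD1_seq k)//= eqxx big1 ?addr0// => t tk.
  by rewrite eq_sym (negbTE tk).
rewrite chi_set0 => [|x /= cx]; last by rewrite -cx cT in kT.
by rewrite big_seq big1// => t tT; case: eqP kT => // ->; rewrite tT.
Qed.

Lemma measurable_translate g (U : measurableSet X) : measurable (al g^-1%g @^-1` U).
Proof. exact/measurable_preimage_sact/ms_measurable. Qed.

Definition mtranslate g U : measurableSet X := MeasurableSet (measurable_translate g U).

Lemma act_chi g U : Linf_act al g (chi U) = chi (mtranslate g U).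
Proof. exact: chi_act. Qed.

(** Where [c] has the value [t], the point [t^-1 x] is in [F]; so the translate of [F] by [t]
    contains the fiber of [t]. *)
Lemma graph_mchi : graph_elt * mchi F = graph_elt.
Proof.
rewrite /graph_elt mulr_suml; apply: eq_bigr => t _.
rewrite /mchi monomM mulg1 [A t _]act_chi mulrC chi_sub// => x /= <-.
exact: cF.
Qed.

Lemma graph_act : (graph_elt *: (chi F : Linf_module al Z) : Linf_module al Z) = 1 :> L.
Proof.
rewrite /graph_elt scaler_suml -(chi_partition mu Z (U := fiber) uT cT)//.
apply: eq_bigr => t _; rewrite Linf_cact_monom act_chi mulrC chi_sub// => x /= <-.
exact: cF.
Qed.

(** At [k], the coefficients of [g z] and of [z] are the indicators of [c (g^-1 x) = g^-1 k] and of
    [c x = k], which agree off [B]. *)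
Lemma graph_defect g : g \in K 0 ->
  mchi B * (monom A 1 g * graph_elt - graph_elt) = monom A 1 g * graph_elt - graph_elt.
Proof.
move=> gK; apply: crossedP => k.
rewrite coeff_mchiM coeffD coeffN coeff_monomM mul1r !coeff_graph act_chi.
apply: chi_agree => x nB /=; rewrite c_equiv//; split=> [/mulgI//|->//].
Qed.

Lemma mchi_const U l : mchi U * monom A l 1%g = monom A l 1%g * mchi U.
Proof. by rewrite /mchi !monomM !Linf_act1E mulg1 mulrC. Qed.

(** The coefficients of [y] have sum 0, so [y] is a combination of elements [g - 1], to which
    [graph_defect] applies; constants commute with the indicator of [B]. *)
Lemma augmentation_kernel_absorb (y : ZG) : (forall g, coeff y g != 0 -> g \in K 0) ->
  (y *: (1 : trivialMod G Z) : trivialMod G Z) = 0 ->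
  mchi B * (incl y * graph_elt) = incl y * graph_elt.
Proof.
move=> yK y0; have [s us ys] := finsupp_seq (coeff_finsupp y).
pose t := [seq g <- s | coeff y g != 0].
have ut : uniq t by rewrite filter_uniq.
have yt g : coeff y g != 0 -> g \in t by move=> yg; rewrite mem_filter yg ys.
pose cst g := monom A (Linf_const mu (coeff y g)) 1%g.
have -> : incl y * graph_elt =
    \sum_(g <- t) cst g * (monom A 1 g * graph_elt - graph_elt).
  have cst0 : \sum_(g <- t) cst g = 0.
    rewrite /cst -monom_sum -(rmorph_sum (@Linf_const _ _ _ mu Z)).
    suff -> : \sum_(g <- t) coeff y g = 0 by rewrite rmorph0 monom0.
    rewrite -[RHS]y0 -[RHS]/(cact _ _) (cactE _ ut yt).
    by apply: eq_bigr => g _; rewrite mulr1.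
  under eq_bigr do rewrite mulrBr.
  have cstz0 : \sum_(g <- t) cst g * graph_elt = 0 by rewrite -mulr_suml cst0 mul0r.
  rewrite sumrB cstz0 subr0.
  rewrite {1}(crossed_sumE ut yt) incl_sum mulr_suml; apply: eq_bigr => g _.
  by rewrite mulrA monomM Linf_act1E mulr1 mul1g incl_monom.
rewrite mulr_sumr big_seq [RHS]big_seq; apply: eq_bigr => g.
rewrite mem_filter => /andP[/yK gK _].
by rewrite mulrA mchi_const -mulrA graph_defect.
Qed.

Lemma measurable_saturate (s : seq G) (U : measurableSet X) :
  measurable (\big[setU/set0]_(g <- s) (al g^-1%g @^-1` U)).
Proof. by apply: bigsetU_measurable => g _; exact: measurable_translate. Qed.

Definition saturate s U : measurableSet X := MeasurableSet (measurable_saturate s U).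

(* The boundary matrix of [E] in degree [k] maps the submodule supported on
   [bad k.-1] into that supported on [bad k]. *)
Fixpoint bad k : measurableSet X :=
  if k is k'.+1 then saturate (K k) (bad k') else B.

(** Moving [g] past the indicator of [bad k] translates this set by [g], and [bad k.+1] contains the
    translates by the elements of [K k.+1]. *)
Lemma bad_absorb k (y : ZG) : (forall g, coeff y g != 0 -> g \in K k.+1) ->
  mchi (bad k.+1) * (incl y * mchi (bad k)) = incl y * mchi (bad k).
Proof.
move=> yK; have [s us ys] := finsupp_seq (coeff_finsupp y).
pose t := [seq g <- s | coeff y g != 0].
have ut : uniq t by rewrite filter_uniq.
have yt g : coeff y g != 0 -> g \in t by move=> yg; rewrite mem_filter yg ys.
rewrite (crossed_sumE ut yt) incl_sum mulr_suml mulr_sumr !big_seq.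
apply: eq_bigr => g; rewrite mem_filter => /andP[/yK gK _].
rewrite incl_monom /mchi !monomM Linf_act1E mul1g; congr monom.
rewrite [A g _]act_chi mulrCA chi_sub// => x /= badx.
by rewrite -bigcup_seq; exists g.
Qed.

(** One generator suffices in degree 0, as all generators of [E] go to multiples of [base_elt]
    there. *)
Definition idx k : nat := if k is 0 then 1%N else rc_rank E k.

Definition sets k (_ : 'I_(idx k)) : measurableSet X :=
  if k is k'.+1 then bad k' else F.

Local Notation D k := (marked_sum al Z (@sets k)).

Lemma base_elt_subproof (i : 'I_(idx 0)) : graph_elt * mchi (@sets 0 i) = graph_elt.
Proof. exact: graph_mchi. Qed.

Definition base_elt : D 0 := mk_ms base_elt_subproof.

Definition bad_elt_fun k (j : 'I_(idx k.+1)) (i : 'I_(idx k.+1)) : S :=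
  if i == j then mchi (bad k) else 0.

Lemma bad_elt_subproof k (j i : 'I_(idx k.+1)) :
  bad_elt_fun j i * mchi (@sets k.+1 i) = bad_elt_fun j i.
Proof. by rewrite /bad_elt_fun; case: ifP; rewrite ?mul0r// mchi_idem. Qed.

Definition gen_elt k : 'I_(rc_rank E k) -> D k :=
  match k with
  | 0 => fun j => incl (monom _ (rc_aug E (delta_mx 0 j) : Z) 1%g) *: base_elt
  | k'.+1 => fun j => mk_ms (bad_elt_subproof j)
  end.

Definition into_marked k (x : 'rV[ZG]_(rc_rank E k)) : D k :=
  \sum_j incl (x 0 j) *: gen_elt j.

Lemma into_marked_linear k a x y :
  into_marked (a *: x + y) = incl a *: @into_marked k x + into_marked y.
Proof.
rewrite /into_marked scaler_sumr -big_split; apply: eq_bigr => j _ /=.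
by rewrite !mxE inclD inclM scalerDl scalerA.
Qed.

Lemma into_marked0 (x : 'rV[ZG]_(rc_rank E 0)) i :
  ms_coord (into_marked x) i =
  incl (\sum_j x 0 j * monom _ (rc_aug E (delta_mx 0 j) : Z) 1%g) * graph_elt.
Proof.
rewrite ms_coord_sum incl_sum mulr_suml; apply: eq_bigr => j _.
by rewrite !ms_coordZ mk_msE inclM mulrA.
Qed.

Lemma into_markedS k (x : 'rV[ZG]_(rc_rank E k.+1)) (i : 'I_(rc_rank E k.+1)) :
  ms_coord (into_marked x) i = incl (x 0 i) * mchi (bad k).
Proof.
rewrite ms_coord_sum (bigD1 i)//= big1 ?addr0 => [|j ji].
  by rewrite ms_coordZ mk_msE /bad_elt_fun eqxx.
by rewrite ms_coordZ mk_msE /bad_elt_fun eq_sym (negbTE ji) mulr0.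
Qed.

Lemma aug_sum (x : 'rV[ZG]_(rc_rank E 0)) :
  ((\sum_j x 0 j * monom _ (rc_aug E (delta_mx 0 j) : Z) 1%g : ZG) *:
     (1 : trivialMod G Z) : trivialMod G Z) = rc_aug E x.
Proof.
rewrite (linear_row (rc_aug E)) scaler_suml; apply: eq_bigr => j _.
by rewrite -scalerA; congr (_ *: _); rewrite cact_monom mulr1.
Qed.

(** Generators in degree [k.+1] are cut down to [bad k]. A compatible boundary exists because the
    image of the boundary of the original generator is supported there already; for [k = 0] this is
    because boundaries have augmentation 0. *)
Lemma into_marked_absorb k (i : 'I_(rc_rank E k.+1)) :
  mchi (bad k) *: into_marked (rc_d E k (delta_mx 0 i)) =
  into_marked (rc_d E k (delta_mx 0 i)).
Proof.
apply: ms_ext => j; rewrite ms_coordZ; case: k i j => [|k] i j.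
  rewrite into_marked0 augmentation_kernel_absorb//; last by rewrite aug_sum rc_augd.
  move=> g; apply: contraR => gK; rewrite coeff_sum big1// => l _.
  rewrite coeff_mulm; have /eqP-> : coeff (rc_d E 0 (delta_mx 0 i) 0 l) g == 0.
    by apply: contraR gK => /K_supp.
  by rewrite mul0r.
by rewrite into_markedS bad_absorb// => g /K_supp.
Qed.

Definition small_bd k (v : D k.+1) : D k :=
  \sum_(i < rc_rank E k.+1) ms_coord v i *: into_marked (rc_d E k (delta_mx 0 i)).

Lemma small_bd_linear k : linear (@small_bd k).
Proof.
move=> a v w; rewrite /small_bd scaler_sumr -big_split; apply: eq_bigr => i _ /=.
by rewrite ms_coordD ms_coordZ scalerDl scalerA.
Qed.

HB.instance Definition _ k :=
  GRing.isLinear.Build S (D k.+1) (D k) *:%R (@small_bd k) (@small_bd_linear k).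

Definition small_aug (v : D 0) : Linf_module al Z :=
  ms_coord v ord0 *: (chi F : Linf_module al Z).

Lemma small_aug_linear : linear small_aug.
Proof.
by move=> a v w; rewrite /small_aug ms_coordD ms_coordZ scalerDl scalerA.
Qed.

HB.instance Definition _ :=
  GRing.isLinear.Build S (D 0) (Linf_module al Z) *:%R small_aug small_aug_linear.

Lemma small_bd_into k x : small_bd (into_marked x) = into_marked (rc_d E k x).
Proof.
rewrite (linear_row (rc_d E k)) /small_bd.
have sum_into (J : Type) (s : seq J) (H : J -> 'rV[ZG]_(rc_rank E k)) :
    into_marked (\sum_(j <- s) H j) = \sum_(j <- s) into_marked (H j).
  apply: (big_morph _ (id1 := 0)) => [v w|].
    have := into_marked_linear 1 v w; rewrite scale1r => ->.
    by rewrite incl1 scale1r.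
  by rewrite /into_marked big1// => j _; rewrite mxE incl0 scale0r.
rewrite sum_into; apply: eq_bigr => i _.
rewrite into_markedS -scalerA into_marked_absorb.
have /(_ 0) := into_marked_linear (x 0 i) (rc_d E k (delta_mx 0 i)).
rewrite addr0 => ->; rewrite [into_marked 0]big1 ?addr0// => j _.
by rewrite mxE incl0 scale0r.
Qed.

Lemma small_aug_into x : small_aug (into_marked x) = Linf_const mu (rc_aug E x : Z).
Proof.
rewrite /small_aug into_marked0 -scalerA graph_act -aug_sum -incl_act.
by congr (_ *: _); rewrite [RHS]rmorph1.
Qed.

(** Boundaries are combinations of images of boundaries of [E], so the identity is inherited from
    [rc_dd]. *)
Lemma small_bd_bd k (v : D k.+2) : small_bd (small_bd v) = 0.
Proof.
rewrite [in X in small_bd X]/small_bd linear_sum big1// => i _.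
rewrite linearZ /= small_bd_into rc_dd [into_marked 0]big1 ?scaler0// => j _.
by rewrite mxE incl0 scale0r.
Qed.

Lemma small_aug_bd (v : D 1) : small_aug (small_bd v) = 0.
Proof.
rewrite /small_bd linear_sum big1// => i _.
by rewrite linearZ /= small_aug_into rc_augd rmorph0 scaler0.
Qed.

Lemma small_aug_surj (l : Linf_module al Z) : exists v, small_aug v = l.
Proof.
exists (monom A (l : L) 1%g *: base_elt).
rewrite linearZ /= [small_aug _](_ : _ = 1) ?Linf_cact_monom.
  by rewrite [Linf_act _ _ _]rmorph1 mulr1.
by rewrite /small_aug mk_msE graph_act.
Qed.

Definition small_complex : augmentedComplex (Linf_module al Z) :=
  @AugmentedComplex S (Linf_module al Z) (fun k => D k : lmodType S)
    (fun k => @small_bd k : {linear _ -> _}) (small_aug : {linear _ -> _})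
    small_bd_bd small_aug_bd small_aug_surj.

Definition small_marked_complex : markedComplex al Z :=
  @MarkedComplex _ _ _ _ _ al Z small_complex (fun k => marked_sum_marking al Z (@sets k)).

Local Notation marking k := (marked_sum_marking al Z (@sets k)).

(** The weights depend on [E] and [K] only, so they are known before [B] and [F] are made small. *)
Fixpoint bad_weight k : nat := if k is k'.+1 then (size (K k) * bad_weight k')%N else 1.

Definition dim_weight k : nat :=
  if k is k'.+1 then (rc_rank E k * bad_weight k')%N else 1.

Lemma pm_bad k : pm mu (bad k) <= (bad_weight k)%:R * pm mu B.
Proof.
elim: k => [|k IH]; first by rewrite mul1r.
apply: le_trans (pm_bigU mu _ _) _ => [g|]; first exact: measurable_translate.
under eq_bigr do rewrite (pm_preimage_sact al _ (ms_measurable _)).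
rewrite big_const_seq count_predT iter_addr_0 -[leLHS]mulr_natl.
rewrite [bad_weight _]/(size (K k.+1) * bad_weight k)%N natrM -mulrA.
by rewrite ler_wpM2l.
Qed.

Lemma mdim_marking k (e : R) : pm mu B <= e -> pm mu F <= e ->
  mdim (marking k) <= (dim_weight k)%:R * e.
Proof.
move=> Be Fe; rewrite /mdim /sets_dim /=.
case: k => [|k]; first by rewrite big_ord1 mul1r.
rewrite (eq_bigr (fun=> pm mu (bad k)))// sumr_const card_ord -[leLHS]mulr_natl.
rewrite [dim_weight _]/(rc_rank E k.+1 * bad_weight k)%N natrM -mulrA ler_wpM2l//.
by rewrite (le_trans (pm_bad k))// ler_wpM2l.
Qed.

Section NormBound.
Hypotheses (norm0 : coef_norm Z 0 = 0) (norm1 : coef_norm Z 1 = 1).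

(** At almost every point [x] only the coefficient at [c x] is nonzero, and it has norm 1. *)
Lemma right_bounded_graph : right_bounded graph_elt 1.
Proof.
apply: (right_bounded_pointwise norm0 uT) => //.
  move=> g; apply: contraR => gT; rewrite coeff_graph chi_set0// => x /= cx.
  by rewrite -cx cT in gT.
have H (s : seq G) : {ae mu, forall x,
    \sum_(t <- s) coef_norm Z (Linf_fun (coeff graph_elt t) x) =
    \sum_(t <- s) coef_norm Z (bmeas_fun (chi_bmeas mu Z (fiber t)) x)}.
  elim: s => [|t s IH]; first by apply: aeW => x; rewrite !big_nil.
  apply: filterS2 IH (Linf_fun_class (chi_bmeas mu Z (fiber t))) => x IH Ex.
  by rewrite !big_cons IH coeff_graph [Linf_fun _ _]Ex.
apply: filterS (H T) => x ->; rewrite (bigD1_seq (c x))//= big1 => [|t tc].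
  by rewrite /bmeas_fun/= asboolT// norm1 addr0.
by rewrite /bmeas_fun/= asboolF// => ct; rewrite ct eqxx in tc.
Qed.

(** Each matrix entry of [small_bd] is an element of the group ring times [graph_elt] or an
    indicator. The latter act with norm at most 1, so the bound does not see [c], [B] and [F]. *)
Lemma mnorm_small_bd k (v : D k.+1) :
  mnorm (marking k) (small_bd v) <= bd_const E k * mnorm (marking k.+1) v.
Proof.
have H (I J : finType) (w : I -> J -> S) (b : I -> J -> R) (f : I -> S) :
    (forall i j, right_bounded (w i j) (b i j)) ->
    \sum_j crossed_norm (\sum_i f i * w i j) <=
    (\sum_i \sum_j b i j) * \sum_i crossed_norm (f i).
  move=> wb; apply: (@le_trans _ _ (\sum_i \sum_j crossed_norm (f i * w i j))).
    rewrite exchange_big; apply: ler_sum => j _; exact: crossed_norm_sum.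
  rewrite mulr_suml; apply: ler_sum => i _; rewrite mulr_suml.
  apply: ler_sum => j _; have [b0 /(_ (f i))/le_trans -> //] := wb i j.
  rewrite ler_wpM2l// (bigD1 i)//= lerDl sumr_ge0// => i' _.
  exact: crossed_norm_ge0.
pose w (i : 'I_(rc_rank E k.+1)) (j : 'I_(idx k)) :=
  ms_coord (into_marked (rc_d E k (delta_mx 0 i))) j.
have -> : mnorm (marking k) (small_bd v) = \sum_j crossed_norm (\sum_i ms_coord v i * w i j).
  apply: eq_bigr => j _; congr crossed_norm.
  rewrite -[LHS]/(ms_coord (small_bd v) j) ms_coord_sum; apply: eq_bigr => i _.
  by rewrite ms_coordZ.
suff [b wb ->] : exists2 b, forall i j, right_bounded (w i j) (b i j) &
    bd_const E k = \sum_i \sum_j b i j by exact: H.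
rewrite {H}/w; case: k {v} => [|k].
  exists (fun i _ => l1norm (\sum_j rc_d E 0 (delta_mx 0 i) 0 j *
         monom _ (rc_aug E (delta_mx 0 j) : Z) 1%g)).
    move=> i j; rewrite into_marked0 -[l1norm _]mulr1.
    apply: right_boundedM; first exact: right_bounded_incl.
    exact: right_bounded_graph.
  by apply: eq_bigr => i _; rewrite big_ord1.
exists (fun i j => l1norm (rc_d E k.+1 (delta_mx 0 i) 0 j)) => // i j.
rewrite into_markedS -[l1norm _]mulr1.
by apply: right_boundedM; [exact: right_bounded_incl|exact: right_bounded_mchi].
Qed.

End NormBound.

End SmallComplex.

(** * Vanishing *)

Section Lognorm.
Variables (R : realType) (G : groupType) (d : measure_display).
Variables (X : measurableType d) (mu : probability X R).
Variables (al : standardAction G mu) (Z : coefRing R).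
Local Notation S := (crossedRing al Z).
Variables (M N : lmodType S) (m : marking M) (n : marking N) (f : {linear M -> N}).

Lemma sets_dim_ge0 (I : finType) (B : I -> measurableSet X) : 0 <= sets_dim mu B.
Proof. by apply: sumr_ge0 => i _; exact: pm_ge0. Qed.

Lemma inf_ge0 (A : set R) : (forall x, A x -> 0 <= x) -> 0 <= inf A.
Proof.
move=> A0; have [->|/set0P A_neq0] := eqVneq A set0; first by rewrite inf0.
exact: lb_le_inf.
Qed.

Lemma inf_le (A : set R) x : (forall y, A y -> 0 <= y) -> A x -> inf A <= x.
Proof. by move=> A0 Ax; apply: ge_inf => //; exists 0. Qed.

Lemma logp_ge0 (t : R) : 0 <= logp t.
Proof. by rewrite /logp le_max lexx orbT. Qed.

Lemma le_logp (s t : R) : s <= t -> logp s <= logp t.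
Proof.
move=> st; have [s0|s0] := leP s 0.
  by rewrite {1}/logp ln0// maxxx logp_ge0.
by rewrite /logp ge_max !le_max lexx orbT ler_ln ?st// posrE ?(lt_le_trans s0).
Qed.

Lemma rk_ge0 (B : mk_index m -> measurableSet X) : 0 <= rk n f B.
Proof. by apply: inf_ge0 => _ [C [_ _ ->]]; exact: sets_dim_ge0. Qed.

Lemma lognorm'_ge0 (B : mk_index m -> measurableSet X) : 0 <= lognorm' n f B.
Proof.
by rewrite /lognorm' le_min !mulr_ge0 ?logp_ge0 ?sets_dim_ge0 ?rk_ge0.
Qed.

Lemma lognorm_ge0 : 0 <= lognorm m n f.
Proof.
apply: inf_ge0 => _ [k [B [_ ->]]]; apply: sumr_ge0 => j _; exact: lognorm'_ge0.
Qed.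

(** Take the decomposition into a single piece and the first term of the minimum. *)
Lemma lognorm_le (C : R) : 0 <= C -> (forall z, mnorm n (f z) <= C * mnorm m z) ->
  lognorm m n f <= mdim m * logp C.
Proof.
move=> C0 fC.
apply: (@le_trans _ _ (\sum_(j < 1) lognorm' n f (fun i => mk_set (m := m) i))).
  apply: inf_le => [_ [k [B [_ ->]]]|].
    by apply: sumr_ge0 => j _; exact: lognorm'_ge0.
  exists 1%N, (fun _ i => mk_set i); split => // i; split.
    by apply/trivIsetP => j k _ _; rewrite (ord1 j) (ord1 k) eqxx.
  by apply/seteqP; split => [x [j _]//|x ?]; exists ord0.
rewrite big_ord1 /lognorm' ge_min; apply/orP; left.
rewrite ler_wpM2l ?sets_dim_ge0//; apply: le_logp; apply: inf_le => [_ []//|].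
by split => // z _; exact: fC.
Qed.

End Lognorm.

Section Vanishing.
Variables (R : realType) (n : nat) (G : groupType).
Hypotheses (G_countable : countable [set: G]) (G_infinite : infinite_set [set: G]).
Hypotheses (G_amenable : amenable R G) (G_FP : typeFP G n.+1).
Variables (d : measure_display) (X : measurableType d) (mu : probability X R).
Variables (al : standardAction G mu) (Z : coefRing R).
Variable C : augmentedComplex (trivialMod G Z).
Hypothesis freeC : free_resolution C.

(** The bounds [b] are chosen before [k] and [e], so the differentials stay bounded while the
    dimension shrinks. The chain map is the composite through [E]. *)
Lemma small_embedding : exists b : nat -> R, forall (k : nat) (e : R), 0 < e ->
  exists D : markedComplex al Z,
    [/\ embeddable C n D, mdim (mc_marking D k) <= e &
     coef_norm Z 0 = 0 -> coef_norm Z 1 = 1 -> forall j z,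
       mnorm (mc_marking D j) (bd D j z) <= b j * mnorm (mc_marking D j.+1) z].
Proof.
have [E _] := typeFP_retract Z G_FP.
have [psi [psi_bd psi_aug]] := chain_map_to_retract E freeC.2.
have /choice[K KP] : forall k, exists s : seq G, forall i j h,
    coeff (rc_d E k (delta_mx 0 i) 0 j) h != 0 -> h \in s.
  move=> k.
  pose supp (i : 'I_(rc_rank E k.+1)) (j : 'I_(rc_rank E k)) : seq G :=
    sval (cid2 (finsupp_seq (coeff_finsupp (rc_d E k (delta_mx 0 i) 0 j)))).
  exists (flatten [seq flatten [seq supp i j | j <- enum 'I_(rc_rank E k)] |
                       i <- enum 'I_(rc_rank E k.+1)]) => i j h hij.
  apply/flatten_mapP; exists i; rewrite ?mem_enum//.
  apply/flatten_mapP; exists j; rewrite ?mem_enum//.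
  by rewrite /supp; case: cid2 => s us /= sP; apply: sP.
exists (bd_const E) => k e e0.
pose w := dim_weight E K k.
(* The dimension in degree [k] is at most [w] times the measure allowed for [B] and [F]; [w.+1]
   avoids dividing by 0. *)
have e'0 : 0 < e / w.+1%:R by rewrite divr_gt0.
have [c [T [B [F [[uT cT mc] [mB mF Be Fe] cK cF]]]]] :=
  rokhlin al G_countable G_amenable G_infinite (K 0%N) e'0.
pose B' := MeasurableSet mB; pose F' := MeasurableSet mF.
have cF' x : (F' : set X) (al (c x)^-1%g x) by exact: cF.
have cK' g x : g \in K 0%N -> ~ (B' : set X) x -> c (al g^-1%g x) = (g^-1 * c x)%g.
  exact: cK.
pose D := small_marked_complex (E := E) KP uT cT mc cK' cF'.
exists D; split.
- exists (fun k x => into_marked K T B' mc cF' (psi k x)); split.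
  + by move=> j _ a x y; rewrite linearP into_marked_linear.
  + move=> j jn x; rewrite -psi_bd//.
    exact: (small_bd_into KP uT cT mc cK' cF' (psi j.+1 x)).
  + move=> x; rewrite -psi_aug.
    exact: (small_aug_into K B' uT cT mc cF' (psi 0%N x)).
- apply: le_trans (mdim_marking al E K k (B := B') (F := F') Be Fe) _.
  rewrite -/w mulrCA ler_piMr ?(ltW e0)// ler_pdivrMr// mul1r ler_nat.
  exact: leqnSn.
- move=> norm0 norm1 j z.
  exact: (mnorm_small_bd uT cT mc cF' norm0 norm1 z).
Qed.

Lemma medim_eq0 : medim al C n = 0%E.
Proof.
have [b emb] := small_embedding.
apply/eqP; rewrite eq_le; apply/andP; split; last first.
  by apply: le_ereal_inf_tmp => _ [D _ ->]; rewrite lee_fin sets_dim_ge0.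
apply/lee_addgt0Pr => e e0; rewrite add0e.
have [D [DC De _]] := emb n e e0.
by apply: ge_ereal_inf; exists (mdim (mc_marking D n))%:E => //; exists D.
Qed.

(** The differential starts in degree [n.+1], so the dimension is made small there, while the
    logarithm of its norm stays bounded. *)
Lemma mevol_eq0 : coef_norm Z 0 = 0 -> coef_norm Z 1 = 1 -> mevol al C n = 0%E.
Proof.
move=> norm0 norm1; have [b emb] := small_embedding.
apply/eqP; rewrite eq_le; apply/andP; split; last first.
  by apply: le_ereal_inf_tmp => _ [D _ ->]; rewrite lee_fin lognorm_ge0.
apply/lee_addgt0Pr => e e0; rewrite add0e.
pose c := Num.max (b n) 0.
have l0 : 0 <= logp c by exact: logp_ge0.
(* Adding 1 avoids dividing by 0, as [logp c] vanishes when [c] is at most 1. *)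
have e'0 : 0 < e / (logp c + 1) by rewrite divr_gt0// ltr_wpDl.
have [D [DC De Db]] := emb n.+1 _ e'0.
apply: ge_ereal_inf.
exists (lognorm (mc_marking D n.+1) (mc_marking D n) (bd D n))%:E; first by exists D.
rewrite lee_fin; apply: le_trans (lognorm_le (C := c) _ _) _.
- by rewrite /c le_max lexx orbT.
- move=> z; apply: le_trans (Db norm0 norm1 n z) _.
  apply: ler_wpM2r; last by rewrite /c le_max lexx.
  by apply: sumr_ge0 => i _; exact: crossed_norm_ge0.
apply: (@le_trans _ _ (e / (logp c + 1) * logp c)); first by rewrite ler_wpM2r.
by rewrite mulrAC -mulrA ler_piMr ?(ltW e0)// ler_pdivrMr ?ltr_wpDl// mul1r lerDl.
Qed.

End Vanishing.

Theorem theorem1p4 (R : realType) (n : nat) (G : groupType)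
    (G_countable : countable [set: G]) (G_infinite : infinite_set [set: G])
    (G_amenable : amenable R G) (G_FP : typeFP G n.+1)
    (d : measure_display) (X : measurableType d) (mu : probability X R)
    (al : standardAction G mu) :
  [/\ forall C : augmentedComplex (trivialMod G (coefInt R)),
        free_resolution C -> medim al C n = 0%E,
      forall (F : finFieldType) (C : augmentedComplex (trivialMod G (coefFin R F))),
        free_resolution C -> medim al C n = 0%E &
      forall C : augmentedComplex (trivialMod G (coefInt R)),
        free_resolution C -> mevol al C n = 0%E].
Proof.
split=> [C freeC|F C freeC|C freeC]; [exact: medim_eq0|exact: medim_eq0|].
by apply: mevol_eq0 => //; rewrite /= /int_norm (normr0, normr1).
Qed.
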